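(* Let $n\ge 3$ and let $s>0$. Suppose that for every $u_0\in H^s(\mathbb{R}^n)$ the solution $u$ of the Schrödinger equation $i\partial_t u+\Delta u=0$ on $\mathbb{R}^{n+1}$ with initial datum $u(\cdot,0)=u_0$ satisfies $$\lim_{t\to 0}u(x,t)=u_0(x)\qquad\text{for almost every } x\in\mathbb{R}^n .$$ Then $s\ge \frac12-\frac{1}{n+2}$.
   Context: $H^s(\mathbb{R}^n)$ is the inhomogeneous $L^2(\mathbb{R}^n)$-Sobolev space, defined via the Fourier transform as usual. When the initial datum $u_0$ is a Schwartz function, the solution can be written as $$u(x,t)=e^{it\Delta}u_0(x)=\int_{\mathbb{R}^n}\widehat{u}_0(\xi)\,e^{2\pi i x\cdot\xi-4\pi^2 i t|\xi|^2}\,d\xi ,$$ where $\widehat{u}_0$ denotes the Fourier transform of $u_0$. *)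

(* Defs.v *)
From HB Require Import structures.
From mathcomp Require Import all_boot all_order all_algebra.
From mathcomp Require Import complex.
From mathcomp Require Import all_classical all_reals all_analysis.

Set Implicit Arguments.
Unset Strict Implicit.
Unset Printing Implicit Defensive.

Import Order.TTheory GRing.Theory Num.Theory.
Import numFieldNormedType.Exports.

Local Open Scope classical_set_scope.
Local Open Scope ring_scope.
Local Open Scope complex_scope.

(** R^n carries the product Borel sigma-algebra of [n.-tuple]. *)
Notation euclid R n := (n.-tuple (measurableTypeR R)).

Section consing.
Context (R : realType) (n : nat).

Definition consT (p : measurableTypeR R * euclid R n) : euclid R n.+1 :=
  [the n.+1.-tuple _ of p.1 :: p.2].

Lemma measurable_consT : measurable_fun setT consT.
Proof. exact: measurable_cons. Qed.

Context (mu : {sigma_finite_measure set (euclid R n) -> \bar R}).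

Definition leb_cons : set (euclid R n.+1) -> \bar R :=
  pushforward (@lebesgue_measure R \x mu)%E consT.

Let leb_cons0 : leb_cons set0 = 0%E.
Proof. by rewrite /leb_cons /pushforward preimage_set0 measure0. Qed.

Let leb_cons_ge0 A : (0 <= leb_cons A)%E.
Proof. by rewrite /leb_cons /pushforward; exact: measure_ge0. Qed.

Let leb_cons_sigma_additive : semi_sigma_additive leb_cons.
Proof.
move=> F mF tF mUF; rewrite /leb_cons /pushforward preimage_bigcup.
apply: measure_semi_sigma_additive.
- by move=> k; rewrite -[X in measurable X]setTI; exact: measurable_consT.
- apply/trivIsetP => /= i j _ _ ij; rewrite -preimage_setI.
  by move/trivIsetP : tF => /(_ _ _ _ _ ij) ->//; rewrite preimage_set0.
- rewrite -preimage_bigcup -[X in measurable X]setTI.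
  exact: measurable_consT.
Qed.

HB.instance Definition _ := isMeasure.Build _ _ _ leb_cons
  leb_cons0 leb_cons_ge0 leb_cons_sigma_additive.

Lemma leb_cons_sigma_finite : sigma_finite setT leb_cons.
Proof.
have /sigma_finiteP[F [TF ndF Foo]] := sigma_finiteT (@lebesgue_measure R).
have /sigma_finiteP[G [TG ndG Goo]] := sigma_finiteT mu.
exists (fun k => [set t | F k (thead t) /\ G k [tuple of behead t]]).
  rewrite predeqE => t; split=> // _.
  have [i _ Fi] : (\bigcup_k F k) (thead t) by rewrite -TF.
  have [j _ Gj] : (\bigcup_k G k) [tuple of behead t] by rewrite -TG.
  exists (maxn i j) => //; split.
  - by move: Fi; exact/subsetPset/ndF/leq_maxl.
  - by move: Gj; exact/subsetPset/ndG/leq_maxr.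
move=> k; have [mF oF] := Foo k; have [mG oG] := Goo k; split.
  apply: measurableI.
  - by rewrite -[X in measurable X]setTI; exact: measurable_tnth.
  - by rewrite -[X in measurable X]setTI; exact: measurable_behead.
rewrite /leb_cons /pushforward.
rewrite (_ : _ @^-1` _ = F k `*` G k); last first.
  have tE p : [tuple of behead (consT p)] = p.2 by exact: val_inj.
  by apply/seteqP; split => -[x t] /=; rewrite tE theadE.
by rewrite product_measure1E// lte_mul_pinfty// ge0_fin_numE.
Qed.

HB.instance Definition _ :=
  Measure_isSigmaFinite.Build _ _ _ leb_cons leb_cons_sigma_finite.

End consing.

(** Lebesgue measure on R^n: the n-fold product of [lebesgue_measure]. *)
Fixpoint leb (R : realType) (n : nat) :
    {sigma_finite_measure set (euclid R n) -> \bar R} :=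
  match n with
  | 0 => \d_([tuple] : euclid R 0)
  | m.+1 => leb_cons (leb R m)
  end.

Lemma leb_box (R : realType) n (A : 'I_n -> set (measurableTypeR R)) :
  (forall i, measurable (A i)) ->
  leb R n [set t | forall i, A i (tnth t i)] =
  (\prod_(i < n) lebesgue_measure (A i))%E.
Proof.
elim: n A => [|n IH] A mA.
  by rewrite big_ord0 /= diracE mem_set//= => -[].
have mbox m (B : 'I_m -> set (measurableTypeR R)) :
    (forall i, measurable (B i)) ->
    measurable [set t : euclid R m | forall i, B i (tnth t i)].
  move=> mB; have -> : [set t : euclid R m | forall i, B i (tnth t i)] =
      \bigcap_(i in [set: 'I_m]) ((fun t => tnth t i) @^-1` B i).
    by apply/seteqP; split => t /= h i; [move=> _|]; apply: h.
  apply: fin_bigcap_measurable; first by [].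
  by move=> i _; rewrite -[X in measurable X]setTI; exact: measurable_tnth.
rewrite big_ord_recl -IH // /= /leb_cons /pushforward.
have -> : @consT R n @^-1` [set t | forall i, A i (tnth t i)] =
    A ord0 `*` [set t | forall i, A (lift ord0 i) (tnth t i)].
  apply/seteqP; split => -[x t] /=.
    move=> h; split; first by have := h ord0.
    by move=> i; have := h (lift ord0 i); rewrite tnthS.
  by move=> [h1 h2] i; case: (unliftP ord0 i) => [j ->|->] //; rewrite tnthS.
rewrite product_measure1E //.
exact: (mbox n (fun i => A (lift ord0 i))).
Qed.

Section schrodinger.
Context (R : realType) (n : nat).
Local Notation C := R[i].
Local Notation E := (euclid R n).
Local Notation normc := (@Normc.normc R).
Local Notation Re := (@complex.Re R).
Local Notation Im := (@complex.Im R).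

Definition dot (x y : E) : R := \sum_(i < n) tnth x i * tnth y i.

Definition cexpi (theta : R) : C := cos theta +i* sin theta.

Definition cintegral (D : set E) (f : E -> C) : C :=
  (\int[leb R n]_(x in D) Re (f x))
    +i* (\int[leb R n]_(x in D) Im (f x)).

Definition cmeasurable (f : E -> C) : Prop :=
  measurable_fun setT (Re \o f) /\ measurable_fun setT (Im \o f).

Definition sqL2norm (f : E -> C) : \bar R :=
  (\int[leb R n]_x (normc (f x) ^+ 2)%:E)%E.

Definition L2 (f : E -> C) : Prop := cmeasurable f /\ (sqL2norm f < +oo)%E.

Definition cvg_L2 (F : nat -> E -> C) (f : E -> C) : Prop :=
  sqL2norm (fun x => F N x - f x) @[N --> \oo] --> 0%E.

Definition eball (N : nat) : set E := [set x | dot x x <= N%:R ^+ 2].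

(** [g] is the L^2 (Plancherel) Fourier transform of [f]; it is determined by
    [f] up to a null set. *)
Definition fourier_L2 (f g : E -> C) : Prop :=
  [/\ L2 f, L2 g &
    cvg_L2 (fun N xi => cintegral (eball N)
              (fun x => f x * cexpi (- (2 * pi * dot x xi)))) g].

(** Membership in H^s(R^n) for [0 <= s]: elements are functions in L^2. *)
Definition sobolev (s : R) (f : E -> C) : Prop :=
  exists2 g, fourier_L2 f g &
    (\int[leb R n]_xi ((1 + dot xi xi) `^ s * normc (g xi) ^+ 2)%:E < +oo)%E.

Definition schrodinger_on (D : set E) (g : E -> C) (x : E) (t : R) : C :=
  cintegral D (fun xi =>
    g xi * cexpi (2 * pi * dot x xi - 4 * pi ^+ 2 * t * dot xi xi)).

(** [u x t] is a version of the solution e^{it Delta} u0 of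
    i du/dt + Delta u = 0 with datum [u0] in L^2: for each [t] the Fourier
    integral over |xi| <= N converges to [u ^~ t] in L^2, which determines
    [u ^~ t] up to a null set depending on [t]; when that integral is absolutely
    convergent (e.g. for Schwartz [u0]), [u] is given by it at every point. *)
Definition schrodinger_solution (u0 : E -> C) (u : E -> R -> C) : Prop :=
  exists2 g, fourier_L2 u0 g &
    (forall t, L2 (u ^~ t) /\
       cvg_L2 (fun N x => schrodinger_on (eball N) g x t) (u ^~ t)) /\
    ((\int[leb R n]_xi (normc (g xi))%:E < +oo)%E ->
       forall x t, u x t = schrodinger_on setT g x t).

End schrodinger.

(* Main.v *)
(** The idea: if [s < n / (2 (n + 2))] then there are data [f] of arbitrarily
    small H^s norm, together with finite sets of arbitrarily small times, such
    that at every point of a fixed cube the evolution of [f] is huge at one of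
    these times.  Up to a profile [phi], such an [f] is a product over [i < n]
    of the exponential sums
      [\sum_(m < M) cexpi (2 * pi * (v i + D * m) * x_i)],
    with [D = Q ^ n.+1], [Q] a multiple of [M] and [v i = Q ^ (n - i) / 2].  At
    times with [2 * pi * t = k / D ^ 2] the quadratic phases of the nodes are
    aligned, while the offsets [v i] translate the i-th coordinate by
    [k / Q ^ i.+1] in units of [1 / D]; the base-Q digits of [k] can thus be
    chosen so that all [n] sums are simultaneously of size comparable to [M].
    All frequencies are at most [Q ^ n.+2], and [M ^ (n / 2)] beats
    [Q ^ ((n + 2) * s)].

    A sum of rapidly decreasing data of this kind, with the i-th one chosen
    after the times of the previous ones, belongs to H^s.  At the times of the
    j-th block the later blocks are negligible in L^2 of the cube, by a Bessel
    inequality for the weight [phi (x_0) * ... * phi (x_n.-1)], whose transform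
    has a bounded Schur norm.  By Chebyshev and a union bound, at some point of
    the cube the solution converges while it is unbounded along these times. *)

Require Import Defs.
From mathcomp Require Import all_boot all_order all_algebra.
From mathcomp Require Import complex ring lra.
From mathcomp Require Import all_classical all_reals all_analysis.
From mathcomp Require Import measurable_realfun.
Set Implicit Arguments.
Unset Strict Implicit.
Unset Printing Implicit Defensive.
Import Order.TTheory GRing.Theory Num.Theory.
Import numFieldNormedType.Exports.
Local Open Scope classical_set_scope.
Local Open Scope ring_scope.

(** * Real and complex integrals of integrable functions *)

(** Two demands meet in [D = Q ^ n.+1]. The integer [k] needs [Q ^ n] values to have a free digit
    for each coordinate; and over the time [k / D ^ 2] a wave packet of frequency at most about
    [D * M] moves by about [k * M / D], which must stay below a small constant so that it remains
    near the cube. With [Q = q * M] and [q] a large constant both hold. The exponent comes from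
    balancing: each of the [n] sums has modulus about [M] at a good time but L^2 norm about
    [M ^ (1 / 2)], and the frequency costs [Q ^ ((n + 2) * s)] in H^s. A gain remains exactly when
    [(n + 2) * s < n / 2], that is [s < 1 / 2 - 1 / (n + 2)]. A solution is determined at each time
    only up to a null set depending on that time. This is why every block comes with finitely many
    times: a bad set per time can be summed, and later blocks can be made small relative to the
    number of times already fixed. Earlier blocks are not small; their transforms are integrable, so
    their evolutions are bounded by a constant at every point, and the next block is made to exceed
    that constant. *)

Notation L1 mu f := (mu.-integrable setT (EFin \o f)).

Section L1_theory.
Context d (T : measurableType d) (R : realType).
Variable mu : {measure set T -> \bar R}.
Implicit Types f g : T -> R.

Lemma L1_measurable f : L1 mu f -> measurable_fun setT f.
Proof. by move=> /measurable_int /measurable_EFinP. Qed.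

Lemma L1P f : measurable_fun setT f ->
  (\int[mu]_x `|f x|%:E < +oo)%E -> L1 mu f.
Proof. by move=> mf h; apply/integrableP; split => //; exact/measurable_EFinP. Qed.

Lemma L1_lty f : L1 mu f -> (\int[mu]_x `|f x|%:E < +oo)%E.
Proof. by move=> /integrableP[]. Qed.

Lemma L1_le f g : measurable_fun setT f -> L1 mu g ->
  (forall x, `|f x| <= `|g x|) -> L1 mu f.
Proof.
move=> mf ig fg; apply: le_integrable ig => //; first exact/measurable_EFinP.
by move=> x _ /=; rewrite lee_fin fg.
Qed.

Lemma L1_bdM (B : R) f g : measurable_fun setT g -> (forall x, `|g x| <= B) ->
  L1 mu f -> L1 mu (fun x => f x * g x).
Proof.
move=> mg gB If.
apply: (@L1_le _ (fun x => B * f x)).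
- by apply: measurable_funM => //; exact: L1_measurable If.
- exact: (integrableZl measurableT B If).
- move=> x; rewrite mulrC !normrM ler_wpM2r//.
  by rewrite (le_trans (gB x))// ler_norm.
Qed.

Lemma L1Z (k : R) f : L1 mu f -> L1 mu (fun x => k * f x).
Proof. by move=> If; apply: (integrableZl measurableT k If). Qed.

Lemma L1D f g : L1 mu f -> L1 mu g -> L1 mu (fun x => f x + g x).
Proof. by move=> If Ig; apply: (integrableD measurableT If Ig). Qed.

Lemma L1B f g : L1 mu f -> L1 mu g -> L1 mu (fun x => f x - g x).
Proof. by move=> If Ig; apply: (integrableB measurableT If Ig). Qed.

Lemma L1_norm f : L1 mu f -> L1 mu (fun x => `|f x|).
Proof. exact: integrable_norm. Qed.

Lemma L1_sum I (s : seq I) (h : I -> T -> R) :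
  (forall i, L1 mu (h i)) -> L1 mu (fun x => \sum_(i <- s) h i x).
Proof.
move=> ih; elim: s => [|i s IH].
  by under eq_fun do rewrite big_nil; exact: integrable0.
by under eq_fun do rewrite big_cons; apply: L1D.
Qed.

Lemma Rint_sum I (s : seq I) (h : I -> T -> R) :
  (forall i, L1 mu (h i)) ->
  \int[mu]_x (\sum_(i <- s) h i x) = \sum_(i <- s) \int[mu]_x h i x.
Proof.
move=> ih; elim: s => [|i s IH].
  rewrite big_nil; under eq_Rintegral do rewrite big_nil.
  by rewrite Rintegral_cst// mul0r.
rewrite big_cons -IH -RintegralD//; last exact: L1_sum.
by apply: eq_Rintegral => x _; rewrite big_cons.
Qed.

Lemma EFin_Rint f : L1 mu f -> (\int[mu]_x f x)%:E = (\int[mu]_x (f x)%:E)%E.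
Proof. by move=> If; rewrite /Rintegral fineK//; exact: integrable_fin_num. Qed.

Lemma le_norm_Rint f g : L1 mu f -> L1 mu g -> (forall x, `|f x| <= g x) ->
  `|\int[mu]_x f x| <= \int[mu]_x g x.
Proof.
move=> If Ig fg; apply: le_trans (le_normr_Rintegral _ _) _ => //.
by apply: le_Rintegral => //; exact: L1_norm.
Qed.

End L1_theory.

(** * Fubini for integrable factors and a bounded kernel *)

Section L1_prod.
Context d1 d2 (T1 : measurableType d1) (T2 : measurableType d2) (R : realType).
Variable m1 : {sigma_finite_measure set T1 -> \bar R}.
Variable m2 : {sigma_finite_measure set T2 -> \bar R}.
Implicit Types (f : T1 -> R) (g : T2 -> R) (k : T1 * T2 -> R).

(** Tonelli gives measurability for the positive and the negative part; composing their difference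
    with the measurable [fine] also covers the points where the integral is infinite. *)
Lemma measurable_fun_Rint k : measurable_fun setT k ->
  measurable_fun setT (fun x => \int[m2]_y k (x, y)).
Proof.
move=> mk.
have mEk : measurable_fun setT (EFin \o k) by exact/measurable_EFinP.
apply: measurableT_comp => //.
rewrite [X in measurable_fun _ X](_ : _ =
  (fun x => \int[m2]_y (EFin \o k)^\+ (x, y)) \-
  (fun x => \int[m2]_y (EFin \o k)^\- (x, y)))%E.
  apply: emeasurable_funB.
    by apply: measurable_fun_fubini_tonelli_F => //; exact: measurable_funepos.
  by apply: measurable_fun_fubini_tonelli_F => //; exact: measurable_funeneg.
apply/funext => x; rewrite integralE.

congr (_ - _)%E; apply: eq_integral => y _; [rewrite funeposE|rewrite funenegE]; by rewrite ?funeposE ?funenegE.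
Qed.

(** All double integrals below have this shape: one integrable factor per variable and a bounded
    kernel, such as a cosine or a transform of a bump. *)
Lemma L1_prod (B : R) f g k : L1 m1 f -> L1 m2 g -> measurable_fun setT k ->
  (forall z, `|k z| <= B) -> L1 (m1 \x m2)%E (fun z => f z.1 * g z.2 * k z).
Proof.
move=> If Ig mk kB.
have mf := L1_measurable If; have mg := L1_measurable Ig.
have mfg : measurable_fun setT (fun z : T1 * T2 => f z.1 * g z.2).
  by apply: measurable_funM; apply: measurableT_comp.
apply: (@L1_bdM _ _ _ _ B) => //.
apply/integrable12ltyP; first exact/measurable_EFinP.
rewrite /= (_ : (fun _ => _) =
  (fun x => `|f x|%:E * \int[m2]_y (`|g y|)%:E)%E); last first.
  apply/funext => x; rewrite -ge0_integralZl//=.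
    by apply: eq_integral => y _; rewrite normrM EFinM.
  by apply/measurable_EFinP; apply: measurableT_comp.
have [r r0 ->] : exists2 r : R, 0 <= r & (\int[m2]_y (`|g y|)%:E = r%:E)%E.
  exists (\int[m2]_y `|g y|); first exact: Rintegral_ge0.
  by rewrite EFin_Rint//; exact: L1_norm.
rewrite ge0_integralZr//=; last by apply/measurable_EFinP; apply: measurableT_comp.
by rewrite muleC; apply: lte_mul_pinfty => //; exact: L1_lty.
Qed.

Lemma Rint_prod_L1 (B : R) f g k : L1 m1 f -> L1 m2 g -> measurable_fun setT k ->
  (forall z, `|k z| <= B) -> L1 m1 (fun x => f x * \int[m2]_y (g y * k (x, y))).
Proof.
move=> If Ig mk kB.
have mf := L1_measurable If; have mg := L1_measurable Ig.
apply: (@L1_bdM _ _ _ _ (\int[m2]_y (B * `|g y|))) => //.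
  apply: (@measurable_fun_Rint (fun z => g z.2 * k z)).
  by apply: measurable_funM => //; apply: measurableT_comp.
move=> x.
have mkx : measurable_fun setT (fun y => k (x, y)).
  exact: (measurableT_comp mk (pair1_measurable x)).
apply: le_norm_Rint.
- by apply: (@L1_bdM _ _ _ _ B).
- exact/L1Z/L1_norm.
- by move=> y; rewrite normrM mulrC ler_wpM2r.
Qed.

Lemma Rint_Fubini (B : R) f g k : L1 m1 f -> L1 m2 g -> measurable_fun setT k ->
  (forall z, `|k z| <= B) ->
  \int[m1]_x (f x * \int[m2]_y (g y * k (x, y))) =
  \int[m2]_y (g y * \int[m1]_x (f x * k (x, y))).
Proof.
move=> If Ig mk kB.
have mkx x : measurable_fun setT (fun y => k (x, y)).
  exact: (measurableT_comp mk (pair1_measurable x)).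
have mky y : measurable_fun setT (fun x => k (x, y)).
  exact: (measurableT_comp mk (pair2_measurable y)).
rewrite /Rintegral; congr fine.
transitivity (\int[m1]_x \int[m2]_y (f x * g y * k (x, y))%:E)%E.
  apply: eq_integral => x _.
  rewrite -RintegralZl//; last by apply: (@L1_bdM _ _ _ _ B).
  rewrite EFin_Rint; last by apply: L1Z; apply: (@L1_bdM _ _ _ _ B).
  by apply: eq_integral => y _; rewrite mulrA.
rewrite (Fubini (L1_prod If Ig mk kB)).
apply: eq_integral => y _.
rewrite -[in RHS]RintegralZl//; last by apply: (@L1_bdM _ _ _ _ B).
rewrite EFin_Rint; last by apply: L1Z; apply: (@L1_bdM _ _ _ _ B).
by apply: eq_integral => x _ /=; rewrite mulrA (mulrC (g y)).
Qed.

End L1_prod.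

(** * Translation invariance on the line *)

Section lebesgue_shift.
Context (R : realType).
Local Notation mu := (@lebesgue_measure R).

Let shiftf (a : R) (x : measurableTypeR R) : measurableTypeR R := x + a.

Let mshift (a : R) : measurable_fun setT (shiftf a).
Proof. exact: measurable_funD. Qed.

Lemma lebesgue_measure_shift (a : R) (A : set (measurableTypeR R)) : measurable A ->
  pushforward mu (shiftf a) A = mu A.
Proof.
move=> mA; apply/esym/lebesgue_measure_unique => //=.
move=> _ [[b c]] _ <-.
rewrite /pushforward (_ : _ @^-1` _ = `]b - a, c - a]%classic); last first.
  by apply/seteqP; split => x /=; rewrite /shiftf !in_itv/= ltrBlDr lerBrDr.
rewrite !lebesgue_measure_itv/= !lte_fin ltrD2r.
by case: ifP => // _; rewrite -!EFinD; congr EFin; ring.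
Qed.

Lemma ge0_integral_shift (f : measurableTypeR R -> \bar R) (a : R) :
  measurable_fun setT f -> (forall x, 0 <= f x)%E ->
  (\int[mu]_x f (x + a)%R = \int[mu]_x f x)%E.
Proof.
move=> mf f0.
transitivity (\int[pushforward mu (shiftf a)]_x f x)%E.
  by rewrite ge0_integral_pushforward//= ?preimage_setT//; exact: mshift.
apply: eq_measure_integral => A mA _; exact: lebesgue_measure_shift.
Qed.

Lemma L1_shift (f : R -> R) (a : R) : L1 mu f -> L1 mu (fun x => f (x + a)).
Proof.
move=> If; have mf := L1_measurable If.
apply: L1P; first exact: (measurableT_comp mf (mshift a)).
rewrite (ge0_integral_shift (f := fun x => `|f x|%:E))//; first exact: L1_lty.
by apply/measurable_EFinP; apply: measurableT_comp.
Qed.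

Lemma Rint_shift (f : R -> R) (a : R) : L1 mu f ->
  \int[mu]_x f (x + a) = \int[mu]_x f x.
Proof.
move=> If; have mf := L1_measurable If; rewrite /Rintegral; congr fine.
rewrite integralE [RHS]integralE; congr (_ - _)%E.
  rewrite -[RHS](ge0_integral_shift a)//.
    by apply: eq_integral => x _; rewrite !funeposE.
  by apply: measurable_funepos; exact/measurable_EFinP.
rewrite -[RHS](ge0_integral_shift a)//.
  by apply: eq_integral => x _; rewrite !funenegE.
by apply: measurable_funeneg; exact/measurable_EFinP.
Qed.

End lebesgue_shift.

(** * Complex-valued integrals *)

Section cint.
Context d (T : measurableType d) (R : realType).
Variable mu : {measure set T -> \bar R}.
Local Notation C := R[i].
Local Notation normc := (@Normc.normc R).
Local Notation Re := (@complex.Re R).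
Local Notation Im := (@complex.Im R).
Implicit Types f g : T -> C.

(** For [leb R n] this is [cintegral setT] by conversion; a general measure is allowed because the
    integrals are factored into one-dimensional ones. *)
Definition cint f : C :=
  Complex (\int[mu]_x Re (f x)) (\int[mu]_x Im (f x)).

Definition cL1 f := L1 mu (Re \o f) /\ L1 mu (Im \o f).

Definition cmeas f := measurable_fun setT (Re \o f) /\ measurable_fun setT (Im \o f).

Lemma cReM (a b : C) : Re (a * b) = Re a * Re b - Im a * Im b.
Proof. by case: a b => [? ?] [? ?]. Qed.

Lemma cImM (a b : C) : Im (a * b) = Re a * Im b + Im a * Re b.
Proof. by case: a b => [? ?] [? ?]. Qed.

Lemma cReD (a b : C) : Re (a + b) = Re a + Re b.
Proof. by case: a b => [? ?] [? ?]. Qed.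

Lemma cImD (a b : C) : Im (a + b) = Im a + Im b.
Proof. by case: a b => [? ?] [? ?]. Qed.

Lemma cReN (a : C) : Re (- a) = - Re a. Proof. by case: a. Qed.
Lemma cImN (a : C) : Im (- a) = - Im a. Proof. by case: a. Qed.

Lemma ReIm_sum (I : Type) (s : seq I) (F : I -> C) :
  Re (\sum_(i <- s) F i) = \sum_(i <- s) Re (F i) /\
  Im (\sum_(i <- s) F i) = \sum_(i <- s) Im (F i).
Proof.
elim: s => [|i s [IH1 IH2]]; first by rewrite !big_nil.
by rewrite !big_cons cReD cImD IH1 IH2.
Qed.

Lemma complexP (a b : C) : Re a = Re b -> Im a = Im b -> a = b.
Proof. by case: a b => [? ?] [? ?] /= -> ->. Qed.

Lemma normc_sqr (z : C) : normc z ^+ 2 = Re z ^+ 2 + Im z ^+ 2.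
Proof. by case: z => a b /=; rewrite sqr_sqrtr// addr_ge0// sqr_ge0. Qed.

Lemma normc_ge0 (z : C) : 0 <= normc z.
Proof. by case: z => a b /=; exact: sqrtr_ge0. Qed.

Lemma Re_le_normc (z : C) : `|Re z| <= normc z.
Proof.
rewrite -(ler_pXn2r (n := 2))// ?nnegrE ?normc_ge0//.
by rewrite normc_sqr real_normK ?num_real// lerDl sqr_ge0.
Qed.

Lemma Im_le_normc (z : C) : `|Im z| <= normc z.
Proof.
rewrite -(ler_pXn2r (n := 2))// ?nnegrE ?normc_ge0//.
by rewrite normc_sqr real_normK ?num_real// lerDr sqr_ge0.
Qed.

Lemma normc_le_ReIm (z : C) : normc z <= `|Re z| + `|Im z|.
Proof.
rewrite -(ler_pXn2r (n := 2))// ?nnegrE ?normc_ge0// ?addr_ge0//.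
rewrite normc_sqr sqrrD !real_normK ?num_real//.
by rewrite addrAC lerDl mulrn_wge0// mulr_ge0.
Qed.

Lemma cmeasM f g : cmeas f -> cmeas g -> cmeas (fun x => f x * g x).
Proof.
move=> [f1 f2] [g1 g2]; split.
  rewrite (_ : _ \o _ = fun x => Re (f x) * Re (g x) - Im (f x) * Im (g x)).
    by apply: measurable_funB; apply: measurable_funM.
  by apply/funext => x; rewrite /= cReM.
rewrite (_ : _ \o _ = fun x => Re (f x) * Im (g x) + Im (f x) * Re (g x)).
  by apply: measurable_funD; apply: measurable_funM.
by apply/funext => x; rewrite /= cImM.
Qed.

Lemma measurable_normc f : cmeas f -> measurable_fun setT (normc \o f).
Proof.
move=> [f1 f2].
rewrite (_ : _ \o _ = fun x => Num.sqrt (Re (f x) ^+ 2 + Im (f x) ^+ 2)).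
  apply: (measurableT_comp (f := @Num.sqrt R)); last first.
    by apply: measurable_funD; apply: measurable_funX.
  by apply: continuous_measurable_fun; exact: sqrt_continuous.
by apply/funext => x /=; case: (f x).
Qed.

Lemma cL1_cmeas f : cL1 f -> cmeas f.
Proof. by move=> [/L1_measurable ? /L1_measurable ?]. Qed.

Lemma cL1P f : cL1 f <-> cmeas f /\ L1 mu (normc \o f).
Proof.
split=> [If|[mf In]].
  have mf := cL1_cmeas If; split => //; case: If => If1 If2.
  apply: (@L1_le _ _ _ _ _ (fun x => `|Re (f x)| + `|Im (f x)|)).
  - exact: measurable_normc.
  - by apply: L1D; apply: L1_norm.
  - move=> x /=; rewrite ger0_norm ?normc_ge0// ger0_norm ?addr_ge0//.
    exact: normc_le_ReIm.
split; apply: (L1_le _ In); try exact: mf.1; try exact: mf.2.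
  by move=> x /=; rewrite (ger0_norm (normc_ge0 _)) Re_le_normc.
by move=> x /=; rewrite (ger0_norm (normc_ge0 _)) Im_le_normc.
Qed.

Lemma cL1Z (a : C) f : cL1 f -> cL1 (fun x => a * f x).
Proof.
move=> [If1 If2]; split.
  rewrite (_ : _ \o _ = fun x => Re a * Re (f x) - Im a * Im (f x)).
    by apply: L1B; apply: L1Z.
  by apply/funext => x /=; rewrite cReM.
rewrite (_ : _ \o _ = fun x => Re a * Im (f x) + Im a * Re (f x)).
  by apply: L1D; apply: L1Z.
by apply/funext => x /=; rewrite cImM.
Qed.

Lemma cintZ (a : C) f : cL1 f -> cint (fun x => a * f x) = a * cint f.
Proof.
move=> [If1 If2]; apply: complexP; rewrite /= ?cReM ?cImM.
  under eq_Rintegral do rewrite cReM.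
  by rewrite RintegralB ?RintegralZl//; exact: L1Z.
under eq_Rintegral do rewrite cImM.
by rewrite RintegralD ?RintegralZl//; exact: L1Z.
Qed.

Lemma cint_sum (I : Type) (s : seq I) (F : I -> T -> C) : (forall i, cL1 (F i)) ->
  cint (fun x => \sum_(i <- s) F i x) = \sum_(i <- s) cint (F i).
Proof.
move=> IF; apply: complexP.
  rewrite (ReIm_sum _ _).1 /= -Rint_sum; last by move=> i; exact: (IF i).1.
  by apply: eq_Rintegral => x _; rewrite (ReIm_sum _ _).1.
rewrite (ReIm_sum _ _).2 /= -Rint_sum; last by move=> i; exact: (IF i).2.
by apply: eq_Rintegral => x _; rewrite (ReIm_sum _ _).2.
Qed.

Lemma cL1_sum (I : Type) (s : seq I) (F : I -> T -> C) : (forall i, cL1 (F i)) ->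
  cL1 (fun x => \sum_(i <- s) F i x).
Proof.
move=> IF; split.
  rewrite (_ : _ \o _ = fun x => \sum_(i <- s) Re (F i x)).
    by apply: L1_sum => i; exact: (IF i).1.
  by apply/funext => x /=; rewrite (ReIm_sum _ _).1.
rewrite (_ : _ \o _ = fun x => \sum_(i <- s) Im (F i x)).
  by apply: L1_sum => i; exact: (IF i).2.
by apply/funext => x /=; rewrite (ReIm_sum _ _).2.
Qed.

(* With z = cint f, |z|^2 is the integral of the real part of conj(z) f. *)
Lemma normc_cint_le f : cL1 f -> normc (cint f) <= \int[mu]_x normc (f x).
Proof.
move=> If; have In := (cL1P f).1 If.
have [z0|z0] := eqVneq (normc (cint f)) 0.
  by rewrite z0; apply: Rintegral_ge0 => x _; exact: normc_ge0.
have z1 : 0 < normc (cint f) by rewrite lt_def z0 normc_ge0.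
rewrite -(ler_pM2l z1) -expr2 normc_sqr.
pose c : C := Complex (Re (cint f)) (- Im (cint f)).
have <- : Re (c * cint f) = Re (cint f) ^+ 2 + Im (cint f) ^+ 2.
  by rewrite cReM /c /= mulNr opprK.
have nc : normc c = normc (cint f) by rewrite /c /= sqrrN.
rewrite -cintZ// /= -RintegralZl//; last exact: In.2.
apply: le_Rintegral => //.
- exact: (cL1Z c If).1.
- exact: L1Z In.2.
- move=> x _; rewrite (le_trans (ler_norm _))// (le_trans (Re_le_normc _))//.
  by rewrite Normc.normcM nc.
Qed.

Lemma cL1M_bd (B : R) f g : cmeas g -> (forall x, normc (g x) <= B) ->
  cL1 f -> cL1 (fun x => f x * g x).
Proof.
move=> mg gB /cL1P[mf If]; apply/cL1P; split; first exact: cmeasM.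
rewrite (_ : _ \o _ = fun x => normc (f x) * normc (g x)).
  apply: (@L1_bdM _ _ _ _ B) => //; first exact: measurable_normc.
  by move=> x; rewrite ger0_norm// normc_ge0.
by apply/funext => x /=; rewrite Normc.normcM.
Qed.

Lemma normc_cexpi (t : R) : normc (cexpi t) = 1.
Proof. by rewrite /cexpi /= cos2Dsin2 sqrtr1. Qed.

Lemma cexpiD (s t : R) : cexpi (s + t) = cexpi s * cexpi t.
Proof. by apply: complexP; rewrite /cexpi ?cReM ?cImM /= ?cosD ?sinD//; ring. Qed.

Lemma cmeas_cexpi (h : T -> R) : measurable_fun setT h ->
  cmeas (fun x => cexpi (h x)).
Proof.
move=> mh; split.
  apply: (measurableT_comp (f := @cos R)) => //.
  by apply: continuous_measurable_fun; exact: continuous_cos.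
apply: (measurableT_comp (f := @sin R)) => //.
by apply: continuous_measurable_fun; exact: continuous_sin.
Qed.

Lemma cL1_cexpi f (h : T -> R) : measurable_fun setT h -> cL1 f ->
  cL1 (fun x => f x * cexpi (h x)).
Proof.
move=> mh If; apply: (@cL1M_bd 1) => //; first exact: cmeas_cexpi.
by move=> x; rewrite normc_cexpi.
Qed.

End cint.

(** * A compactly supported profile with nonnegative transform *)

Section trigo_bounds.
Context (R : realType).

Lemma norm_cos_le1 (x : R) : `|cos x| <= 1.
Proof. by rewrite ler_norml cos_geN1 cos_le1. Qed.

Lemma norm_sin_le1 (x : R) : `|sin x| <= 1.
Proof. by rewrite ler_norml sin_geN1 sin_le1. Qed.

Lemma norm_sin_le (x : R) : `|sin x| <= `|x|.
Proof.
wlog x0 : x / 0 < x.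
  move=> H; have [x0|x0|<-] := ltgtP 0 x; first exact: H.
    by rewrite -normrN -sinN -[leRHS]normrN; apply: H; rewrite oppr_gt0.
  by rewrite sin0.
have [c _] := @MVT R sin cos 0 x x0 (fun y _ => is_derive_sin y)
  (continuous_subspaceT (@continuous_sin R)).
rewrite sin0 !subr0 => ->; rewrite normrM ler_piMl//; exact: norm_cos_le1.
Qed.

Lemma normc_cexpi_sub1 (t : R) : Normc.normc (cexpi t - 1) <= `|t|.
Proof.
have -> : cexpi t - 1 = Complex (cos t - 1) (sin t).
  by apply: complexP; rewrite ?cReD ?cImD /= ?oppr0 ?addr0.
rewrite -(ler_pXn2r (n := 2))// ?nnegrE ?normc_ge0//.
rewrite normc_sqr /= real_normK ?num_real//.
have -> : (cos t - 1) ^+ 2 + sin t ^+ 2 = 4 * sin (t / 2) ^+ 2.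
  have := cos2Dsin2 t; have := cos2Dsin2 (t / 2).
  have -> : cos t = cos (t / 2) ^+ 2 - sin (t / 2) ^+ 2.
    by rewrite !expr2 -cosD; congr cos; field.
  move: (sin t) (cos (t / 2)) (sin (t / 2)) => a b c h1 h2; nra.
have := norm_sin_le (t / 2).
rewrite -[X in is_true X -> _](ler_pXn2r (n := 2))// ?nnegrE// !real_normK ?num_real//.
by rewrite exprMn => h; lra.
Qed.

Lemma norm_cos_sub1 (t : R) : `|1 - cos t| <= `|t|.
Proof.
rewrite distrC; apply: le_trans (normc_cexpi_sub1 t).
by apply: le_trans (Re_le_normc _); rewrite cReD.
Qed.

Lemma measurable_cos d (T : measurableType d) (f : T -> R) :
  measurable_fun setT f -> measurable_fun setT (fun x => cos (f x)).
Proof. by move=> mf; exact: (cmeas_cexpi mf).1. Qed.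

Lemma measurable_sin d (T : measurableType d) (f : T -> R) :
  measurable_fun setT f -> measurable_fun setT (fun x => sin (f x)).
Proof. by move=> mf; exact: (cmeas_cexpi mf).2. Qed.

Lemma sin_natpi k : sin (pi * k%:R) = 0 :> R.
Proof.
elim: k => [|k IH]; first by rewrite mulr0 sin0.
by rewrite -natr1 mulrDr mulr1 sinDpi IH oppr0.
Qed.

End trigo_bounds.

Section oneDsqr_integrable.
Context (R : realType).
Local Notation mu := (@lebesgue_measure R).

Lemma L1_oneDsqrV : L1 mu (fun x : R => (1 + x ^+ 2)^-1).
Proof.
have p0 x : 0 <= (1 + x ^+ 2)^-1 :> R by rewrite invr_ge0 addr_ge0// sqr_ge0.
apply: L1P.
  by apply: continuous_measurable_fun; exact: continuous_oneDsqrV.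
under eq_integral do rewrite ger0_norm//.
rewrite ge0_symfun_integralT//=; last 2 first.
- exact: continuous_oneDsqrV.
- by move=> x /=; rewrite sqrrN.
by rewrite -set_itvcy integral0y_oneDsqr -EFinM ltry.
Qed.

Lemma L1_decay (B : R) (f : R -> R) : measurable_fun setT (f : measurableTypeR R -> R) ->
  (forall x, `|f x| <= B / (1 + x ^+ 2)) -> L1 mu f.
Proof.
move=> mf fB; apply: (L1_le mf (L1Z B L1_oneDsqrV)) => x.
by rewrite (le_trans (fB x))// ler_norm.
Qed.

End oneDsqr_integrable.

Lemma Rint_FTC (R : realType) (f F : R^o -> R^o) (a b : R) : a < b -> continuous f ->
  (forall x : R^o, is_derive x (1 : R^o) F (f x)) ->
  \int[@lebesgue_measure R]_(x in `[a, b]) f x = F b - F a.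
Proof.
move=> ab cf dF.
have cF : continuous F.
  by move=> x; apply: differentiable_continuous; apply/derivable1_diffP; apply: ex_derive.
rewrite /Rintegral (@continuous_FTC2 _ f F)//=.
- exact: continuous_subspaceT.
- split; first by move=> x _; apply: ex_derive.
    by apply: cvg_at_right_filter; exact: cF.
  by apply: cvg_at_left_filter; exact: cF.
- by move=> x _; rewrite derive1E; exact: derive_val.
Qed.

(** * Bumps, their convolutions and transforms *)

Section bumpR.
Context (R : realType).
Local Notation mu := (@lebesgue_measure R).
Local Notation RR := (measurableTypeR R).
Implicit Types (f g F G : R -> R).

(** [F] is the Fourier transform of the probability density [f]. The vanishing sine integrals stand
    for evenness: they make the transform real, and they are what lets [bump_cos] multiply under
    convolution. *)
Record bumpR (a r al : R) (f F : R -> R) : Prop := Bump {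
  bump_meas : measurable_fun setT (f : RR -> R);
  bump_01 : forall x, 0 <= f x <= 1;
  bump_supp : forall x, a < `|x| -> f x = 0;
  bump_cos : forall xi, \int[mu]_x (f x * cos (2 * pi * x * xi)) = F xi;
  bump_sin : forall xi, \int[mu]_x (f x * sin (2 * pi * x * xi)) = 0;
  bump_int : \int[mu]_x f x = 1;
  bump_low : forall x, `|x| <= r -> al <= f x }.

Lemma L1_indic (a : R) : L1 mu (\1_(`[- a, a]%classic : set R)).
Proof. exact: integrable_indic_itv. Qed.

Lemma indicE_itv (a x : R) : \1_(`[- a, a]%classic : set R) x = (`|x| <= a)%R%:R :> R.
Proof. by rewrite indicE/= mem_setE in_itv/= ler_norml. Qed.

Lemma Rint_indic (a : R) : 0 < a ->
  \int[mu]_x \1_(`[- a, a]%classic : set R) x = 2 * a.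
Proof.
move=> a0; rewrite /Rintegral integral_indic//= setIT lebesgue_measure_itv/= lte_fin.
have -> : - a < a by lra.
by rewrite -EFinD /=; lra.
Qed.

Lemma bump_L1 a r al f F : bumpR a r al f F -> L1 mu f.
Proof.
move=> [mf f01 fs _ _ _ _]; apply: (L1_le mf (L1_indic a)) => x.
rewrite indicE_itv normr_nat; case: (leP `|x| a) => xa /=.
  by rewrite ger0_norm; have /andP[] := f01 x.
by rewrite fs// normr0.
Qed.

Definition conv f g (x : R) := \int[mu]_y (f y * g (x - y)).

Let mlin (a b : R) : measurable_fun setT (fun x : RR => a * x * b : R).
Proof. by apply: measurable_funM => //; exact: measurable_funM. Qed.

Lemma bump_conv a b r al be f g F G : 0 <= a -> 0 <= b -> 0 < r -> 0 < al -> 0 < be ->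
  bumpR a r al f F -> bumpR b r be g G ->
  bumpR (a + b) (r / 2) (al * be * r) (conv f g) (fun x => F x * G x).
Proof.
move=> a0 b0 r0 al0 be0 bf bg; have If := bump_L1 bf; have Ig := bump_L1 bg.
have mf := bump_meas bf; have mg := bump_meas bg.
have mgB : measurable_fun setT (fun z : RR * RR => g (z.1 - z.2)).
  by apply: (measurableT_comp mg); exact: measurable_funB.
have mfg : measurable_fun setT (fun z : RR * RR => f z.2 * g (z.1 - z.2)).
  by apply: measurable_funM => //; apply: (measurableT_comp mf).
have g01 x : `|g x| <= 1.
  by rewrite ger0_norm; have /andP[] := bump_01 bg x.
have mgBx x : measurable_fun setT (fun y : RR => g (x - y)).
  exact: (measurableT_comp mgB (pair1_measurable x)).
have Ifg x : L1 mu (fun y => f y * g (x - y)) by apply: (@L1_bdM _ _ _ _ 1).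
have supp x : a + b < `|x| -> conv f g x = 0.
  move=> xab; rewrite /conv (_ : (fun _ => _) = cst 0).
    by rewrite Rintegral_cst ?mul0r//; exact: measurable_itv.
  apply/funext => y; have [ya|ya] := leP `|y| a; last by rewrite (bump_supp bf)// mul0r.
  rewrite (bump_supp bg) ?mulr0// ltNge; apply/negP => xyb.
  move: xab; rewrite ltNge => /negP; apply.
  by rewrite -(subrK y x) addrC (le_trans (ler_normD _ _))// lerD.
(* Testing the convolution against a bounded [c]: Fubini and a translation. With [c] a cosine, a
   sine or 1 it yields the transform and the total mass. *)
have key c : measurable_fun setT (c : RR -> R) -> (forall x, `|c x| <= 1) ->
    \int[mu]_x (conv f g x * c x) =
    \int[mu]_y (f y * \int[mu]_z (g z * c (z + y))).
  move=> mc c1.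
  (* The convolution vanishes off [[- (a + b), a + b]]; the indicator supplies the integrable factor
     in [x] that [Rint_Fubini] asks for. *)
  transitivity (\int[mu]_x (\1_(`[- (a + b), a + b]%classic : set R) x *
     \int[mu]_y (f y * (g (x - y) * c x)))).
    apply: eq_Rintegral => x _; rewrite indicE_itv.
    have -> : \int[mu]_y (f y * (g (x - y) * c x)) = conv f g x * c x.
      by rewrite -RintegralZr//; apply: eq_Rintegral => y _; rewrite mulrA.
    by case: leP => xab /=; rewrite ?mul1r// supp// !mul0r.
  rewrite (@Rint_Fubini _ _ _ _ _ mu mu 1 _ _
     (fun z : RR * RR => g (z.1 - z.2) * c z.1) (L1_indic (a + b)) If); last 2 first.
  - by apply: measurable_funM => //; apply: (measurableT_comp mc).
  - by move=> z; rewrite normrM mulr_ile1.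
  apply: eq_Rintegral => y _.
  have [ya|ya] := leP `|y| a; last by rewrite (bump_supp bf)// !mul0r.
  congr (_ * _).
  rewrite -(@Rint_shift _ (fun z => g z * c (z + y)) (- y)).
    apply: eq_Rintegral => x _ /=; rewrite subrK indicE_itv.
    case: leP => xab /=; rewrite ?mul1r// mul0r (bump_supp bg) ?mul0r//.
    rewrite ltNge; apply/negP => xyb; move: xab; rewrite ltNge => /negP; apply.
    by rewrite -(subrK y x) addrC (le_trans (ler_normD _ _))// lerD.
  apply: (@L1_bdM _ _ _ _ 1) => //.
  by apply: (measurableT_comp mc); exact: measurable_funD.
have mcos (h : RR -> R) : measurable_fun setT h -> measurable_fun setT (fun x => cos (h x)).
  exact: measurable_cos.
have msin (h : RR -> R) : measurable_fun setT h -> measurable_fun setT (fun x => sin (h x)).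
  exact: measurable_sin.
have ml xi : measurable_fun setT (fun x : RR => 2 * pi * x * xi : R) by exact: mlin.
have Igc xi : L1 mu (fun x => g x * cos (2 * pi * x * xi)).
  by apply: (@L1_bdM _ _ _ _ 1) => //; [exact: mcos|move=> ?; exact: norm_cos_le1].
have Igs xi : L1 mu (fun x => g x * sin (2 * pi * x * xi)).
  by apply: (@L1_bdM _ _ _ _ 1) => //; [exact: msin|move=> ?; exact: norm_sin_le1].
have Ifc xi : L1 mu (fun x => f x * cos (2 * pi * x * xi)).
  by apply: (@L1_bdM _ _ _ _ 1) => //; [exact: mcos|move=> ?; exact: norm_cos_le1].
have Ifs xi : L1 mu (fun x => f x * sin (2 * pi * x * xi)).
  by apply: (@L1_bdM _ _ _ _ 1) => //; [exact: msin|move=> ?; exact: norm_sin_le1].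
split.
- exact: (@measurable_fun_Rint _ _ RR RR R mu (fun z : RR * RR => f z.2 * g (z.1 - z.2)) mfg).
- move=> x; apply/andP; split.
    apply: Rintegral_ge0 => y _; rewrite mulr_ge0//.
      by have /andP[] := bump_01 bf y.
    by have /andP[] := bump_01 bg (x - y).
  rewrite -(bump_int bf); apply: le_Rintegral => // y _.
  have /andP[f0 f1] := bump_01 bf y; have /andP[g0 g1] := bump_01 bg (x - y).
  by rewrite ler_piMr.
- exact: supp.
- move=> xi; rewrite (key (fun x => cos (2 * pi * x * xi))); last 2 first.
  + exact: mcos.
  + by move=> ?; exact: norm_cos_le1.
  transitivity (\int[mu]_y (f y * cos (2 * pi * y * xi) * G xi)).
    apply: eq_Rintegral => y _; rewrite -mulrA; congr (_ * _).
    under eq_Rintegral do rewrite mulrDr mulrDl cosD mulrBr mulrA [X in _ - X]mulrA.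
    rewrite RintegralB//; last 2 first.
    + by apply: (@L1_bdM _ _ _ _ `|cos (2 * pi * y * xi)|).
    + by apply: (@L1_bdM _ _ _ _ `|sin (2 * pi * y * xi)|).
    by rewrite !RintegralZr// (bump_cos bg) (bump_sin bg) mul0r subr0 mulrC.
  by rewrite RintegralZr// (bump_cos bf).
- move=> xi; rewrite (key (fun x => sin (2 * pi * x * xi))); last 2 first.
  + exact: msin.
  + by move=> ?; exact: norm_sin_le1.
  transitivity (\int[mu]_y (f y * sin (2 * pi * y * xi) * G xi)).
    apply: eq_Rintegral => y _; rewrite -mulrA; congr (_ * _).
    under eq_Rintegral do rewrite mulrDr mulrDl sinD mulrDr mulrA [X in _ + X]mulrA.
    rewrite RintegralD//; last 2 first.
    + by apply: (@L1_bdM _ _ _ _ `|cos (2 * pi * y * xi)|).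
    + by apply: (@L1_bdM _ _ _ _ `|sin (2 * pi * y * xi)|).
    by rewrite !RintegralZr// (bump_cos bg) (bump_sin bg) mul0r add0r mulrC.
  by rewrite RintegralZr// (bump_sin bf) mul0r.
- have := key (cst 1); rewrite /cst => key1.
  transitivity (\int[mu]_x (conv f g x * 1)).
    by apply: eq_Rintegral => x _; rewrite mulr1.
  rewrite key1//; last by move=> _; rewrite normr1.
  transitivity (\int[mu]_y f y); last exact: (bump_int bf).
  apply: eq_Rintegral => y _.
  have -> : \int[mu]_z (g z * 1) = 1; last by rewrite mulr1.
  by under eq_Rintegral do rewrite mulr1; exact: (bump_int bg).
- move=> x xr.
  (* For [x] and [y] both of modulus at most [r / 2], both [y] and [x - y] have modulus at most [r],
     so the integrand is at least [al * be] on an interval of length [r]. *)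
  have -> : al * be * r = \int[mu]_y (al * be * \1_(`[- (r / 2), r / 2]%classic : set R) y).
    rewrite RintegralZl//; last exact: L1_indic.
    by rewrite Rint_indic; [congr (_ * _); field|rewrite divr_gt0].
  apply: le_Rintegral => //; first by apply: L1Z; exact: L1_indic.
  move=> y _; rewrite indicE_itv; case: (leP `|y| (r / 2)) => yr /=; last first.
    rewrite mulr0 mulr_ge0//.
      by have /andP[] := bump_01 bf y.
    by have /andP[] := bump_01 bg (x - y).
  rewrite mulr1 ler_pM//; [exact: ltW|exact: ltW| |].
    by apply: (bump_low bf); rewrite (le_trans yr)//; lra.
  apply: (bump_low bg); rewrite (le_trans (ler_normB _ _))//; lra.
Qed.

Definition sinc (x : R) : R := if x == 0 then 1 else sin (pi * x) / (pi * x).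

Lemma bump_box : bumpR (1 / 2) (1 / 2) 1 (\1_(`[- (1 / 2), 1 / 2]%classic : set R)) sinc.
Proof.
set I := (`[- (1 / 2), 1 / 2]%classic : set R).
have half : - (1 / 2) < 1 / 2 :> R by lra.
have int1 : \int[mu]_x \1_I x = 1.
  by rewrite Rint_indic ?divr_gt0//; field.
have mI (h : R -> R) : \int[mu]_x (\1_I x * h x) = \int[mu]_(x in I) h x.
  rewrite [RHS]Rintegral_mkcond; apply: eq_Rintegral => x _.
  by rewrite patchE indicE; case: ifP => _ /=; rewrite ?mul1r ?mul0r.
have dlin (xi x : R) : is_derive x 1 (fun x : R => 2 * pi * x * xi) (2 * pi * xi).
  rewrite (_ : (fun x : R => 2 * pi * x * xi) = (fun x : R => (2 * pi * xi) *: (x : R^o))).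
    by rewrite -[X in is_derive _ _ _ X]mulr1; apply: is_deriveZ.
  by apply/funext => y; rewrite /GRing.scale/=; ring.
split.
- by rewrite /I; apply: measurable_indic; exact: measurable_itv.
- by move=> x; rewrite indicE_itv ler0n lern1 leq_b1.
- by move=> x xa; rewrite indicE_itv leNgt xa.
- move=> xi; rewrite mI /sinc; case: eqP => [->|/eqP xi0].
    transitivity (\int[mu]_(x in I) (1 : R)).
      by apply: eq_Rintegral => x _; rewrite mulr0 cos0.
    rewrite -(mI (fun=> 1)) -[RHS]int1; apply: eq_Rintegral => x _; exact: mulr1.
  have c0 : 2 * pi * xi != 0 by rewrite !mulf_neq0// gt_eqF// pi_gt0.
  pose Fx (x : R) := sin (2 * pi * x * xi) / (2 * pi * xi).
  transitivity (Fx (1 / 2) - Fx (- (1 / 2))); last first.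
      rewrite /Fx !mulrN !mulNr sinN.
      have -> : 2 * pi * (1 / 2) * xi = pi * xi by field.
      have p0 : pi != 0 :> R by rewrite gt_eqF// pi_gt0.
      move: (sin _) => sn; move: {c0 Fx} (pi : R) p0 => p p0.
    by field; rewrite ?p0 ?xi0.
  apply: (@Rint_FTC _ _ Fx) => //.
  + move=> x; apply: (@continuous_comp _ _ _ (fun x : R => 2 * pi * x * xi) cos).
      by apply: differentiable_continuous; apply/derivable1_diffP; apply: ex_derive.
    exact: continuous_cos.
  + move=> x; rewrite /Fx.
    have H : is_derive x (1 : R^o) ((sin : R^o -> R^o) \o (fun x0 : R^o => 2 * pi * x0 * xi))
      (cos (2 * pi * x * xi) * (2 * pi * xi)) by apply: is_derive1_comp.
    have HZ := is_deriveZ (2 * pi * xi)^-1 H.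
    rewrite (_ : (fun x => _) = ((2 * pi * xi)^-1 \*: ((sin : R^o -> R^o) \o (fun x0 : R^o => 2 * pi * x0 * xi)))).
      by apply: is_derive_eq; rewrite /GRing.scale/= mulrCA mulVf// mulr1.
    by apply/funext => y; rewrite /GRing.scale/= mulrC.
- move=> xi; rewrite mI; have [->|xi0] := eqVneq xi 0.
    under eq_Rintegral do rewrite mulr0 sin0.
    by rewrite Rintegral_cst ?mul0r//; exact: measurable_itv.
  have c0 : 2 * pi * xi != 0 by rewrite !mulf_neq0// gt_eqF// pi_gt0.
  pose Fx (x : R) := - cos (2 * pi * x * xi) / (2 * pi * xi).
  transitivity (Fx (1 / 2) - Fx (- (1 / 2))); last first.
      by rewrite /Fx !mulrN !mulNr cosN subrr.
  apply: (@Rint_FTC _ _ Fx) => //.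
  + move=> x; apply: (@continuous_comp _ _ _ (fun x : R => 2 * pi * x * xi) sin).
      by apply: differentiable_continuous; apply/derivable1_diffP; apply: ex_derive.
    exact: continuous_sin.
  + move=> x; rewrite /Fx.
    have H : is_derive x (1 : R^o) ((cos : R^o -> R^o) \o (fun x0 : R^o => 2 * pi * x0 * xi))
      (- sin (2 * pi * x * xi) * (2 * pi * xi)) by apply: is_derive1_comp.
    have HZ := is_deriveZ (- (2 * pi * xi)^-1) H.
    rewrite (_ : (fun x => _) = ((- (2 * pi * xi)^-1) \*: ((cos : R^o -> R^o) \o (fun x0 : R^o => 2 * pi * x0 * xi)))).
      by apply: is_derive_eq; rewrite /GRing.scale/= mulNr mulNr mulrN opprK mulrCA mulVf// mulr1.
    apply/funext => y; apply: etrans (mulNr _ _) _; apply/esym.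
    by apply: etrans (mulNr _ _) _; congr (- _); exact: mulrC.
- exact: int1.
- by move=> x xr; rewrite indicE_itv xr.
Qed.

(** Sum of two bounds by 1: for [sinc x ^+ 2], and for [(x * sinc x) ^+ 2], since [x * sinc x] is
    [sin (pi * x) / pi]. *)
Lemma sinc_bound (x : R) : `|sinc x| <= 1 -> sinc x ^+ 2 <= 2 / (1 + x ^+ 2).
Proof.
move=> s1.
have D0 : 0 < 1 + x ^+ 2 by rewrite ltr_pwDl// sqr_ge0.
rewrite ler_pdivlMr// mulrDr mulr1.
have ss1 : sinc x ^+ 2 <= 1 by rewrite -real_normK ?num_real// expr_le1.
have : sinc x ^+ 2 * x ^+ 2 <= 1; last lra.
rewrite -exprMn -real_normK ?num_real// expr_le1//.
rewrite /sinc; case: eqP => [->|/eqP x0]; first by rewrite mulr0 normr0.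
have p0 : 0 < pi :> R by exact: pi_gt0.
rewrite (_ : sin (pi * x) / (pi * x) * x = sin (pi * x) / pi); last first.
  have p1 : pi != 0 :> R by rewrite gt_eqF.
  move: (sin (pi * x)) => sn; move: (pi : R) p1 => p p1.
  by field; apply/andP.
rewrite normrM normfV (ger0_norm (pi_ge0 _)) ler_pdivrMr// mul1r.
by rewrite (le_trans (norm_sin_le1 _))// (le_trans _ (pi_ge2 _))// ler1n.
Qed.

Lemma bump_hat_le1 a r al f F xi : bumpR a r al f F -> `|F xi| <= 1.
Proof.
move=> bf; have If := bump_L1 bf; rewrite -(bump_cos bf) -(bump_int bf).
apply: le_norm_Rint => //.
  apply: (@L1_bdM _ _ _ _ 1) => //; last by move=> ?; exact: norm_cos_le1.
  by apply: measurable_cos; exact: mlin.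
move=> x; have /andP[f0 f1] := bump_01 bf x.
by rewrite normrM ger0_norm// ler_piMr// norm_cos_le1.
Qed.

(* The cubic B-spline; its transform is sinc^4. *)
Lemma profile_exists : exists phi psi : R -> R,
  [/\ bumpR 2 (1 / 8) (1 / 16) phi psi,
     measurable_fun setT (psi : RR -> R) &
     forall xi, 0 <= psi xi <= 4 / (1 + xi ^+ 2) ^+ 2] /\
  [/\ forall xi, psi (- xi) = psi xi,
     forall k : nat, k != 0%N -> psi k%:R = 0 &
     0 < \int[mu]_xi psi xi].
Proof.
(* Convolving twice: the support radius goes 1/2, 1, 2, the radius of the lower bound 1/2, 1/4, 1/8,
   and the lower bound itself 1, 1/2, 1/16. *)
have h : 0 < (1 / 2 : R) by lra.
have b2 := bump_conv (ltW h) (ltW h) h ltr01 ltr01 bump_box bump_box.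
have h1 : 0 < (1 * 1 * (1 / 2) : R) by lra.
have h2 : 0 <= (1 / 2 + 1 / 2 : R) by lra.
have h3 : 0 < (1 / 2 / 2 : R) by lra.
have b4 := bump_conv h2 h2 h3 h1 h1 b2 b2.
set phi := conv _ _ in b4.
pose psi := fun x : R => sinc x * sinc x * (sinc x * sinc x).
have bp : bumpR 2 (1 / 8) (1 / 16) phi psi.
  have := b4.
  have -> : 1 / 2 + 1 / 2 + (1 / 2 + 1 / 2) = 2 :> R by lra.
  have -> : 1 / 2 / 2 / 2 = 1 / 8 :> R by lra.
  by have -> : 1 * 1 * (1 / 2) * (1 * 1 * (1 / 2)) * (1 / 2 / 2) = 1 / 16 :> R by lra.
have Ip := bump_L1 bp.
have psi4 xi : 0 <= psi xi <= 4 / (1 + xi ^+ 2) ^+ 2.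
  rewrite /psi -expr2 mulr_ge0 ?sqr_ge0//=.
  have := sinc_bound (bump_hat_le1 xi bump_box) => sb.
  have -> : 4 / (1 + xi ^+ 2) ^+ 2 = (2 / (1 + xi ^+ 2)) * (2 / (1 + xi ^+ 2)).
    by field; rewrite gt_eqF// ltr_pwDl// sqr_ge0.
  by rewrite ler_pM// ?sqr_ge0.
have mpsi : measurable_fun setT (psi : RR -> R).
  rewrite (_ : psi = fun xi => \int[mu]_x (phi x * cos (2 * pi * x * xi))); last first.
    by apply/funext => xi; rewrite (bump_cos bp).
  apply: (@measurable_fun_Rint _ _ RR RR R mu
    (fun z : RR * RR => phi z.2 * cos (2 * pi * z.2 * z.1))).
  apply: measurable_funM; first exact: (measurableT_comp (bump_meas bp)).
  by apply: measurable_cos; apply: measurable_funM => //; apply: measurable_funM.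
have Ipsi : L1 mu psi.
  apply: (@L1_decay _ 4) => // xi; have /andP[p0 p1] := psi4 xi.
  rewrite ger0_norm// (le_trans p1)// ler_wpM2l// lef_pV2 ?posrE.
  - by rewrite expr2 ler_peMl// ?addr_ge0// ?lerDl// sqr_ge0.
  - by rewrite exprn_gt0// ltr_pwDl// sqr_ge0.
  - by rewrite ltr_pwDl// sqr_ge0.
exists phi, psi; split; [by split|split => //].
    move=> xi; rewrite -!(bump_cos bp); apply: eq_Rintegral => x _.
    by rewrite mulrN cosN.
  move=> k k0; rewrite /psi /sinc pnatr_eq0 (negbTE k0).
  by rewrite sin_natpi !mul0r.
(* As [phi] has mass 1 and lives on [|x| <= 2], one has [|1 - psi xi| <= 4 * pi * |xi|], which is at
   most 1/2 for [|xi| <= d]. *)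
pose d : R := 1 / (8 * pi).
have p0 : 0 < pi :> R by exact: pi_gt0.
have d0 : 0 < d by rewrite divr_gt0// mulr_gt0.
have low xi : `|xi| <= d -> 1 / 2 <= psi xi.
  move=> xd.
  have : `|1 - psi xi| <= 1 / 2; last by rewrite ler_norml => /andP[]; lra.
  have Ic : L1 mu (fun x => phi x * cos (2 * pi * x * xi)).
    apply: (@L1_bdM _ _ _ _ 1) => //; last by move=> ?; exact: norm_cos_le1.
    by apply: measurable_cos; exact: mlin.
  have -> : 1 / 2 = \int[mu]_x (1 / 2 * phi x) by rewrite RintegralZl// (bump_int bp) mulr1.
  rewrite -[X in `|X - _|](bump_int bp) -(bump_cos bp) -RintegralB//.
  apply: le_norm_Rint; [exact: L1B|exact: L1Z|move=> x].
  rewrite -[X in X - _]mulr1 -mulrBr normrM mulrC.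
  have /andP[f0 f1] := bump_01 bp x; rewrite (ger0_norm f0).
  have [x2|x2] := leP `|x| 2; last by rewrite (bump_supp bp)// !mulr0.
  rewrite ler_wpM2r// (le_trans (norm_cos_sub1 _))// !normrM.
  rewrite (ger0_norm (pi_ge0 R)) normr_nat.
  apply: (@le_trans _ _ (2 * pi * 2 * d)).
    by rewrite ler_pM// ?mulr_ge0// ?ler_wpM2l// ?mulr_ge0// pi_ge0.
  have p1 : pi != 0 :> R by rewrite gt_eqF.
  suff -> : 2 * pi * 2 * d = 1 / 2 by [].
  by rewrite /d; move: (pi : R) p1 => p p1; field.
apply: (@lt_le_trans _ _ (\int[mu]_xi (1 / 2 * \1_(`[- d, d]%classic : set R) xi))).
  rewrite RintegralZl//; last exact: L1_indic.
  by rewrite Rint_indic// mulr_gt0// mulr_gt0.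
apply: le_Rintegral => //; first by apply: L1Z; exact: L1_indic.
move=> xi _; rewrite indicE_itv; case: (leP `|xi| d) => xd /=; last first.
  by rewrite mulr0; have /andP[] := psi4 xi.
by rewrite mulr1 low.
Qed.

End bumpR.

(** * Integration over products *)

Section euclid_integral.
Context (R : realType).
Local Notation mu := (@lebesgue_measure R).
Local Notation RR := (measurableTypeR R).

Lemma ge0_integral_leb_cons n (f : euclid R n.+1 -> \bar R) :
  measurable_fun setT f -> (forall x, 0 <= f x)%E ->
  (\int[leb R n.+1]_x f x = \int[mu \x leb R n]_p f (consT p))%E.
Proof.
move=> mf f0.
transitivity (\int[pushforward (mu \x leb R n)%E (@consT R n)]_x f x)%E.
  by apply: eq_measure_integral => //; exact: measurable_consT.
by rewrite ge0_integral_pushforward//= ?preimage_setT//; exact: measurable_consT.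
Qed.

Lemma L1_leb_cons n (f : euclid R n.+1 -> R) : measurable_fun setT f ->
  L1 (mu \x leb R n)%E (f \o @consT R n) -> L1 (leb R n.+1) f.
Proof.
move=> mf If; apply: L1P => //.
rewrite ge0_integral_leb_cons//; first exact: L1_lty If.
by apply/measurable_EFinP; apply: measurableT_comp.
Qed.

Lemma Rint_leb_cons n (f : euclid R n.+1 -> R) : measurable_fun setT f ->
  \int[leb R n.+1]_x f x = \int[(mu \x leb R n)%E]_p f (consT p).
Proof.
move=> mf; rewrite /Rintegral; congr fine.
rewrite integralE [RHS]integralE; congr (_ - _)%E.
  rewrite ge0_integral_leb_cons//.
    by apply: eq_integral => x _; rewrite !funeposE.
  by apply: measurable_funepos; exact/measurable_EFinP.
rewrite ge0_integral_leb_cons//.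
  by apply: eq_integral => x _; rewrite !funenegE.
by apply: measurable_funeneg; exact/measurable_EFinP.
Qed.

Lemma Rint_leb0 (f : euclid R 0 -> R) : measurable_fun setT f ->
  \int[leb R 0]_x f x = f [tuple].
Proof.
move=> mf; rewrite /Rintegral integral_dirac//=; last exact/measurable_EFinP.
by rewrite indicT mul1r.
Qed.

Lemma L1_leb0 (f : euclid R 0 -> R) : measurable_fun setT f -> L1 (leb R 0) f.
Proof.
move=> mf; apply: L1P => //; rewrite integral_dirac//= ?diracT ?mul1e ?ltry//.
by apply/measurable_EFinP; apply: measurableT_comp.
Qed.

Lemma Rint_prod d1 d2 (T1 : measurableType d1) (T2 : measurableType d2)
  (m1 : {sigma_finite_measure set T1 -> \bar R})
  (m2 : {sigma_finite_measure set T2 -> \bar R}) (f : T1 -> R) (g : T2 -> R) :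
  L1 m1 f -> L1 m2 g ->
  L1 (m1 \x m2)%E (fun z => f z.1 * g z.2) /\
  \int[(m1 \x m2)%E]_z (f z.1 * g z.2) = \int[m1]_x f x * \int[m2]_y g y.
Proof.
move=> If Ig.
have H : L1 (m1 \x m2)%E (fun z => f z.1 * g z.2).
  have := @L1_prod _ _ _ _ _ m1 m2 1 f g (cst 1) If Ig; rewrite /cst.
  under [X in _ -> _ -> integrable _ _ (_ \o X)]eq_fun do rewrite mulr1.
  by apply => //; move=> _; rewrite normr1.
split=> //.
rewrite {1}/Rintegral -(integral12_prod_meas1 H) /=.
rewrite -RintegralZr// /Rintegral; congr fine; apply: eq_integral => x _ /=.
rewrite /fubini_F /= -EFin_Rint; last exact: L1Z.
by rewrite RintegralZl.
Qed.

(** The ring of values is left open: weights and transforms are real, data are complex. *)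
Definition tens (V : comRingType) n (f : 'I_n -> R -> V) (x : euclid R n) : V :=
  \prod_(i < n) f i (tnth x i).

Lemma tens_cons (V : comRingType) n (f : 'I_n.+1 -> R -> V) p :
  tens f (consT p) = f ord0 p.1 * tens (fun i => f (lift ord0 i)) p.2.
Proof.
rewrite /tens big_ord_recl; congr (_ * _).
by apply: eq_bigr => i _; rewrite tnthS.
Qed.

Lemma cmeas1 d (T : measurableType d) : cmeas (fun _ : T => 1 : R[i]).
Proof. by split; exact: measurable_cst. Qed.

Lemma cmeas_tens n (f : 'I_n -> R -> R[i]) :
  (forall i, cmeas (f i : RR -> R[i])) -> cmeas (tens f).
Proof.
move=> mf; rewrite /tens.
elim: (index_enum _) => [|i s IH].
  by under eq_fun do rewrite big_nil; exact: cmeas1.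
under eq_fun do rewrite big_cons.
apply: cmeasM IH; have [m1 m2] := mf i.
by split; [apply: (measurableT_comp m1)|apply: (measurableT_comp m2)];
  exact: measurable_tnth.
Qed.

Lemma measurable_tens n (f : 'I_n -> R -> R) :
  (forall i, measurable_fun setT (f i : RR -> R)) -> measurable_fun setT (tens f).
Proof.
move=> mf; apply: measurable_prod => i _.
by apply: (measurableT_comp (mf i)); exact: measurable_tnth.
Qed.

Lemma Rint_tens n (f : 'I_n -> R -> R) : (forall i, L1 mu (f i)) ->
  L1 (leb R n) (tens f) /\
  \int[leb R n]_x tens f x = \prod_(i < n) \int[mu]_x f i x.
Proof.
elim: n f => [|n IH] f If.
  have mt : measurable_fun setT (tens f) by apply: measurable_tens => -[].
  split; first exact: L1_leb0.
  by rewrite Rint_leb0// /tens !big_ord0.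
have mt : measurable_fun setT (tens f).
  by apply: measurable_tens => i; exact: L1_measurable (If i).
have [It Et] := IH (fun i => f (lift ord0 i)) (fun i => If _).
have [Ip Ep] := Rint_prod (If ord0) It.
have E : (tens f) \o @consT R n =
    (fun p => f ord0 p.1 * tens (fun i => f (lift ord0 i)) p.2).
  by apply/funext => p; rewrite /= tens_cons.
split; first by apply: L1_leb_cons => //; rewrite E.
rewrite Rint_leb_cons// big_ord_recl -Et -Ep.
by apply: eq_Rintegral => p _; rewrite tens_cons.
Qed.

Lemma cint_prod d1 d2 (T1 : measurableType d1) (T2 : measurableType d2)
  (m1 : {sigma_finite_measure set T1 -> \bar R})
  (m2 : {sigma_finite_measure set T2 -> \bar R}) (f : T1 -> R[i]) (g : T2 -> R[i]) :
  cL1 m1 f -> cL1 m2 g ->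
  cL1 (m1 \x m2)%E (fun z => f z.1 * g z.2) /\
  cint (m1 \x m2)%E (fun z => f z.1 * g z.2) = cint m1 f * cint m2 g.
Proof.
move=> [If1 If2] [Ig1 Ig2].
have [H11 E11] := Rint_prod If1 Ig1; have [H12 E12] := Rint_prod If1 Ig2.
have [H21 E21] := Rint_prod If2 Ig1; have [H22 E22] := Rint_prod If2 Ig2.
have ERe : (@complex.Re R) \o (fun z => f z.1 * g z.2) = (fun z =>
    complex.Re (f z.1) * complex.Re (g z.2) - complex.Im (f z.1) * complex.Im (g z.2)).
  by apply/funext => z /=; rewrite cReM.
have EIm : (@complex.Im R) \o (fun z => f z.1 * g z.2) = (fun z =>
    complex.Re (f z.1) * complex.Im (g z.2) + complex.Im (f z.1) * complex.Re (g z.2)).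
  by apply/funext => z /=; rewrite cImM.
split.
  by split; [rewrite ERe; apply: L1B|rewrite EIm; apply: L1D].
apply: complexP; rewrite ?cReM ?cImM /= -?E11 -?E12 -?E21 -?E22.
  by rewrite -RintegralB//; apply: eq_Rintegral => z _; rewrite cReM.
by rewrite -RintegralD//; apply: eq_Rintegral => z _; rewrite cImM.
Qed.

Lemma cint_tens n (f : 'I_n -> R -> R[i]) : (forall i, cL1 mu (f i)) ->
  cL1 (leb R n) (tens f) /\ cint (leb R n) (tens f) = \prod_(i < n) cint mu (f i).
Proof.
elim: n f => [|n IH] f If.
  have [mt1 mt2] : cmeas (tens f) by apply: cmeas_tens => -[].
  split; first by split; exact: L1_leb0.
  by apply: complexP => /=; rewrite Rint_leb0// /tens !big_ord0.
have [mt1 mt2] : cmeas (tens f).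
  by apply: cmeas_tens => i; exact: cL1_cmeas (If i).
have [It Et] := IH (fun i => f (lift ord0 i)) (fun i => If _).
have [Ip Ep] := cint_prod (If ord0) It.
have E : (tens f) \o @consT R n =
    (fun p => f ord0 p.1 * tens (fun i => f (lift ord0 i)) p.2).
  by apply/funext => p; rewrite /= tens_cons.
split.
  by split; apply: L1_leb_cons => //; rewrite -[X in L1 _ X]/(_ \o (tens f \o @consT R n)) E; [exact: Ip.1|exact: Ip.2].
rewrite big_ord_recl -Et -Ep; apply: complexP => /=; rewrite Rint_leb_cons//.
  by apply: eq_Rintegral => p _; rewrite tens_cons.
by apply: eq_Rintegral => p _; rewrite tens_cons.
Qed.

Lemma cexpi0 : cexpi 0 = 1 :> R[i].
Proof. by apply: complexP; rewrite /= ?cos0 ?sin0. Qed.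

Lemma cexpi_sum (I : Type) (s : seq I) (F : I -> R) :
  cexpi (\sum_(i <- s) F i) = \prod_(i <- s) cexpi (F i).
Proof.
elim: s => [|i s IH]; first by rewrite !big_nil cexpi0.
by rewrite !big_cons cexpiD IH.
Qed.

Lemma normc_prod (I : Type) (s : seq I) (F : I -> R[i]) :
  Normc.normc (\prod_(i <- s) F i) = \prod_(i <- s) Normc.normc (F i).
Proof.
elim: s => [|i s IH]; first by rewrite !big_nil Normc.normc1.
by rewrite !big_cons Normc.normcM IH.
Qed.

End euclid_integral.

(** * A weighted Bessel inequality *)

Section bessel.
Context (R : realType) (n : nat).
Local Notation mu := (@lebesgue_measure R).
Local Notation RR := (measurableTypeR R).
Local Notation E := (euclid R n).
Local Notation normc := (@Normc.normc R).

Lemma measurable_dot d (T : measurableType d) (f g : T -> E) :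
  measurable_fun setT f -> measurable_fun setT g ->
  measurable_fun setT (fun z => dot (f z) (g z)).
Proof.
move=> mf mg; apply: measurable_sum => i; apply: measurable_funM.
  by apply: (measurableT_comp (measurable_tnth i)).
by apply: (measurableT_comp (measurable_tnth i)).
Qed.

Definition th (x xi : E) : R := 2 * pi * dot x xi.

Lemma measurable_th d (T : measurableType d) (f g : T -> E) :
  measurable_fun setT f -> measurable_fun setT g ->
  measurable_fun setT (fun z => th (f z) (g z)).
Proof. by move=> mf mg; apply: measurable_funM => //; exact: measurable_dot. Qed.

Variables (phi psi : R -> R).
Hypothesis bp : bumpR 2 (1 / 8) (1 / 16) phi psi.
Hypothesis mpsi : measurable_fun setT (psi : RR -> R).
Hypothesis psi_ge0 : forall xi, 0 <= psi xi.
Hypothesis psiN : forall xi, psi (- xi) = psi xi.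
Hypothesis Ipsi : L1 mu psi.

Definition wt : E -> R := tens (fun _ => phi).

Lemma L1_wt : L1 (leb R n) wt.
Proof. by apply: (Rint_tens _).1 => i; exact: bump_L1 bp. Qed.

Lemma wt_ge0 x : 0 <= wt x.
Proof. by apply: prodr_ge0 => i _; have /andP[] := bump_01 bp (tnth x i). Qed.

Lemma wt_low x : (forall i, `|tnth x i| <= 1 / 8) -> (1 / 16) ^+ n <= wt x.
Proof.
move=> xK; rewrite /wt /tens -[n in _ ^+ n]card_ord -prodr_const.
by apply: ler_prod => i _; rewrite divr_ge0//=; exact: (bump_low bp).
Qed.

Definition hat (x y : E) : R := \prod_(i < n) psi (tnth x i - tnth y i).

Lemma hat_ge0 x y : 0 <= hat x y.
Proof. by apply: prodr_ge0. Qed.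

Lemma hat_le1 x y : hat x y <= 1.
Proof.
apply: prodr_ile1 => i _; rewrite psi_ge0/=.
by rewrite (le_trans (ler_norm _))//; exact: bump_hat_le1 bp.
Qed.

Lemma hatC x y : hat x y = hat y x.
Proof. by apply: eq_bigr => i _; rewrite -psiN opprB. Qed.

Lemma measurable_hat d (T : measurableType d) (f g : T -> E) :
  measurable_fun setT f -> measurable_fun setT g ->
  measurable_fun setT (fun z => hat (f z) (g z)).
Proof.
move=> mf mg; apply: measurable_prod => i _.
apply: (measurableT_comp mpsi); apply: measurable_funB.
  by apply: (measurableT_comp (measurable_tnth i)).
by apply: (measurableT_comp (measurable_tnth i)).
Qed.

(** The value does not depend on [y]; together with the symmetry [hatC] it is the Schur bound of the
    kernel [hat]. *)
Lemma hat_int y : L1 (leb R n) (fun x => hat x y) /\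
  \int[leb R n]_x hat x y = (\int[mu]_x psi x) ^+ n.
Proof.
have H i : L1 mu (fun x => psi (x - tnth y i)).
  exact: (@L1_shift _ psi (- tnth y i)).
have [h1 h2] := Rint_tens H; split => //.
rewrite [LHS]h2 -[n in _ ^+ n]card_ord -prodr_const; apply: eq_bigr => i _.
exact: (@Rint_shift _ psi (- tnth y i)).
Qed.

Lemma wt_hat x y : \int[leb R n]_z (wt z * cos (th z x - th z y)) = hat x y.
Proof.
pose f (i : 'I_n) (z : R) := (real_complex R (phi z)) * cexpi (2 * pi * z * (tnth x i - tnth y i)).
have Ip := bump_L1 bp.
have If i : cL1 mu (f i).
  apply: cL1_cexpi; last first.
    split; first exact: Ip.
    rewrite (_ : _ \o _ = (fun z => 0 * phi z)); last by apply/funext => z /=; rewrite mul0r.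
    exact: L1Z.
  by apply: measurable_funM => //; exact: measurable_funM.
have [_ /(congr1 (@complex.Re R))] := cint_tens If.
have -> : \prod_(i < n) cint mu (f i) = real_complex R (hat x y).
  rewrite /hat rmorph_prod; apply: eq_bigr => i _.
  apply: complexP => /=.
    rewrite -(bump_cos bp); apply: eq_Rintegral => z _.
    by rewrite /= mul0r subr0.
  rewrite -[RHS](bump_sin bp (tnth x i - tnth y i)); apply: eq_Rintegral => z _.
  by rewrite /= mul0r addr0.
move=> /= <-; apply: eq_Rintegral => z _.
have -> : th z x - th z y = \sum_(i < n) 2 * pi * tnth z i * (tnth x i - tnth y i).
  rewrite /th /dot -mulrBr -sumrB mulr_sumr; apply: eq_bigr => i _.
  by rewrite -!mulrA -mulrBr.
have -> : tens f z = real_complex R (wt z) *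
    cexpi (\sum_(i < n) 2 * pi * tnth z i * (tnth x i - tnth y i)).
  by rewrite cexpi_sum /wt /tens rmorph_prod -big_split.
by rewrite cReM /= mul0r subr0.
Qed.

Section real_bessel.
Variable a : E -> R.
Hypothesis Ia : L1 (leb R n) a.
Hypothesis Ia2 : L1 (leb R n) (fun x => a x ^+ 2).

Let C x := \int[leb R n]_xi (a xi * cos (th x xi)).
Let S x := \int[leb R n]_xi (a xi * sin (th x xi)).
Let A := \int[leb R n]_xi `|a xi|.

Let ma : measurable_fun setT a. Proof. exact: L1_measurable Ia. Qed.

Let mth : measurable_fun setT (fun z : E * E => th z.1 z.2).
Proof. exact: measurable_th. Qed.

Let mthx x : measurable_fun setT (fun y : E => th x y).
Proof. exact: measurable_th. Qed.

Let mthy y : measurable_fun setT (fun x : E => th x y).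
Proof. exact: measurable_th. Qed.

Let Iac x : L1 (leb R n) (fun xi => a xi * cos (th x xi)).
Proof.
apply: (@L1_bdM _ _ _ _ 1) => //; last by move=> ?; exact: norm_cos_le1.
exact: measurable_cos.
Qed.

Let Ias x : L1 (leb R n) (fun xi => a xi * sin (th x xi)).
Proof.
apply: (@L1_bdM _ _ _ _ 1) => //; last by move=> ?; exact: norm_sin_le1.
exact: measurable_sin.
Qed.

Let mC : measurable_fun setT C.
Proof.
apply: (@measurable_fun_Rint _ _ _ _ _ _ (fun z : E * E => a z.2 * cos (th z.1 z.2))).
apply: measurable_funM; first exact: (measurableT_comp ma).
exact: measurable_cos.
Qed.

Let mS : measurable_fun setT S.
Proof.
apply: (@measurable_fun_Rint _ _ _ _ _ _ (fun z : E * E => a z.2 * sin (th z.1 z.2))).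
apply: measurable_funM; first exact: (measurableT_comp ma).
exact: measurable_sin.
Qed.

Let C_le x : `|C x| <= A.
Proof.
apply: le_norm_Rint => //; first exact: L1_norm.
by move=> xi; rewrite normrM ler_piMr// norm_cos_le1.
Qed.

Let S_le x : `|S x| <= A.
Proof.
apply: le_norm_Rint => //; first exact: L1_norm.
by move=> xi; rewrite normrM ler_piMr// norm_sin_le1.
Qed.

(** With [C + i S] the transform of [a] at [x], [k (x, xi)] is the real part of its conjugate times
    [cexpi (th x xi)]. Integrated against [a] it gives the squared modulus, and being bounded it can
    be fed to Fubini. *)
Let k (z : E * E) := C z.1 * cos (th z.1 z.2) + S z.1 * sin (th z.1 z.2).

Let mk : measurable_fun setT k.
Proof.
apply: measurable_funD; apply: measurable_funM.
- exact: (measurableT_comp mC).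
- exact: measurable_cos.
- exact: (measurableT_comp mS).
- exact: measurable_sin.
Qed.

Let k_le z : `|k z| <= A + A.
Proof.
rewrite (le_trans (ler_normD _ _))// lerD// normrM.
  by rewrite (le_trans _ (C_le z.1))// ler_piMr// norm_cos_le1.
by rewrite (le_trans _ (S_le z.1))// ler_piMr// norm_sin_le1.
Qed.

Let CS x : C x ^+ 2 + S x ^+ 2 = \int[leb R n]_xi (a xi * k (x, xi)).
Proof.
rewrite !expr2 {2}/C {2}/S -!RintegralZl// -RintegralD//; last 2 first.
- exact: L1Z.
- exact: L1Z.
by apply: eq_Rintegral => xi _; rewrite /k/= mulrDr mulrCA [X in _ + X = _]mulrCA.
Qed.

Let kE x y : k (x, y) = \int[leb R n]_xi (a xi * cos (th x xi - th x y)).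
Proof.
rewrite /k /C /S /= -!RintegralZr// -RintegralD//; last 2 first.
- by apply: (@L1_bdM _ _ _ _ `|cos (th x y)|).
- by apply: (@L1_bdM _ _ _ _ `|sin (th x y)|).
by apply: eq_Rintegral => xi _; rewrite cosB; ring.
Qed.

Lemma L1_wtCS : L1 (leb R n) (fun x => wt x * (C x ^+ 2 + S x ^+ 2)).
Proof.
apply: (@L1_bdM _ _ _ _ (A ^+ 2 + A ^+ 2)); last exact: L1_wt.
  by apply: measurable_funD; apply: measurable_funX.
move=> x; rewrite ger0_norm ?addr_ge0 ?sqr_ge0//.
rewrite -[C x ^+ 2]real_normK ?num_real// -[S x ^+ 2]real_normK ?num_real//.
by apply: lerD; rewrite lerXn2r ?nnegrE ?(le_trans (normr_ge0 _) (C_le x)).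
Qed.

(* Schur's test for the kernel [hat], after writing |C|^2 + |S|^2 as a double
   integral. *)
Lemma real_bessel : \int[leb R n]_x (wt x * (C x ^+ 2 + S x ^+ 2)) <=
  (\int[mu]_x psi x) ^+ n * \int[leb R n]_x (a x ^+ 2).
Proof.
set P := _ ^+ n; set N2 := Rintegral _ _ (fun x => a x ^+ 2).
have -> : \int[leb R n]_x (wt x * (C x ^+ 2 + S x ^+ 2)) =
    \int[leb R n]_y (a y * \int[leb R n]_xi (a xi * hat xi y)).
  under eq_Rintegral do rewrite CS.
  rewrite (@Rint_Fubini _ _ _ _ _ _ _ (A + A) _ _ k L1_wt Ia)//.
  apply: eq_Rintegral => y _; congr (_ * _).
  under eq_Rintegral do rewrite kE.
  rewrite (@Rint_Fubini _ _ _ _ _ _ _ 1 _ _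
    (fun z : E * E => cos (th z.1 z.2 - th z.1 y)) L1_wt Ia); last 2 first.
  - apply: measurable_cos; apply: measurable_funB => //.
    exact: (measurableT_comp (mthy y)).
  - by move=> ?; exact: norm_cos_le1.
  by apply: eq_Rintegral => xi _; rewrite /= wt_hat.
have mhat : measurable_fun setT (fun z : E * E => hat z.2 z.1).
  exact: measurable_hat.
have mhy y : measurable_fun setT (fun x => hat x y) by exact: measurable_hat.
have ma2 : measurable_fun setT (fun x => a x ^+ 2) by exact: L1_measurable Ia2.
have h1 x y : `|hat x y| <= 1 by rewrite ger0_norm ?hat_ge0// hat_le1.
have Ia2h y : L1 (leb R n) (fun x => a x ^+ 2 * hat x y).
  by apply: (@L1_bdM _ _ _ _ 1).
pose V y := \int[leb R n]_x (a x ^+ 2 * hat x y).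
have mV : measurable_fun setT V.
  apply: (@measurable_fun_Rint _ _ _ _ _ _ (fun z : E * E => a z.2 ^+ 2 * hat z.2 z.1)).
  by apply: measurable_funM => //; exact: (measurableT_comp ma2).
have V0 y : 0 <= V y.
  by apply: Rintegral_ge0 => x _; rewrite mulr_ge0 ?sqr_ge0 ?hat_ge0.
have EV : (\int[leb R n]_y (V y)%:E = (P * N2)%:E)%E.
  transitivity (\int[leb R n]_y \int[leb R n]_x (a x ^+ 2 * hat x y)%:E)%E.
    by apply: eq_integral => y _; rewrite -EFin_Rint.
  rewrite (fubini_tonelli (fun z : E * E => (a z.2 ^+ 2 * hat z.2 z.1)%:E))//=; last 2 first.
  - apply/measurable_EFinP; apply: measurable_funM => //.
    exact: (measurableT_comp ma2).
  - by move=> z; rewrite lee_fin mulr_ge0 ?sqr_ge0 ?hat_ge0.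
  transitivity (\int[leb R n]_x (P * a x ^+ 2)%:E)%E.
    apply: eq_integral => x _; have [Ih Eh] := hat_int x.
    under eq_integral do rewrite hatC.
    by rewrite -EFin_Rint; [rewrite RintegralZl// Eh mulrC|exact: L1Z].
  by rewrite -EFin_Rint; [rewrite RintegralZl|exact: L1Z].
have IV : L1 (leb R n) V.
  apply: L1P => //; under eq_integral do rewrite ger0_norm//.
  by rewrite EV ltry.
have RV : \int[leb R n]_y V y = P * N2 by rewrite /Rintegral EV.
(* [V] carries half of the mass after [a x * a y <= (a x ^+ 2 + a y ^+ 2) / 2]: the term in [a y]
   integrates over [x] to [P * a y ^+ 2], the term in [a x] gives [V y]. *)
have -> : P * N2 = \int[leb R n]_y (1 / 2 * (P * a y ^+ 2 + V y)).
  rewrite RintegralZl//; last by apply: L1D => //; exact: L1Z.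
  by rewrite RintegralD ?RintegralZl// ?RV; [rewrite -/N2; field|exact: L1Z].
apply: le_Rintegral => //.
- apply: (@Rint_prod_L1 _ _ _ _ _ _ _ 1 a a (fun z : E * E => hat z.2 z.1)) => //.
- by apply: L1Z; apply: L1D => //; exact: L1Z.
- move=> y _; have [Ih Eh] := hat_int y; rewrite /P -Eh.
  rewrite -RintegralZl//; last by apply: (@L1_bdM _ _ _ _ 1).
  rewrite -RintegralZr// -RintegralD//; last by apply: (@L1_bdM _ _ _ _ (a y ^+ 2)); rewrite ?ger0_norm ?sqr_ge0.
  rewrite -RintegralZl//; last first.
    by apply: L1D => //; apply: (@L1_bdM _ _ _ _ (a y ^+ 2)); rewrite ?ger0_norm ?sqr_ge0.
  apply: le_Rintegral => //.
  + by apply: L1Z; apply: (@L1_bdM _ _ _ _ 1).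
  + apply: L1Z; apply: L1D => //.
    by apply: (@L1_bdM _ _ _ _ (a y ^+ 2)); rewrite ?ger0_norm ?sqr_ge0.
  + move=> x _; have := hat_ge0 x y; move: (hat x y) (a x) (a y) => h u v h0.
    have := sqr_ge0 (u - v); nra.
Qed.

End real_bessel.

(** [real_bessel] is applied to the real and imaginary parts of [h]; recombining the two transforms
    costs the factor 2. On a cube where [wt] is bounded below this serves as the upper half of
    Plancherel. *)
Lemma bessel (h : E -> R[i]) : cL1 (leb R n) h ->
  L1 (leb R n) (fun x => normc (h x) ^+ 2) ->
  let H x := cint (leb R n) (fun xi => h xi * cexpi (th x xi)) in
  cmeas H /\
  L1 (leb R n) (fun x => wt x * normc (H x) ^+ 2) /\
  \int[leb R n]_x (wt x * normc (H x) ^+ 2) <=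
  2 * (\int[mu]_x psi x) ^+ n * \int[leb R n]_x (normc (h x) ^+ 2).
Proof.
move=> [Ia Ib] Ih2 H.
have [ma mb] := (L1_measurable Ia, L1_measurable Ib).
pose a x := complex.Re (h x); pose b x := complex.Im (h x).
have Eh x : normc (h x) ^+ 2 = a x ^+ 2 + b x ^+ 2 by rewrite normc_sqr.
have Ia2 : L1 (leb R n) (fun x => a x ^+ 2).
  apply: (L1_le _ Ih2); first exact: measurable_funX.
  by move=> x; rewrite Eh !ger0_norm ?addr_ge0 ?sqr_ge0// lerDl sqr_ge0.
have Ib2 : L1 (leb R n) (fun x => b x ^+ 2).
  apply: (L1_le _ Ih2); first exact: measurable_funX.
  by move=> x; rewrite Eh !ger0_norm ?addr_ge0 ?sqr_ge0// lerDr sqr_ge0.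
pose C (f : E -> R) x := \int[leb R n]_xi (f xi * cos (th x xi)).
pose S (f : E -> R) x := \int[leb R n]_xi (f xi * sin (th x xi)).
have Ifc f x : L1 (leb R n) f -> L1 (leb R n) (fun xi => f xi * cos (th x xi)).
  move=> If; apply: (@L1_bdM _ _ _ _ 1) => //; last by move=> ?; exact: norm_cos_le1.
  by apply: measurable_cos; exact: measurable_th.
have Ifs f x : L1 (leb R n) f -> L1 (leb R n) (fun xi => f xi * sin (th x xi)).
  move=> If; apply: (@L1_bdM _ _ _ _ 1) => //; last by move=> ?; exact: norm_sin_le1.
  by apply: measurable_sin; exact: measurable_th.
have HRe x : complex.Re (H x) = C a x - S b x.
  rewrite /C /S -RintegralB//; [|exact: Ifc|exact: Ifs].
  by rewrite /H /=; apply: eq_Rintegral => xi _; rewrite cReM.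
have HIm x : complex.Im (H x) = S a x + C b x.
  rewrite /C /S -RintegralD//; [|exact: Ifs|exact: Ifc].
  by rewrite /H /=; apply: eq_Rintegral => xi _; rewrite cImM.
have mC (f : E -> R) : measurable_fun setT f -> measurable_fun setT (C f).
  move=> mf.
  apply: (@measurable_fun_Rint _ _ _ _ _ _ (fun z : E * E => f z.2 * cos (th z.1 z.2))).
  apply: measurable_funM; first exact: (measurableT_comp mf).
  by apply: measurable_cos; exact: measurable_th.
have mS (f : E -> R) : measurable_fun setT f -> measurable_fun setT (S f).
  move=> mf.
  apply: (@measurable_fun_Rint _ _ _ _ _ _ (fun z : E * E => f z.2 * sin (th z.1 z.2))).
  apply: measurable_funM; first exact: (measurableT_comp mf).
  by apply: measurable_sin; exact: measurable_th.
have cmH : cmeas H.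
  split.
    rewrite (_ : _ \o _ = C a \- S b); last by apply/funext => x; exact: HRe.
    by apply: measurable_funB; [exact: mC|exact: mS].
  rewrite (_ : _ \o _ = S a \+ C b); last by apply/funext => x; exact: HIm.
  by apply: measurable_funD; [exact: mS|exact: mC].
have Ka := L1_wtCS Ia; have Kb := L1_wtCS Ib.
have Hle x : wt x * normc (H x) ^+ 2 <=
    2 * (wt x * (C a x ^+ 2 + S a x ^+ 2) + wt x * (C b x ^+ 2 + S b x ^+ 2)).
  rewrite normc_sqr HRe HIm; have := wt_ge0 x.
  move: (wt x) (C a x) (S a x) (C b x) (S b x) => w c s c' s' w0.
  have := sqr_ge0 (c + s'); have := sqr_ge0 (s - c'); nra.
have IK : L1 (leb R n) (fun x =>
   2 * (wt x * (C a x ^+ 2 + S a x ^+ 2) + wt x * (C b x ^+ 2 + S b x ^+ 2))).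
  by apply: L1Z; apply: L1D.
have IH : L1 (leb R n) (fun x => wt x * normc (H x) ^+ 2).
  apply: (L1_le _ IK).
    apply: measurable_funM; first exact: L1_measurable L1_wt.
    by apply: measurable_funX; exact: measurable_normc.
  move=> x; rewrite ger0_norm ?mulr_ge0 ?exprn_ge0 ?normc_ge0 ?wt_ge0//.
  by rewrite (le_trans (Hle x))// ler_norm.
split=> //; split=> //.
apply: (le_trans (le_Rintegral measurableT IH IK (fun x _ => Hle x))).
rewrite RintegralZl//; last exact: L1D.
rewrite RintegralD// -mulrA ler_pM2l// (le_trans (lerD (real_bessel Ia Ia2) (real_bessel Ib Ib2)))//.
by rewrite -mulrDr -RintegralD//; under [X in _ <= _ * X]eq_Rintegral do rewrite Eh.
Qed.

End bessel.

(** * One-dimensional lattice data *)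

Section comb.
Context (R : realType).
Local Notation mu := (@lebesgue_measure R).
Local Notation RR := (measurableTypeR R).
Local Notation normc := (@Normc.normc R).
Local Notation "x %:C" := (real_complex R x).

Lemma cexpi_natpi k : cexpi (2 * pi * k%:R) = 1 :> R[i].
Proof.
have E : 2 * pi * k%:R = (pi : R) *+ 2 *+ k by rewrite mulr_natr mulr_natl.
rewrite E; elim: k {E} => [|k IH]; first by rewrite mulr0n cexpi0.
rewrite mulrSr cexpiD IH mul1r.
by apply: complexP; rewrite /cexpi /= ?cos2pi ?sin2pi.
Qed.

Lemma cexpiN_natpi k : cexpi (- (2 * pi * k%:R)) = 1 :> R[i].
Proof.
have := cexpi_natpi k => H; have := cexpiD (2 * pi * k%:R) (- (2 * pi * k%:R) : R).
by rewrite subrr cexpi0 H mul1r.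
Qed.

Lemma normc_sum (I : Type) (s : seq I) (F : I -> R[i]) :
  normc (\sum_(i <- s) F i) <= \sum_(i <- s) normc (F i).
Proof.
elim: s => [|i s IH]; first by rewrite !big_nil Normc.normc0.
by rewrite !big_cons (le_trans (le_normcD _ _))// lerD2l.
Qed.

Lemma normc_real (a : R) : normc a%:C = `|a|.
Proof. by rewrite /= expr0n addr0 sqrtr_sqr. Qed.

Lemma normc_sumcexpi M (t : 'I_M -> R) : normc (\sum_m cexpi (t m)) ^+ 2 =
  \sum_m \sum_l cos (t m - t l).
Proof.
rewrite normc_sqr (ReIm_sum _ _).1 (ReIm_sum _ _).2 !expr2 !mulr_suml -big_split/=.
apply: eq_bigr => m _; rewrite !mulr_sumr -big_split/=.
by apply: eq_bigr => l _; rewrite cosB.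
Qed.

Variables (phi psi : R -> R).
Hypothesis bp : bumpR 2 (1 / 8) (1 / 16) phi psi.
Hypothesis mpsi : measurable_fun setT (psi : RR -> R).
Hypothesis psi4 : forall xi, 0 <= psi xi <= 4 / (1 + xi ^+ 2) ^+ 2.
Hypothesis psiN : forall xi, psi (- xi) = psi xi.
Hypothesis psi_nat : forall k : nat, k != 0%N -> psi k%:R = 0.
Hypothesis I_gt0 : 0 < \int[mu]_xi psi xi.

Let psi_ge0 xi : 0 <= psi xi. Proof. by have /andP[] := psi4 xi. Qed.

Let D1 (x : R) : 0 < 1 + x ^+ 2. Proof. by rewrite ltr_pwDl// sqr_ge0. Qed.

Lemma psi_le xi : psi xi <= 4 / (1 + xi ^+ 2).
Proof.
have /andP[_ h] := psi4 xi; apply: (le_trans h).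
rewrite ler_wpM2l// lef_pV2 ?posrE ?exprn_gt0//.
by rewrite expr2 ler_peMl ?(ltW (D1 _))// lerDl sqr_ge0.
Qed.

Lemma L1_psi : L1 mu psi.
Proof.
by apply: (@L1_decay _ 4) => // xi; rewrite ger0_norm// psi_le.
Qed.

(** The square in the denominator of [psi4] is spent here: one factor against [xi ^+ 2], one for
    integrability. Hence a transform [sinc ^ 4] instead of [sinc ^ 2]. *)
Lemma L1_sqpsi : L1 mu (fun xi => xi ^+ 2 * psi xi).
Proof.
apply: (@L1_decay _ 4); first by apply: measurable_funM => //; apply: measurable_funX.
move=> xi; rewrite (ger0_norm (mulr_ge0 (sqr_ge0 _) _))//.
have /andP[_ h] := psi4 xi; apply: (le_trans (ler_wpM2l (sqr_ge0 xi) h)).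
have := D1 xi; have := sqr_ge0 xi; move: (xi ^+ 2) => y y0 d0.
rewrite mulrCA ler_wpM2l// ler_pdivrMr ?exprn_gt0// expr2 mulrA mulVf ?gt_eqF//.
by rewrite mul1r lerDr.
Qed.

Let I := \int[mu]_xi psi xi.
Let J := \int[mu]_xi (xi ^+ 2 * psi xi).

Lemma J_ge0 : 0 <= J.
Proof. by apply: Rintegral_ge0 => xi _; apply: (mulr_ge0 (sqr_ge0 _)). Qed.

(** * Profiles placed along an arithmetic progression of frequencies *)

Section nodes.
Variables (M D : nat) (v : R).
Hypothesis M_gt0 : (0 < M)%N.
Hypothesis MD : (M <= D)%N.

Definition node (m : 'I_M) : R := v + D%:R * m%:R.

Definition comb_hat (xi : R) : R := \sum_(m < M) psi (xi - node m).

Definition comb_fun (x : R) : R[i] :=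
  (phi x)%:C * \sum_(m < M) cexpi (2 * pi * node m * x).

Let L1_psi_node m : L1 mu (fun xi => psi (xi - node m)).
Proof. exact: (@L1_shift _ psi (- node m)) L1_psi. Qed.

Lemma L1_comb_hat : L1 mu comb_hat.
Proof. exact: L1_sum. Qed.

Lemma measurable_comb_hat : measurable_fun setT (comb_hat : RR -> R).
Proof. exact: L1_measurable L1_comb_hat. Qed.

Lemma comb_hat_ge0 xi : 0 <= comb_hat xi.
Proof. by apply: sumr_ge0. Qed.

Let node_sep (m l : 'I_M) : m != l -> D%:R ^+ 2 <= (node m - node l) ^+ 2.
Proof.
move=> ml; rewrite (_ : node m - node l = D%:R * (m%:R - l%:R)); last by rewrite /node; ring.
rewrite exprMn ler_peMr ?sqr_ge0//.
wlog lm : m l ml / (l < m)%N.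
  move=> H; case: (ltngtP l m) => [|lm|/val_inj lm]; first exact: H.
    by rewrite -sqrrN opprB; apply: H => //; rewrite eq_sym.
  by rewrite lm eqxx in ml.
by rewrite -natrB ?(ltnW lm)// -natrX ler1n expn_gt0 subn_gt0 lm.
Qed.

(* With b_m = 1/(1 + (xi - node m)^2) and S the sum of the b_m, the separation
   of the nodes gives S^2 <= S + 2, hence S <= 2. *)
Lemma comb_hat_le xi : comb_hat xi <= 8.
Proof.
pose b m := (1 + (xi - node m) ^+ 2)^-1.
have b0 m : 0 < b m by rewrite invr_gt0.
have b1 m : b m <= 1 by rewrite invf_le1// lerDl sqr_ge0.
have D0 : 0 < D%:R :> R by rewrite ltr0n (leq_trans M_gt0).
pose S := \sum_m b m.
have S0 : 0 <= S by apply: sumr_ge0 => m _; exact: ltW.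
have bb m l : b m * b l <= (m == l)%:R * b m + 2 / D%:R ^+ 2.
  have [<-|ml] := eqVneq m l.
    rewrite mul1r (@le_trans _ _ (b m))//; first by rewrite ler_piMr// ltW.
    by rewrite lerDl divr_ge0// sqr_ge0.
  rewrite mul0r add0r -invfM.
  have -> : 2 / D%:R ^+ 2 = (D%:R ^+ 2 / 2)^-1 :> R by rewrite invf_div.
  rewrite lef_pV2 ?posrE ?mulr_gt0 ?divr_gt0 ?exprn_gt0//.
  (* With [a] and [c] the distances of [xi] to the two nodes, [D ^ 2 <= (a - c) ^ 2 <= 2 * (a ^ 2 +
     c ^ 2)]. *)
  have := node_sep ml.
  have -> : node m - node l = (xi - node l) - (xi - node m) by ring.
  move: (xi - node m) (xi - node l) (D%:R ^+ 2) => a c d h.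
  have := sqr_ge0 (a + c); have := mulr_ge0 (sqr_ge0 a) (sqr_ge0 c); nra.
have SS : S * S <= S + 2.
  rewrite {1}/S mulr_suml.
  apply: (@le_trans _ _ (\sum_m \sum_l ((m == l)%:R * b m + 2 / D%:R ^+ 2))).
    by apply: ler_sum => m _; rewrite mulr_sumr; apply: ler_sum => l _.
  have -> : \sum_(m < M) \sum_(l < M) ((m == l)%:R * b m + 2 / D%:R ^+ 2) =
      S + M%:R ^+ 2 * (2 / D%:R ^+ 2).
    under eq_bigr do rewrite big_split/=.
    rewrite big_split/=; congr (_ + _).
      apply: eq_bigr => m _; rewrite (bigD1 m)//= eqxx mul1r big1 ?addr0//.
      by move=> l; rewrite eq_sym => /negbTE ->; rewrite mul0r.
    by rewrite !sumr_const !card_ord -[LHS]mulr_natl -[X in _ * X]mulr_natl expr2 mulrA.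
  rewrite lerD2l mulrCA ger_pMr// ler_pdivrMr ?exprn_gt0// mul1r.
  by rewrite lerXn2r ?nnegrE ?ler0n// ler_nat.
have S2 : S <= 2 by nra.
apply: (@le_trans _ _ (4 * S)); last lra.
by rewrite /S mulr_sumr; apply: ler_sum => m _; exact: psi_le.
Qed.

(** One factor [comb_hat] is replaced by its bound 8, so that the square becomes a sum of [M]
    translates and the result is linear in [M]. On the translate at a node [y <= r], [xi ^+ 2 <= 2 *
    y ^+ 2 + 2 * (xi - y) ^+ 2] and [1 <= r] bound the weight by [3 + 2 * (xi - y) ^+ 2]. *)
Lemma comb_hat_sq r : 1 <= r -> (forall m, 0 <= node m <= r) ->
  L1 mu (fun xi => (1 + xi ^+ 2 / r ^+ 2) * comb_hat xi ^+ 2) /\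
  \int[mu]_xi ((1 + xi ^+ 2 / r ^+ 2) * comb_hat xi ^+ 2) <= 8 * (3 * I + 2 * J) * M%:R.
Proof.
move=> r1 nr.
pose q xi := 3 * psi xi + 2 * (xi ^+ 2 * psi xi).
have Iq : L1 mu q by apply: L1D; apply: L1Z; [exact: L1_psi|exact: L1_sqpsi].
have q0 xi : 0 <= q xi.
  have h := mulr_ge0 (sqr_ge0 xi) (psi_ge0 xi); have h' := psi_ge0 xi.
  by rewrite /q; lra.
have Iqs m : L1 mu (fun xi => q (xi - node m)) by exact: (@L1_shift _ q (- node m)) Iq.
have le1 m xi : (1 + xi ^+ 2 / r ^+ 2) * psi (xi - node m) <= q (xi - node m).
  rewrite /q mulrA -mulrDl; apply: ler_wpM2r => //.
  have r0 : 0 < r ^+ 2 by rewrite exprn_gt0// (lt_le_trans ltr01).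
  have r2 : 1 <= r ^+ 2 by rewrite expr_ge1// (le_trans ler01).
  have /andP[n0 nr'] := nr m.
  have : xi ^+ 2 <= (2 + 2 * (xi - node m) ^+ 2) * r ^+ 2.
    move: n0 nr'; move: (node m) => y y0 yr.
    have h : y ^+ 2 <= r ^+ 2 by rewrite lerXn2r ?nnegrE// (le_trans y0).
    have := mulr_ge0 (sqr_ge0 (xi - y)) (_ : 0 <= r ^+ 2 - 1).
    rewrite subr_ge0 => /(_ r2) h'.
    have := sqr_ge0 (xi - 2 * y); nra.
  rewrite -ler_pdivrMr//; lra.
have key xi : (1 + xi ^+ 2 / r ^+ 2) * comb_hat xi ^+ 2 <=
    8 * \sum_(m < M) q (xi - node m).
  have w0 : 0 <= 1 + xi ^+ 2 / r ^+ 2 by rewrite addr_ge0// divr_ge0 ?sqr_ge0.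
  rewrite expr2 mulrCA; apply: (@le_trans _ _ (8 * ((1 + xi ^+ 2 / r ^+ 2) * comb_hat xi))).
    by rewrite ler_wpM2r ?comb_hat_le// mulr_ge0// comb_hat_ge0.
  rewrite ler_wpM2l// /comb_hat mulr_sumr; apply: ler_sum => m _; exact: le1.
have Irhs : L1 mu (fun xi => 8 * \sum_(m < M) q (xi - node m)).
  by apply: L1Z; apply: L1_sum.
have mlhs : measurable_fun setT (fun xi : RR => (1 + xi ^+ 2 / r ^+ 2) * comb_hat xi ^+ 2).
  apply: measurable_funM; last exact: (measurable_funX _ measurable_comb_hat).
  by apply: measurable_funD => //; apply: measurable_funM => //; exact: measurable_funX.
have Ilhs : L1 mu (fun xi => (1 + xi ^+ 2 / r ^+ 2) * comb_hat xi ^+ 2).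
  apply: (L1_le mlhs Irhs) => xi; rewrite ger0_norm.
    by rewrite (le_trans (key xi))// ler_norm.
  by rewrite mulr_ge0 ?sqr_ge0// addr_ge0// divr_ge0 ?sqr_ge0.
split=> //; apply: (le_trans (le_Rintegral measurableT Ilhs Irhs (fun x _ => key x))).
rewrite RintegralZl//; last exact: L1_sum.
rewrite Rint_sum// -mulrA ler_wpM2l// (eq_bigr (fun=> 3 * I + 2 * J)).
  by rewrite sumr_const card_ord mulr_natr.
move=> m _; rewrite (@Rint_shift _ q (- node m))//.
rewrite RintegralD//; [|by apply: L1Z; exact: L1_psi|by apply: L1Z; exact: L1_sqpsi].
by rewrite !RintegralZl//; [exact: L1_sqpsi|exact: L1_psi].
Qed.

Let Iphi := bump_L1 bp.

Let mlin (a : R) : measurable_fun setT (fun x : RR => a * x : R).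
Proof. exact: measurable_funM. Qed.

Let cL1_real d (T : measurableType d) (nu : {measure set T -> \bar R}) (f : T -> R) :
  L1 nu f -> cL1 nu (fun x => (f x)%:C).
Proof.
move=> If; split=> //; rewrite (_ : _ \o _ = fun x => 0 * f x); first exact: L1Z.
by apply/funext => x /=; rewrite mul0r.
Qed.

Lemma cmeas_comb_fun : cmeas (comb_fun : RR -> R[i]).
Proof.
have : cL1 mu (fun x => \sum_(m < M) (phi x)%:C * cexpi (2 * pi * node m * x)).
  by apply: cL1_sum => m; apply: cL1_cexpi; [exact: mlin|exact: cL1_real].
by move/cL1_cmeas; under eq_fun do rewrite -mulr_sumr.
Qed.

Lemma comb_fun_supp x : 2 < `|x| -> comb_fun x = 0.
Proof. by move=> x2; rewrite /comb_fun (bump_supp bp)// rmorph0 mul0r. Qed.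

Lemma comb_fun_fourier xi :
  cL1 mu (fun x => comb_fun x * cexpi (- (2 * pi * x * xi))) /\
  cint mu (fun x => comb_fun x * cexpi (- (2 * pi * x * xi))) = (comb_hat xi)%:C.
Proof.
have E : (fun x => comb_fun x * cexpi (- (2 * pi * x * xi))) =
    (fun x => \sum_(m < M) (phi x)%:C * cexpi (2 * pi * x * (node m - xi))).
  apply/funext => x; rewrite /comb_fun mulrAC mulr_sumr; apply: eq_bigr => m _.
  by rewrite -mulrA -cexpiD; congr (_ * cexpi _); ring.
have Im m : cL1 mu (fun x => (phi x)%:C * cexpi (2 * pi * x * (node m - xi))).
  apply: cL1_cexpi; last exact: cL1_real.
  by apply: measurable_funM => //; exact: mlin.
rewrite E; split; first exact: cL1_sum.
rewrite cint_sum// /comb_hat rmorph_sum; apply: eq_bigr => m _.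
apply: complexP => /=.
  rewrite -psiN opprB -(bump_cos bp); apply: eq_Rintegral => x _.
  by rewrite /= mul0r subr0.
rewrite -[RHS](bump_sin bp (node m - xi)); apply: eq_Rintegral => x _.
by rewrite /= mul0r addr0.
Qed.

(** Since [0 <= phi <= 1], [phi ^ 2] may be replaced by [phi]. Expanding the exponential sum then
    produces the values of [psi] at differences of nodes. These are integers, nonzero off the
    diagonal, where [psi] vanishes: the exponentials are orthogonal for the weight [phi]. *)
Lemma comb_fun_sq : L1 mu (fun x => normc (comb_fun x) ^+ 2) /\
  \int[mu]_x (normc (comb_fun x) ^+ 2) <= M%:R.
Proof.
have Ic a : L1 mu (fun x => phi x * cos (2 * pi * x * a)).
  apply: (@L1_bdM _ _ _ _ 1) => //; last by move=> ?; exact: norm_cos_le1.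
  by apply: measurable_cos; apply: measurable_funM => //; exact: mlin.
pose q x := \sum_(m < M) \sum_(l < M) phi x * cos (2 * pi * x * (node m - node l)).
have Iq : L1 mu q by apply: L1_sum => m; apply: L1_sum.
have le1 x : normc (comb_fun x) ^+ 2 <= q x.
  rewrite /comb_fun Normc.normcM normc_real exprMn normc_sumcexpi.
  have -> : q x = phi x * \sum_(m < M) \sum_(l < M) cos (2 * pi * node m * x - 2 * pi * node l * x).
    rewrite mulr_sumr; apply: eq_bigr => m _; rewrite mulr_sumr; apply: eq_bigr => l _.
    by congr (_ * cos _); ring.
  have /andP[p0 p1] := bump_01 bp x.
  rewrite ler_wpM2r//; first by rewrite -normc_sumcexpi sqr_ge0.
  by rewrite ger0_norm// expr2 ler_piMr.
have mn : measurable_fun setT (fun x : RR => normc (comb_fun x) ^+ 2).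
  by apply: measurable_funX; exact: measurable_normc cmeas_comb_fun.
have In : L1 mu (fun x => normc (comb_fun x) ^+ 2).
  apply: (L1_le mn Iq) => x; rewrite ger0_norm ?exprn_ge0 ?normc_ge0//.
  by rewrite (le_trans (le1 x))// ler_norm.
split=> //; apply: (le_trans (le_Rintegral measurableT In Iq (fun x _ => le1 x))).
rewrite Rint_sum; last by move=> m; apply: L1_sum.
rewrite (eq_bigr (fun=> 1)); first by rewrite sumr_const card_ord.
move=> m _; rewrite Rint_sum// (bigD1 m)//= (bump_cos bp) subrr.
have -> : psi 0 = 1.
  rewrite -(bump_cos bp); transitivity (\int[mu]_x phi x); last exact: (bump_int bp).
  by apply: eq_Rintegral => x _; rewrite mulr0 cos0 mulr1.
rewrite big1 ?addr0// => l lm.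
rewrite (bump_cos bp) (_ : node m - node l = D%:R * (m%:R - l%:R)); last by rewrite /node; ring.
have D0 : (0 < D)%N by rewrite (leq_trans M_gt0).
case: (ltngtP l m) => [h|h|/val_inj h]; last by rewrite h eqxx in lm.
  by rewrite -natrB ?(ltnW h)// -natrM psi_nat// muln_eq0 negb_or -!lt0n D0 subn_gt0.
rewrite -psiN -mulrN opprB -natrB ?(ltnW h)// -natrM psi_nat//.
by rewrite muln_eq0 negb_or -!lt0n D0 subn_gt0.
Qed.

(** With [tau = 2 * pi * t] this is the contribution of one coordinate to the phase in
    [schrodinger_on]. *)
Definition comb_phase (x tau xi : R) : R := 2 * pi * (x * xi - tau * xi ^+ 2).

Let mphase x tau : measurable_fun setT (fun xi : RR => comb_phase x tau xi).
Proof.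
apply: measurable_funM => //; apply: measurable_funB; first exact: mlin.
by apply: measurable_funM => //; exact: measurable_funX.
Qed.

Lemma cL1_comb_evol x tau :
  cL1 mu (fun xi => (comb_hat xi)%:C * cexpi (comb_phase x tau xi)).
Proof. by apply: cL1_cexpi => //; apply: cL1_real; exact: L1_comb_hat. Qed.

Let packet y tau := cint mu (fun eta => (psi eta)%:C * cexpi (comb_phase y tau eta)).

(** For short times and near the origin the phase is at most [6 * pi * kappa * (1 + eta ^+ 2)], so
    the evolved profile is close to its value [I] at the origin at time 0. The two moments of [psi]
    give [I + J]. *)
Let packet_near kappa y tau : `|y| <= 3 * kappa -> 0 <= tau <= kappa ->
  normc (packet y tau - I%:C) <= 6 * pi * kappa * (I + J).
Proof.
move=> yk /andP[t0 tk].
have Ip := cL1_real L1_psi.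
have Ipe : cL1 mu (fun eta => (psi eta)%:C * cexpi (comb_phase y tau eta)).
  exact: cL1_cexpi.
have Id : cL1 mu (fun eta => (psi eta)%:C * (cexpi (comb_phase y tau eta) - 1)).
  apply: (@cL1M_bd _ _ _ _ 2) => //.
    have [h1 h2] := cmeas_cexpi (mphase y tau); split.
      rewrite (_ : _ \o _ = fun x => complex.Re (cexpi (comb_phase y tau x)) - 1).
        exact: measurable_funB.
      by apply/funext => z; rewrite [LHS]cReD cReN.
    rewrite (_ : _ \o _ = complex.Im (R := R) \o (fun x => cexpi (comb_phase y tau x)))//.
    by apply/funext => z; rewrite [LHS]cImD cImN /= oppr0 addr0.
  move=> z; rewrite (le_trans (le_normcD _ _))// normc_cexpi.
  by rewrite -[(-1)%R]/(- (1 : R[i])) normcN Normc.normc1.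
have -> : packet y tau - I%:C =
    cint mu (fun eta => (psi eta)%:C * (cexpi (comb_phase y tau eta) - 1)).
  have -> : I%:C = cint mu (fun eta => (psi eta)%:C).
    by apply: complexP => //=; rewrite Rintegral_cst// mul0r.
  apply: complexP; rewrite ?cReD ?cImD ?cReN ?cImN /=.
    rewrite -RintegralB//; [|exact: Ipe.1|exact: Ip.1].
    by apply: eq_Rintegral => eta _ /=; ring.
  rewrite -RintegralB//; [|exact: Ipe.2|exact: Ip.2].
  by apply: eq_Rintegral => eta _ /=; ring.
apply: (le_trans (normc_cint_le Id)).
have -> : 6 * pi * kappa * (I + J) =
    \int[mu]_eta (6 * pi * kappa * (psi eta + eta ^+ 2 * psi eta)).
  rewrite RintegralZl//; last by apply: L1D; [exact: L1_psi|exact: L1_sqpsi].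
  by rewrite RintegralD//; [exact: L1_psi|exact: L1_sqpsi].
apply: le_Rintegral => //.
- exact: ((cL1P _ _).1 Id).2.
- by apply: L1Z; apply: L1D; [exact: L1_psi|exact: L1_sqpsi].
- move=> eta _; rewrite Normc.normcM normc_real ger0_norm//.
  rewrite -[X in _ * (X + _)]mul1r -mulrDl mulrA [leRHS]mulrC ler_wpM2l//.
  rewrite (le_trans (normc_cexpi_sub1 _))// /comb_phase normrM.
  rewrite (ger0_norm (mulr_ge0 _ (pi_ge0 R)))//.
  have -> : 6 * pi * kappa * (1 + eta ^+ 2) = 2 * pi * (3 * kappa * (1 + eta ^+ 2)) by ring.
  rewrite ler_wpM2l ?mulr_ge0 ?pi_ge0//.
  rewrite (le_trans (ler_normB _ _))// (normrM y) (ger0_norm (mulr_ge0 t0 (sqr_ge0 eta))).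
  have k0 : 0 <= kappa by exact: le_trans tk.
  have h1 : `|y| * `|eta| <= 3 * kappa * `|eta| by rewrite ler_wpM2r.
  have h2 : tau * eta ^+ 2 <= kappa * eta ^+ 2 by rewrite ler_wpM2r ?sqr_ge0.
  have h3 : `|eta| <= 1 / 2 + 1 / 2 * eta ^+ 2.
    by have := sqr_ge0 (`|eta| - 1); rewrite sqrrB real_normK ?num_real//; lra.
  have := ler_wpM2l (_ : 0 <= 3 * kappa) h3; rewrite mulr_ge0// => /(_ isT) h4.
  have := mulr_ge0 k0 (sqr_ge0 eta); nra.
Qed.

(** Galilean invariance: moving the profile to frequency [node m] multiplies its evolution by a
    phase and moves the point of observation by [2 * tau * node m]. *)
Let evolE x tau :
  cint mu (fun xi => (comb_hat xi)%:C * cexpi (comb_phase x tau xi)) =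
  \sum_(m < M) cexpi (comb_phase x tau (node m)) * packet (x - 2 * tau * node m) tau.
Proof.
have E : (fun xi => (comb_hat xi)%:C * cexpi (comb_phase x tau xi)) =
    (fun xi => \sum_(m < M) (psi (xi - node m))%:C * cexpi (comb_phase x tau xi)).
  by apply/funext => xi; rewrite /comb_hat rmorph_sum mulr_suml.
rewrite E cint_sum; last first.
  by move=> m; apply: cL1_cexpi => //; exact: cL1_real.
apply: eq_bigr => m _.
have Ip := cL1_cexpi (mphase (x - 2 * tau * node m) tau) (cL1_real L1_psi).
rewrite /packet -cintZ//.
pose g eta := cexpi (comb_phase x tau (node m)) *
  ((psi eta)%:C * cexpi (comb_phase (x - 2 * tau * node m) tau eta)).
have Ig : cL1 mu g by exact: cL1Z.
have -> : (fun xi => (psi (xi - node m))%:C * cexpi (comb_phase x tau xi)) =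
    (fun xi => g (xi - node m)).
  apply/funext => xi; rewrite /g mulrCA -cexpiD; congr (_ * cexpi _).
  by rewrite /comb_phase; ring.
apply: complexP => /=.
  exact: (@Rint_shift _ (complex.Re (R := R) \o g) (- node m)) Ig.1.
exact: (@Rint_shift _ (complex.Im (R := R) \o g) (- node m)) Ig.2.
Qed.

(** Up to the common phase [t0], each of the [M] terms is within [I / 2] of [I]: a quarter from
    [packet_near], at a point of modulus at most [3 * kappa], and a quarter from the phase error
    [dl]. No cancellation can then occur. *)
Lemma comb_evol_low kappa x tau (t0 : R) (dl : 'I_M -> R) :
  6 * pi * kappa * (I + J) <= I / 4 ->
  `|x| <= kappa -> 0 <= tau <= kappa -> (forall m, 0 <= node m /\ tau * node m <= kappa) ->
  (forall m, `|dl m| <= 1 / 4) ->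
  (forall m, cexpi (comb_phase x tau (node m)) = cexpi t0 * cexpi (dl m)) ->
  M%:R * (I / 2) <=
  normc (cint mu (fun xi => (comb_hat xi)%:C * cexpi (comb_phase x tau xi))).
Proof.
move=> kI xk tk nk dl4 ph; rewrite evolE.
pose P m := packet (x - 2 * tau * node m) tau.
have near m : normc (P m - I%:C) <= I / 4.
  apply: le_trans kI; apply: packet_near => //.
  have [n0 n1] := nk m; have /andP[ta _] := tk.
  rewrite (le_trans (ler_normB _ _))//.
  have -> : 3 * kappa = kappa + 2 * kappa by ring.
  by rewrite lerD// -mulrA normrM normr_nat ler_wpM2l// ger0_norm// mulr_ge0.
under eq_bigr do rewrite ph -mulrA.
rewrite -mulr_sumr Normc.normcM normc_cexpi mul1r.
have I0 : 0 <= I by exact: ltW.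
have term m : normc (cexpi (dl m) * P m - I%:C) <= I / 2.
  have -> : cexpi (dl m) * P m - I%:C =
      cexpi (dl m) * (P m - I%:C) + (cexpi (dl m) - 1) * I%:C.
    by rewrite mulrBr mulrBl mul1r addrA subrK.
  rewrite (le_trans (le_normcD _ _))// !Normc.normcM normc_cexpi mul1r normc_real ger0_norm//.
  have h1 := near m; have h2 := le_trans (normc_cexpi_sub1 (dl m)) (dl4 m).
  have := ler_wpM2r I0 h2; lra.
set Z := \sum_(i < M) _.
have -> : M%:R * (I / 2) = M%:R * I - M%:R * (I / 2) by lra.
have EZ : (M%:R * I)%:C = Z - \sum_(m < M) (cexpi (dl m) * P m - I%:C).
  rewrite sumrB opprB addrCA subrr addr0 sumr_const card_ord.
  by rewrite mulr_natl rmorphMn.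
have -> : M%:R * I = normc (M%:R * I)%:C by rewrite normc_real ger0_norm// mulr_ge0.
rewrite EZ lerBlDr (le_trans (le_normcD _ _))// lerD2l normcN.
rewrite (le_trans (normc_sum _ _))// (le_trans (ler_sum _ (fun m _ => term m)))//.
by rewrite sumr_const card_ord mulr_natl.
Qed.

End nodes.

(* Base-Q digits: adding [d * Q ^ i] to [k] moves [k / Q ^ i.+1] by [d / Q] and
   changes the lower quotients by integers. *)
Lemma digits (Q n : nat) (y : 'I_n -> R) : (0 < Q)%N ->
  exists k : int, forall i : 'I_n, exists l : int,
    0 <= y i - k%:~R / Q%:R ^+ i.+1 - l%:~R <= 1 / Q%:R.
Proof.
move=> Q0; have QR : 0 < Q%:R :> R by rewrite ltr0n.
elim: n y => [|n IH] y; first by exists 0 => -[].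
have [k Hk] := IH (fun i => y (widen_ord (leqnSn n) i)).
pose z := y ord_max - k%:~R / Q%:R ^+ n.+1.
pose d := Num.floor (Q%:R * z).
exists (k + d * (Q ^ n)%:Z) => i.
have [->|ni] := eqVneq i ord_max.
  exists 0; rewrite rmorph0 subr0.
  have -> : y ord_max - (k + d * (Q ^ n)%:Z)%:~R / Q%:R ^+ (ord_max : 'I_n.+1).+1 =
      z - d%:~R / Q%:R.
    rewrite /z /= rmorphD rmorphM /= -pmulrn natrX exprS.
    by field; rewrite ?expf_neq0 gt_eqF.
  have h1 : d%:~R <= Q%:R * z by exact: floor_le_tmp.
  have h2 : Q%:R * z < (d + 1)%:~R by exact: floorD1_gt.
  rewrite subr_ge0 ler_pdivrMr// mulrC h1 /= lerBlDr -mulrDl.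
  by rewrite ler_pdivlMr// mulrC addrC -[1]/(1%:~R) -rmorphD ltW.
have iin : (i < n)%N by rewrite ltn_neqAle -ltnS ltn_ord andbT.
have [l Hl] := Hk (Ordinal iin).
exists (l - d * (Q ^ (n - i.+1))%:Z).
rewrite (_ : widen_ord _ (Ordinal iin) = i) /= in Hl; last exact: val_inj.
rewrite (_ : y i - _ - _ = y i - k%:~R / Q%:R ^+ i.+1 - l%:~R)//.
rewrite !(rmorphD, rmorphN, rmorphM)/= -!pmulrn !natrX.
have -> : Q%:R ^+ n = Q%:R ^+ (n - i.+1) * Q%:R ^+ i.+1 :> R by rewrite -exprD subnK.
have q0 : Q%:R ^+ i.+1 != 0 :> R by rewrite expf_neq0// gt_eqF.
by field.
Qed.

End comb.

(** * Lattice data in dimension n *)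

Lemma cexpi_intpi (R : realType) (z : int) : cexpi (2 * pi * z%:~R) = 1 :> R[i].
Proof.
case: z => k; first by rewrite -pmulrn cexpi_natpi.
by rewrite NegzE mulrNz -pmulrn mulrN cexpiN_natpi.
Qed.

Lemma le_prod_1D (R : realDomainType) (I : Type) (s : seq I) (a : I -> R) :
  (forall i, 0 <= a i) -> 1 + \sum_(i <- s) a i <= \prod_(i <- s) (1 + a i).
Proof.
move=> a0; elim: s => [|i s IH]; first by rewrite !big_nil addr0.
rewrite !big_cons; have h0 : 0 <= \sum_(j <- s) a j by apply: sumr_ge0.
have := ler_wpM2l (_ : 0 <= 1 + a i) IH; rewrite addr_ge0// => /(_ isT).
have := mulr_ge0 (a0 i) h0; lra.
Qed.

Section block.
Context (R : realType) (n : nat).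
Hypothesis n_gt0 : (0 < n)%N.
Local Notation mu := (@lebesgue_measure R).
Local Notation RR := (measurableTypeR R).
Local Notation E := (euclid R n).
Local Notation normc := (@Normc.normc R).
Local Notation "x %:C" := (real_complex R x).

Definition sob (s : R) (xi : E) : R := (1 + dot xi xi) `^ s.

Definition cube (kappa : R) : set E := [set x | forall i, `|tnth x i| <= kappa].

Lemma dot_ge0 (x : E) : 0 <= dot x x.
Proof. by apply: sumr_ge0 => i _; rewrite -expr2 sqr_ge0. Qed.

(** The radial weight is traded for a product weight, so that Sobolev norms of tensor products
    factor. The product [P] satisfies [1 + |xi|^2 <= r ^+ 2 * P] and [1 <= P], and [P] to the power
    [s] is at most [P] as [s <= 1]. *)
Lemma sob_le s r (xi : E) : 0 <= s <= 1 -> 1 <= r ->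
  sob s xi <= (r `^ s) ^+ 2 * tens (fun _ y => 1 + y ^+ 2 / r ^+ 2) xi.
Proof.
move=> /andP[s0 s1] r1; rewrite /sob.
set P := tens _ _.
have r0 : 0 < r by rewrite (lt_le_trans ltr01).
have r20 : 0 < r ^+ 2 by rewrite exprn_gt0.
have a0 i : 0 <= tnth xi i ^+ 2 / r ^+ 2 by rewrite divr_ge0 ?sqr_ge0.
have P1 : 1 <= P.
  rewrite /P /tens; apply: (le_trans _ (le_prod_1D _ a0)).
  by rewrite lerDl sumr_ge0.
have P0 : 0 <= P by exact: le_trans P1.
have dP : 1 + dot xi xi <= r ^+ 2 * P.
  rewrite -ler_pdivrMl//; apply: (le_trans _ (le_prod_1D _ a0)).
  rewrite mulrDr mulr1 lerD//; first by rewrite invf_le1// expr_ge1// ltW.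
  by rewrite /dot mulr_sumr; apply: ler_sum => i _; rewrite mulrC expr2.
have d0 := dot_ge0 xi.
apply: (@le_trans _ _ ((r ^+ 2 * P) `^ s)).
  by rewrite ge0_ler_powR// nnegrE ?addr_ge0// mulr_ge0// ltW.
rewrite powRM ?(ltW r20)// [in r ^+ 2]expr2 powRM ?(ltW r0)// -expr2.
rewrite ler_wpM2l ?sqr_ge0// -[leRHS](powRr1 P0).
exact: ler_powR.
Qed.

Variables (phi psi : R -> R).
Hypothesis bp : bumpR 2 (1 / 8) (1 / 16) phi psi.
Hypothesis mpsi : measurable_fun setT (psi : RR -> R).
Hypothesis psi4 : forall xi, 0 <= psi xi <= 4 / (1 + xi ^+ 2) ^+ 2.
Hypothesis psiN : forall xi, psi (- xi) = psi xi.
Hypothesis psi_nat : forall k : nat, k != 0%N -> psi k%:R = 0.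
Hypothesis I_gt0 : 0 < \int[mu]_xi psi xi.

Let I := \int[mu]_xi psi xi.
Let J := \int[mu]_xi (xi ^+ 2 * psi xi).
Variable kappa : R.
Hypothesis kappa_gt0 : 0 < kappa.
Hypothesis kappaI : 6 * pi * kappa * (I + J) <= I / 4.
Variable q : nat.
Hypothesis q_pi : 8 * pi <= q%:R :> R.
Hypothesis q_kappa : 2 / kappa <= q%:R.

(** * A block with [M] frequencies per coordinate *)

Section scale.
Variables M Q D : nat.
Hypothesis M_gt0 : (0 < M)%N.
Hypothesis QE : Q = (q * M)%N.
Hypothesis DQ : D = (Q ^ n.+1)%N.
(** The largest frequency scale: all nodes are at most [Q ^ n.+1 * M], and [M <= Q]. *)
Let r : R := Q%:R ^+ n.+2.
(** The 1/2 cancels the 2 of the cross term [2 * v i * D * m] in the squared node. *)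
Let v (i : 'I_n) : R := Q%:R ^+ (n - i) / 2.

Let q_gt0 : (0 < q)%N.
Proof.
rewrite -(ltr0n R); apply: lt_le_trans q_pi.
by rewrite mulr_gt0// pi_gt0.
Qed.

Let Q_gt0 : (0 < Q)%N. Proof. by rewrite QE muln_gt0 q_gt0. Qed.
Let QR_gt0 : 0 < Q%:R :> R. Proof. by rewrite ltr0n. Qed.
Let Q1 : 1 <= Q%:R :> R. Proof. by rewrite ler1n. Qed.
Let MQ : (M <= Q)%N. Proof. by rewrite QE leq_pmull. Qed.
Let MD : (M <= D)%N.
Proof. by rewrite (leq_trans MQ)// DQ expnS leq_pmulr// expn_gt0 Q_gt0. Qed.
Let r1 : 1 <= r. Proof. by rewrite expr_ge1// ltW. Qed.
Let DE : D%:R = Q%:R ^+ n.+1 :> R. Proof. by rewrite DQ natrX. Qed.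

Let node_bd i m : 0 <= @node R M D (v i) m <= Q%:R ^+ n.+1 * M%:R.
Proof.
have v0 : 0 <= v i by rewrite divr_ge0// exprn_ge0// ltW.
have QD : 0 < Q%:R ^+ n.+1 :> R by rewrite exprn_gt0.
rewrite /node DE; apply/andP; split.
  by rewrite addr_ge0// mulr_ge0// ltW.
have vD : v i <= Q%:R ^+ n.+1.
  rewrite /v ler_pdivrMr// (@le_trans _ _ (Q%:R ^+ n.+1))//.
    by rewrite ler_weXn2l// leqW// leq_subr.
  by rewrite ler_peMr ?(ltW QD)// ler1n.
apply: (@le_trans _ _ (Q%:R ^+ n.+1 * (1 + m%:R))).
  by rewrite mulrDr mulr1 lerD2r.
by rewrite ler_wpM2l ?(ltW QD)// nat1r ler_nat.
Qed.

Let node_le_r i m : 0 <= @node R M D (v i) m <= r.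
Proof.
have /andP[h0 h1] := node_bd i m; rewrite h0 (le_trans h1)// /r [leRHS]exprSr.
by rewrite ler_wpM2l ?exprn_ge0 ?(ltW QR_gt0)// ler_nat.
Qed.

Variable c : R.
Hypothesis c_ge0 : 0 <= c.

Definition blk_f (x : E) : R[i] := c%:C * tens (fun i => comb_fun phi M D (v i)) x.

Definition blk_h (xi : E) : R := c * tens (fun i => comb_hat psi M D (v i)) xi.

Definition blk_g (xi : E) : R[i] := (blk_h xi)%:C.

Lemma L1_blk_h : L1 (leb R n) blk_h.
Proof.
apply: L1Z; apply: (Rint_tens _).1 => i; exact: L1_comb_hat.
Qed.

Lemma cL1_blk_g : cL1 (leb R n) blk_g.
Proof.
split; first exact: L1_blk_h.
rewrite (_ : _ \o _ = fun x => 0 * blk_h x); first exact: L1Z L1_blk_h.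
by apply/funext => x /=; rewrite mul0r.
Qed.

Lemma cmeas_blk_f : cmeas blk_f.
Proof.
apply: cmeasM; first by split; exact: measurable_cst.
by apply: cmeas_tens => i; exact: (cmeas_comb_fun bp).
Qed.

Lemma blk_f_supp x : ~ eball (2 * n) x -> blk_f x = 0.
Proof.
move=> xn; have [i xi] : exists i, 2 < `|tnth x i|.
  apply: contrapT => h; apply: xn; rewrite /eball /=.
  have x2 i : `|tnth x i| <= 2 by rewrite leNgt; apply/negP => hi; apply: h; exists i.
  (* In the cube of half-side 2, [|x|^2 <= 4 * n <= (2 * n) ^ 2], because [n] is positive. *)
  apply: (@le_trans _ _ (\sum_(i < n) 4)).
    apply: ler_sum => i _; rewrite -expr2 -real_normK ?num_real//.
    by have := x2 i; have := normr_ge0 (tnth x i); nra.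
  rewrite sumr_const card_ord -mulr_natl natrM.
  by have : 1 <= n%:R :> R; [rewrite ler1n|nra].
rewrite /blk_f /tens (bigD1 i)//= (comb_fun_supp bp)//.
by rewrite mul0r mulr0.
Qed.

Lemma blk_f_fourier xi :
  cL1 (leb R n) (fun x => blk_f x * cexpi (- (2 * pi * dot x xi))) /\
  cint (leb R n) (fun x => blk_f x * cexpi (- (2 * pi * dot x xi))) = blk_g xi.
Proof.
pose F i x := comb_fun phi M D (v i) x * cexpi (- (2 * pi * x * tnth xi i)).
have EF : (fun x => blk_f x * cexpi (- (2 * pi * dot x xi))) =
    (fun x => c%:C * tens F x).
  apply/funext => x; rewrite /blk_f -mulrA; congr (_ * _).
  have -> : - (2 * pi * dot x xi) = \sum_(i < n) - (2 * pi * tnth x i * tnth xi i).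
    by rewrite sumrN /dot mulr_sumr; congr (- _); apply: eq_bigr => i _; rewrite mulrA.
  by rewrite cexpi_sum /tens -big_split.
have IF i : cL1 mu (F i).
  exact: (comb_fun_fourier bp psiN _ _ _ (tnth xi i)).1.
have [IT ET] := cint_tens IF.
rewrite EF; split; first exact: cL1Z.
rewrite cintZ// ET /blk_g /blk_h rmorphM rmorph_prod; congr (_ * _).
apply: eq_bigr => i _.
exact: (comb_fun_fourier bp psiN _ _ _ (tnth xi i)).2.
Qed.

Lemma blk_f_sq : L1 (leb R n) (fun x => normc (blk_f x) ^+ 2) /\
  \int[leb R n]_x (normc (blk_f x) ^+ 2) <= c ^+ 2 * M%:R ^+ n.
Proof.
pose F i x := normc (comb_fun phi M D (v i) x) ^+ 2.
have HF i := comb_fun_sq bp psiN psi_nat (v i) M_gt0 MD.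
have EF x : normc (blk_f x) ^+ 2 = c ^+ 2 * tens F x.
  rewrite /blk_f Normc.normcM exprMn normc_real real_normK ?num_real//.
  by rewrite normc_prod -prodrXl.
have [IT ET] := Rint_tens (f := F) (fun i => (HF i).1).
have -> : (fun x => normc (blk_f x) ^+ 2) = (fun x => c ^+ 2 * tens F x).
  by apply/funext.
split; first exact: L1Z.
rewrite RintegralZl// ler_wpM2l ?sqr_ge0// ET -[n in leRHS]card_ord -prodr_const.
apply: ler_prod => i _; rewrite (HF i).2 andbT.
by apply: Rintegral_ge0 => x _; rewrite exprn_ge0// normc_ge0.
Qed.

Lemma measurable_sob s : measurable_fun setT (sob s : E -> R).
Proof.
apply: (measurableT_comp (@measurable_powR R s)).
by apply: measurable_funD => //; exact: measurable_dot.
Qed.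

Lemma blk_g_sob s : 0 <= s <= 1 ->
  L1 (leb R n) (fun xi => sob s xi * normc (blk_g xi) ^+ 2) /\
  \int[leb R n]_xi (sob s xi * normc (blk_g xi) ^+ 2) <=
  (r `^ s) ^+ 2 * c ^+ 2 * (8 * (3 * I + 2 * J) * M%:R) ^+ n.
Proof.
move=> s01; pose G i y := (1 + y ^+ 2 / r ^+ 2) * comb_hat psi M D (v i) y ^+ 2.
have HG i := comb_hat_sq mpsi psi4 M_gt0 MD r1 (node_le_r i).
have [IT ET] := Rint_tens (f := G) (fun i => (HG i).1).
have key xi : sob s xi * normc (blk_g xi) ^+ 2 <= (r `^ s) ^+ 2 * c ^+ 2 * tens G xi.
  rewrite /blk_g normc_real real_normK ?num_real// /blk_h exprMn.
  have -> : tens G xi = tens (fun _ y => 1 + y ^+ 2 / r ^+ 2) xi *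
      tens (fun i => comb_hat psi M D (v i)) xi ^+ 2.
    by rewrite /tens -prodrXl -big_split.
  set X := c ^+ 2 * tens (fun i => comb_hat psi M D (v i)) xi ^+ 2.
  rewrite [leRHS](_ : _ = (r `^ s) ^+ 2 * tens (fun _ y => 1 + y ^+ 2 / r ^+ 2) xi * X).
    by apply: ler_wpM2r; [rewrite /X -exprMn sqr_ge0|exact: sob_le].
  by rewrite /X mulrACA.
have sob0 xi : 0 <= sob s xi by exact: powR_ge0.
have mg : measurable_fun setT (fun xi => sob s xi * normc (blk_g xi) ^+ 2).
  apply: measurable_funM; first exact: measurable_sob.
  apply: measurable_funX; apply: measurable_normc; exact: cL1_cmeas cL1_blk_g.
have IR : L1 (leb R n) (fun xi => (r `^ s) ^+ 2 * c ^+ 2 * tens G xi) by exact: L1Z.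
have Ig : L1 (leb R n) (fun xi => sob s xi * normc (blk_g xi) ^+ 2).
  apply: (L1_le mg IR) => xi; rewrite ger0_norm.
    by rewrite (le_trans (key xi))// ler_norm.
  by rewrite mulr_ge0// exprn_ge0// normc_ge0.
split=> //; apply: (le_trans (le_Rintegral measurableT Ig IR (fun x _ => key x))).
have cc0 : 0 <= (r `^ s) ^+ 2 * c ^+ 2 by rewrite -exprMn sqr_ge0.
rewrite RintegralZl// ler_wpM2l// ET -[n in leRHS]card_ord -prodr_const.
apply: ler_prod => i _; rewrite (HG i).2 andbT.
apply: Rintegral_ge0 => x _; apply: mulr_ge0; last exact: sqr_ge0.
by rewrite addr_ge0// divr_ge0 ?sqr_ge0.
Qed.

Lemma blk_evol x t :
  normc (schrodinger_on setT blk_g x t) = c * \prod_(i < n)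
   normc (cint mu (fun xi => (comb_hat psi M D (v i) xi)%:C *
      cexpi (comb_phase (tnth x i) (2 * pi * t) xi))).
Proof.
pose G i y := (comb_hat psi M D (v i) y)%:C * cexpi (comb_phase (tnth x i) (2 * pi * t) y).
have IG i : cL1 mu (G i) by exact: cL1_comb_evol.
have [IT ET] := cint_tens IG.
rewrite -normc_prod -ET -[in X in X * _](ger0_norm c_ge0) -normc_real -Normc.normcM -cintZ//.
congr (normc _); rewrite /schrodinger_on -[cintegral _ _]/(cint (leb R n) _).
congr (cint _ _); apply/funext => xi.
rewrite /blk_g /blk_h rmorphM rmorph_prod -[LHS]mulrA; congr (_ * _).
rewrite /tens /G big_split/= -cexpi_sum; congr (_ * cexpi _).
rewrite /dot !mulr_sumr -sumrB; apply: eq_bigr => i _.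
by rewrite /comb_phase; ring.
Qed.

Definition blk_time (k : nat) : R := k%:R / D%:R ^+ 2 / (2 * pi).

(** The numerators form a complete residue system modulo [Q ^ n]. They start at [Q ^ n] rather than
    0 so that every time is positive, as convergence is only assumed for [t] different from 0. *)
Definition blk_times : seq R := [seq blk_time k | k <- iota (Q ^ n) (Q ^ n)].

Lemma blk_time_bd k : (Q ^ n <= k < 2 * Q ^ n)%N -> 0 < blk_time k <= 2 / Q%:R.
Proof.
move=> /andP[k1 k2].
have p0 : 0 < 2 * pi :> R by rewrite mulr_gt0// pi_gt0.
have k0 : (0 < k)%N by rewrite (leq_trans _ k1)// expn_gt0 Q_gt0.
have D0 : 0 < D%:R ^+ 2 :> R by rewrite exprn_gt0// DE exprn_gt0.
rewrite /blk_time !divr_gt0 ?ltr0n//= ler_pdivrMr//.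
apply: (@le_trans _ _ (2 / Q%:R)); last first.
  rewrite ler_peMr ?divr_ge0 ?ltW//.
  by rewrite (@le_lt_trans _ _ 2)// ?ler1n// ltr_pMr// (lt_le_trans _ (pi_ge2 R))// ltr1n.
rewrite ler_pdivrMr// DE mulrAC ler_pdivlMr//.
apply: (@le_trans _ _ (2 * Q%:R ^+ n * Q%:R)).
  rewrite ler_wpM2r ?(ltW QR_gt0)//.
  by rewrite -natrX -[2]/(2%:R) -natrM ler_nat ltnW.
rewrite -mulrA -exprSr ler_wpM2l// -exprM ler_weXn2l//.
by rewrite leq_pmulr.
Qed.

Lemma blk_low x : cube kappa x -> exists2 t, t \in blk_times &
  c * (M%:R * (I / 2)) ^+ n <= normc (schrodinger_on setT blk_g x t).
Proof.
move=> xK.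
have [k0 Hk0] := digits (fun i => D%:R * tnth x i) Q_gt0.
have [k kb [w kmod]] : exists2 k, (Q ^ n <= k < 2 * Q ^ n)%N &
    exists w : int, k0 = k%:Z + (Q ^ n)%:Z * w.
  (* Changing [k0] by a multiple of [Q ^ n] changes each [k0 / Q ^ i.+1] by an integer, as [i < n].
     The residue is raised by [Q ^ n] to land in the range of [blk_times], hence the quotient minus
     1. *)
  pose P : int := (Q ^ n)%:Z.
  have P0 : P != 0 by rewrite /P eqz_nat -lt0n expn_gt0 Q_gt0.
  exists (`|(k0 %% P)%Z| + Q ^ n)%N; last first.
    exists ((k0 %/ P)%Z - 1).
    rewrite {1}(divz_eq k0 P) PoszD gez0_abs ?modz_ge0// -/P; ring.
  rewrite leq_addl/= mul2n -addnn ltn_add2r -ltz_nat gez0_abs ?modz_ge0//.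
  by rewrite ltz_pmod// ltz_nat expn_gt0 Q_gt0.
have Hk i : exists l : int, 0 <= D%:R * tnth x i - k%:R / Q%:R ^+ i.+1 - l%:~R <= 1 / Q%:R.
  have [l Hl] := Hk0 i.
  exists (l + (Q ^ (n - i.+1))%:Z * w).
  have q0 : Q%:R ^+ i.+1 != 0 :> R by rewrite expf_neq0// gt_eqF.
  have -> : D%:R * tnth x i - k%:R / Q%:R ^+ i.+1 - (l + (Q ^ (n - i.+1))%:Z * w)%:~R =
     D%:R * tnth x i - k0%:~R / Q%:R ^+ i.+1 - l%:~R :> R.
    rewrite kmod !(rmorphD, rmorphM)/= -!pmulrn !natrX.
    have -> : Q%:R ^+ n = Q%:R ^+ (n - i.+1) * Q%:R ^+ i.+1 :> R by rewrite -exprD subnK.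
    move: (Q%:R ^+ (n - i.+1)) (Q%:R ^+ i.+1) q0 => A B B0.
    by field.
  by [].
exists (blk_time k).
  by apply: map_f; rewrite mem_iota addnn -mul2n.
rewrite blk_evol ler_wpM2l// -[n in leLHS]card_ord -prodr_const.
have p0 : 2 * pi != 0 :> R by rewrite gt_eqF// mulr_gt0// pi_gt0.
have -> : 2 * pi * blk_time k = k%:R / D%:R ^+ 2 by rewrite /blk_time mulrC divfK.
set tau := _ / _.
have D0 : 0 < D%:R :> R by rewrite DE exprn_gt0.
have qR : 0 < q%:R :> R by rewrite ltr0n.
have tau0 : 0 <= tau by rewrite divr_ge0// exprn_ge0.
have QM : Q%:R = q%:R * M%:R :> R by rewrite QE natrM.
have MR : 0 < M%:R :> R by rewrite ltr0n.
(* Bounds the distance travelled by the fastest packet: [k < 2 * Q ^ n] and [D = Q ^ n.+1] leave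
   [2 * M / Q = 2 / q]. *)
have tauD : tau * (Q%:R ^+ n.+1 * M%:R) <= 2 / q%:R.
  rewrite /tau DE expr2.
  have QD : 0 < Q%:R ^+ n.+1 :> R by rewrite exprn_gt0.
  have -> : k%:R / (Q%:R ^+ n.+1 * Q%:R ^+ n.+1) * (Q%:R ^+ n.+1 * M%:R) =
      k%:R * M%:R / Q%:R ^+ n.+1 :> R by field; rewrite gt_eqF.
  rewrite ler_pdivrMr// mulrAC ler_pdivlMr//.
  have -> : 2 * Q%:R ^+ n.+1 = (2 * Q ^ n)%:R * (q%:R * M%:R) :> R.
    by rewrite -QM natrM natrX exprSr mulrA.
  by rewrite -mulrA (mulrC M%:R) ler_wpM2r ?mulr_ge0// ler_nat; case/andP: kb => _ /ltnW.
have qk : 2 / q%:R <= kappa.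
  by move: q_kappa; rewrite !ler_pdivrMr// mulrC.
apply: ler_prod => i _; apply/andP; split.
  by rewrite mulr_ge0// divr_ge0// ltW.
have [l Hl] := Hk i.
(* [dlt] is the error left by the digits, so [m * dlt] is at most [M / Q = 1 / q], and [8 * pi <= q]
   keeps the phase error below 1/4. The phase [z] at frequency [v i] is common to all nodes. *)
pose dlt := D%:R * tnth x i - k%:R / Q%:R ^+ i.+1 - l%:~R.
pose z := 2 * pi * (tnth x i * v i - tau * v i ^+ 2).
apply: (@comb_evol_low R psi mpsi psi4 I_gt0 M D (v i) kappa (tnth x i) tau z
  (fun m => 2 * pi * (m%:R * dlt))) => //.
- rewrite tau0/=; apply: le_trans qk; apply: le_trans tauD.
  rewrite ler_peMr//; have h1 : 1 <= Q%:R ^+ n.+1 :> R by rewrite expr_ge1// ltW.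
  have h2 : 1 <= M%:R :> R by rewrite ler1n.
  by rewrite (le_trans h1)// ler_peMr// (le_trans ler01).
- move=> m; have /andP[h0 h1] := node_bd i m; split => //.
  by apply: (le_trans _ qk); apply: (le_trans _ tauD); rewrite ler_wpM2l.
- move=> m; have /andP[d0 d1] := Hl.
  rewrite ger0_norm ?mulr_ge0 ?pi_ge0//.
  have h : m%:R * dlt <= M%:R * (1 / Q%:R).
    by rewrite ler_pM// ler_nat ltnW.
  have h' : M%:R * (1 / Q%:R) = 1 / q%:R :> R by rewrite QM; field; rewrite !gt_eqF.
  rewrite h' in h.
  have := ler_wpM2l (_ : 0 <= 2 * pi :> R) h; rewrite mulr_ge0 ?pi_ge0// => /(_ isT) h2.
  apply: (le_trans h2); rewrite mulrA mulr1 ler_pdivrMr//.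
  by have := q_pi; move: (pi : R) (q%:R : R) => a b; lra.
(* Expanding the square of the node: [tau * D ^ 2 = k] makes the quadratic term an integer, and
   [2 * tau * v i * D = k / Q ^ i.+1] puts the linear term in the form [m * (dlt + l)]. *)
- move=> m; have -> : comb_phase (tnth x i) tau (@node R M D (v i) m) =
      z + 2 * pi * (m%:R * dlt) +
      2 * pi * (m%:Z * l - k%:Z * m%:Z * m%:Z)%:~R.
    rewrite rmorphB !rmorphM/= -!pmulrn /comb_phase /z /node /dlt /tau /v DE.
    have -> : Q%:R ^+ n.+1 = Q%:R ^+ (n - i) * Q%:R ^+ i.+1 :> R.
      by rewrite -exprD; congr (_ ^+ _); rewrite addnS subnK// ltnW.
    field; rewrite !expf_neq0// gt_eqF//.
  by rewrite !cexpiD cexpi_intpi mulr1.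
Qed.

End scale.
End block.

(** * Limit theorems and square-summable series *)

(** Cauchy-Schwarz with weights [2 ^ i], whose inverses sum to at most 2. The constant is
    independent of [m], so the bound passes to infinite series. *)
Lemma sqr_sum_le (R : realFieldType) (a : nat -> R) m :
  (\sum_(i < m) a i) ^+ 2 <= 2 * \sum_(i < m) 2 ^+ i * a i ^+ 2.
Proof.
elim: m a => [|m IH] a; first by rewrite !big_ord0 expr0n mulr0.
rewrite !big_ord_recl /= expr0 mul1r.
have := IH (fun i => a i.+1).
have -> : \sum_(i < m) 2 ^+ bump 0 i * a (bump 0 i) ^+ 2 =
   2 * \sum_(i < m) 2 ^+ i * a i.+1 ^+ 2.
  by rewrite mulr_sumr; apply: eq_bigr => i _; rewrite /bump add1n exprS mulrA.
set b := \sum_(i < m) a i.+1; set c := \sum_(i < m) 2 ^+ i * _ => h.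
rewrite -[X in (_ + X) ^+ 2]/b; have := sqr_ge0 (a 0%N - b); nra.
Qed.

Section limits_L1.
Context d (T : measurableType d) (R : realType) (mu : {measure set T -> \bar R}).
Local Notation normc := (@Normc.normc R).
Local Notation Re := (@complex.Re R).
Local Notation Im := (@complex.Im R).

Lemma fatou_L1 (F : nat -> T -> R) (f : T -> R) (B : R) :
  measurable_fun setT f -> (forall x, F ^~ x @ \oo --> f x) ->
  (forall k x, 0 <= F k x) ->
  (forall k, L1 mu (F k)) -> (forall k, \int[mu]_x F k x <= B) ->
  L1 mu f /\ \int[mu]_x f x <= B.
Proof.
move=> mf Ff F0 IF FB.
have f0 x : 0 <= f x.
  rewrite -(cvg_lim _ (Ff x))//; apply: limr_ge; first exact: cvgP (Ff x).
  by apply: nearW => k; exact: F0.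
have H : (\int[mu]_x (f x)%:E <= B%:E)%E.
  rewrite (_ : (fun x => (f x)%:E) = (fun x => limn_einf (fun k => (F k x)%:E))); last first.
    apply/funext => x; have c : (fun k => (F k x)%:E) @ \oo --> (f x)%:E.
      by apply: cvg_EFin; [exact: nearW|exact: Ff].
    by rewrite is_cvg_limn_einfE; [apply/esym/cvg_lim|exact: cvgP c].
  apply: (le_trans (fatou mu measurableT _ _)).
  - by move=> k; exact/measurable_EFinP/(L1_measurable (IF k)).
  - by move=> k x _; rewrite lee_fin.
  - rewrite limn_einf_lim; apply: lime_le; first exact: is_cvg_einfs.
    apply: nearW => k; apply: (@le_trans _ _ (\int[mu]_x (F k x)%:E)%E).
      by apply: ereal_inf_lbound; exists k => /=.
    by rewrite -EFin_Rint// lee_fin.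
have If : L1 mu f.
  apply: L1P => //; under eq_integral do rewrite ger0_norm//.
  by rewrite (le_lt_trans H)// ltry.
by split => //; rewrite -lee_fin EFin_Rint.
Qed.

Lemma Rint_dominated (F : nat -> T -> R) (f g : T -> R) :
  measurable_fun setT f -> (forall k, measurable_fun setT (F k)) -> L1 mu g ->
  (forall x, F ^~ x @ \oo --> f x) -> (forall k x, `|F k x| <= g x) ->
  L1 mu f /\ \int[mu]_x F k x @[k --> \oo] --> \int[mu]_x f x.
Proof.
move=> mf mF Ig Ff Fg.
have [] := @dominated_convergence _ T R mu setT measurableT
  (fun k x => (F k x)%:E) (EFin \o f) (EFin \o g).
- by move=> k; exact/measurable_EFinP.
- exact/measurable_EFinP.
- by apply: aeW => x _; apply: cvg_EFin; [exact: nearW|exact: Ff].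
- by [].
- by apply: aeW => x k _; rewrite lee_fin.
move=> If _ cF; split => //.
apply: fine_cvg; rewrite fineK; last exact: integrable_fin_num.
exact: cF.
Qed.

Definition ccvg (z : nat -> R[i]) (l : R[i]) : Prop :=
  (Re \o z @ \oo --> Re l) /\ (Im \o z @ \oo --> Im l).

Lemma ccvg_sqr z l : ccvg z l -> normc (z k) ^+ 2 @[k --> \oo] --> normc l ^+ 2.
Proof.
move=> [z1 z2]; rewrite normc_sqr.
rewrite (_ : (fun k => _) = (fun k => Re (z k) ^+ 2 + Im (z k) ^+ 2)); last first.
  by apply/funext => k; rewrite normc_sqr.
by apply: cvgD; rewrite !expr2; apply: cvgM.
Qed.

Lemma ccvgB z l c : ccvg z l -> ccvg (fun k => z k - c) (l - c).
Proof.
move=> [z1 z2]; split; rewrite ?cReD ?cImD.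
  rewrite (_ : _ \o _ = fun k => Re (z k) + Re (- c)); last by apply/funext => k; rewrite /= cReD.
  by apply: cvgD => //; exact: cvg_cst.
rewrite (_ : _ \o _ = fun k => Im (z k) + Im (- c)); last by apply/funext => k; rewrite /= cImD.
by apply: cvgD => //; exact: cvg_cst.
Qed.

Lemma cint_dominated (F : nat -> T -> R[i]) (f : T -> R[i]) (g : T -> R) :
  cmeas f -> (forall k, cmeas (F k)) -> L1 mu g ->
  (forall x, ccvg (F ^~ x) (f x)) -> (forall k x, normc (F k x) <= g x) ->
  ccvg (fun k => cint mu (F k)) (cint mu f).
Proof.
move=> [mf1 mf2] mF Ig Ff Fg; split.
  apply: (@Rint_dominated (fun k x => Re (F k x)) (fun x => Re (f x)) g _ _ Ig _ _).2 => //.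
  - by move=> k; exact: (mF k).1.
  - by move=> x; exact: (Ff x).1.
  - by move=> k x; rewrite (le_trans (Re_le_normc _)).
apply: (@Rint_dominated (fun k x => Im (F k x)) (fun x => Im (f x)) g _ _ Ig _ _).2 => //.
- by move=> k; exact: (mF k).2.
- by move=> x; exact: (Ff x).2.
- by move=> k x; rewrite (le_trans (Im_le_normc _)).
Qed.

Lemma cmeas_sum (I : Type) (s : seq I) (F : I -> T -> R[i]) :
  (forall i, cmeas (F i)) -> cmeas (fun x => \sum_(i <- s) F i x).
Proof.
move=> mF; split.
  rewrite (_ : _ \o _ = fun x => \sum_(i <- s) Re (F i x)).
    by apply: measurable_sum => i; exact: (mF i).1.
  by apply/funext => x /=; rewrite (ReIm_sum _ _).1.
rewrite (_ : _ \o _ = fun x => \sum_(i <- s) Im (F i x)).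
  by apply: measurable_sum => i; exact: (mF i).2.
by apply/funext => x /=; rewrite (ReIm_sum _ _).2.
Qed.

(** On a set of finite measure L^2 is contained in L^1, from [|z| <= 1 + |z|^2]. *)
Lemma cL1_L2 (B : set T) f : cmeas f -> L1 mu (\1_B) -> (forall x, ~ B x -> f x = 0) ->
  L1 mu (fun x => normc (f x) ^+ 2) -> cL1 mu f.
Proof.
move=> mf IB fB I2; apply/cL1P; split=> //.
apply: (L1_le _ (L1D IB I2)); first exact: measurable_normc.
move=> x /=; rewrite ger0_norm ?normc_ge0// ger0_norm ?addr_ge0 ?exprn_ge0 ?normc_ge0//.
have n0 := normc_ge0 (f x).
have [Bx|Bx] := pselect (B x).
  by rewrite indicE mem_set//=; have := sqr_ge0 (normc (f x) - 1); nra.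
by rewrite fB// Normc.normc0 expr0n addr0.
Qed.

Lemma L2_sum_le (f : nat -> T -> R[i]) x m :
  normc (\sum_(i < m) f i x) ^+ 2 <= 2 * \sum_(i < m) 2 ^+ i * normc (f i x) ^+ 2.
Proof.
apply: le_trans (sqr_sum_le (fun i => normc (f i x)) m).
rewrite lerXn2r ?nnegrE ?normc_ge0 ?sumr_ge0//; last exact: normc_sum.
by move=> i _; exact: normc_ge0.
Qed.

(* The partial sums converge off the null set where [sum 2^i |f_i|^2] is
   infinite; the sum is redefined to be 0 there. *)
Lemma L2_series (B : set T) (f : nat -> T -> R[i]) (b : R) :
  L1 mu (\1_B) -> (forall i, cmeas (f i)) -> (forall i x, ~ B x -> f i x = 0) ->
  (forall i, L1 mu (fun x => normc (f i x) ^+ 2)) ->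
  (forall m, \sum_(i < m) 2 ^+ i * \int[mu]_x (normc (f i x) ^+ 2) <= b) ->
  exists u : T -> R[i], [/\ cmeas u, forall x, ~ B x -> u x = 0,
    L1 mu (fun x => normc (u x) ^+ 2) &
    forall e : T -> R, measurable_fun setT e ->
      ccvg (fun m => \sum_(i < m) cint mu (fun x => f i x * cexpi (e x)))
           (cint mu (fun x => u x * cexpi (e x)))].
Proof.
move=> IB mf fB If2 fb.
pose h i x : R := 2 ^+ i * normc (f i x) ^+ 2.
have h0 i x : 0 <= h i x by rewrite mulr_ge0 ?exprn_ge0 ?normc_ge0.
have Ih i : L1 mu (h i) by exact: L1Z.
have mh i : measurable_fun setT (h i) by exact: L1_measurable.
pose H x : \bar R := (\sum_(i <oo) (h i x)%:E)%E.
have H0 x : (0 <= H x)%E by apply: nneseries_ge0 => i _ _; rewrite lee_fin.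
have mH : measurable_fun setT H.
  apply: ge0_emeasurable_sum => [i x _ _|i _]; first by rewrite lee_fin.
  exact/measurable_EFinP.
have IH : (\int[mu]_x H x <= b%:E)%E.
  rewrite integral_nneseries//; last first.
  - by move=> i x _; rewrite lee_fin.
  - by move=> i; exact/measurable_EFinP.
  apply: lime_le; first by apply: is_cvg_nneseries => i _ _; apply: integral_ge0 => x _; rewrite lee_fin.
  apply: nearW => m; rewrite big_mkord.
  have E i : (\int[mu]_x (h i x)%:E)%E = (2 ^+ i * \int[mu]_x (normc (f i x) ^+ 2))%:E.
    by rewrite -EFin_Rint// RintegralZl.
  by under eq_bigr do rewrite E; rewrite sumEFin lee_fin.
have IntH : mu.-integrable setT H.
  apply/integrableP; split => //; under eq_integral do rewrite gee0_abs//.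
  by rewrite (le_lt_trans IH)// ltry.
pose A := [set x | (H x < +oo)%E].
have mA : measurable A by rewrite -[A]setTI; exact: emeasurable_fun_infty_o.
have muA : {ae mu, forall x, A x}.
  have := integrable_ae measurableT IntH; apply: filterS => x /(_ I).
  by rewrite ge0_fin_numE.
pose Hr x := fine (H x).
have Hr0 x : 0 <= Hr x by exact: fine_ge0.
have IHr : L1 mu Hr.
  apply: (le_integrable measurableT _ _ IntH).
    by apply/measurable_EFinP; apply: measurableT_comp.
  move=> x _; rewrite /Hr /=; have := H0 x.
  by case: (H x) => [r||] //= r0; rewrite ?leey// lee_fin.
pose f' i x := real_complex R (\1_A x) * f i x.
have f'A i x : A x -> f' i x = f i x by move=> Ax; rewrite /f' indicE mem_set//= rmorph1 mul1r.
have f'N i x : ~ A x -> f' i x = 0 by move=> Ax; rewrite /f' indicE memNset//= rmorph0 mul0r.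
have mf' i : cmeas (f' i).
  by apply: cmeasM => //; split; [exact: measurable_indic|exact: measurable_cst].
have f'B i x : ~ B x -> f' i x = 0 by move=> Bx; rewrite /f' fB// mulr0.
have sq m x : \sum_(i < m) 2 ^+ i * normc (f' i x) ^+ 2 <= Hr x.
  have [Ax|Ax] := pselect (A x); last first.
    by rewrite big1// => i _; rewrite f'N// Normc.normc0 expr0n mulr0.
  rewrite -lee_fin /Hr fineK ?ge0_fin_numE//.
  apply: le_trans (nneseries_lim_ge m _); last by move=> i _ _; rewrite lee_fin.
  rewrite big_mkord sumEFin lee_fin; apply: ler_sum => i _.
  by rewrite f'A.
pose S m x := \sum_(i < m) f' i x.
have S2 m x : normc (S m x) ^+ 2 <= 2 * Hr x.
  by apply: (le_trans (L2_sum_le f' x m)); rewrite ler_pM2l.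
have mS m : cmeas (S m) by exact: cmeas_sum.
(* From [z ^ 2 <= 2 * Hr x] and [z <= 1 + z ^ 2]: absolute convergence at every point, with a bound
   by [1 + 2 * Hr x]. *)
have g2 m x : \sum_(i < m) normc (f' i x) <= 1 + 2 * Hr x.
  have := le_trans (sqr_sum_le (fun i => normc (f' i x)) m) (_ : _ <= 2 * Hr x).
  rewrite ler_pM2l// => /(_ (sq m x)).
  set z := \sum_(i < m) _ => hz; have := sqr_ge0 (z - 1); nra.
have abscv (p : R[i] -> R) x : (forall z, `|p z| <= normc z) ->
    cvgn (series (fun i => p (f' i x))).
  move=> pz; apply: (@normed_cvg R R^o).
  apply: nondecreasing_is_cvgn.
    by apply: nondecreasing_series => i _ _; exact: normr_ge0.
  exists (1 + 2 * Hr x) => _ [m _ <-].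
  apply: le_trans (g2 m x); rewrite /= seriesEord /=.
  by apply: ler_sum => i _; exact: pz.
pose u x : R[i] := Complex (limn (series (fun i => Re (f' i x))))
  (limn (series (fun i => Im (f' i x)))).
have Su x : ccvg (S ^~ x) (u x).
  have ERe : Re \o (S ^~ x) = series (fun i => Re (f' i x)).
    by apply/funext => m; rewrite /series /= big_mkord /S (ReIm_sum _ _).1.
  have EIm : Im \o (S ^~ x) = series (fun i => Im (f' i x)).
    by apply/funext => m; rewrite /series /= big_mkord /S (ReIm_sum _ _).2.
  split; rewrite ?ERe ?EIm; apply: abscv; [exact: Re_le_normc|exact: Im_le_normc].
have mu' : cmeas u.
  split.
    apply: (@measurable_fun_cvg _ _ _ setT (fun m x => Re (S m x))).
      by move=> m; exact: (mS m).1.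
    by move=> x _; exact: (Su x).1.
  apply: (@measurable_fun_cvg _ _ _ setT (fun m x => Im (S m x))).
    by move=> m; exact: (mS m).2.
  by move=> x _; exact: (Su x).2.
have uB x : ~ B x -> u x = 0.
  move=> Bx; have [c1 c2] := Su x.
  have S0 m : S m x = 0 by rewrite /S big1// => i _; exact: f'B.
  apply: complexP.
    apply/esym; rewrite -(cvg_lim _ c1)//.
    by rewrite (_ : _ \o _ = cst 0) ?lim_cst//; apply/funext => m; rewrite /= S0.
  apply/esym; rewrite -(cvg_lim _ c2)//.
  by rewrite (_ : _ \o _ = cst 0) ?lim_cst//; apply/funext => m; rewrite /= S0.
exists u; split => //.
  apply: (fatou_L1 (B := \int[mu]_x (2 * Hr x)) _ (fun x => ccvg_sqr (Su x)) _ _ _).1.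
  - by apply: measurable_funX; exact: measurable_normc.
  - by move=> m x; rewrite exprn_ge0// normc_ge0.
  - move=> m; apply: (L1_le _ (L1Z 2 IHr)).
      by apply: measurable_funX; exact: measurable_normc.
    by move=> x; rewrite !ger0_norm ?mulr_ge0 ?exprn_ge0 ?normc_ge0.
  - move=> m; apply: le_Rintegral => //; last exact: L1Z.
    apply: (L1_le _ (L1Z 2 IHr)).
      by apply: measurable_funX; exact: measurable_normc.
    by move=> x; rewrite !ger0_norm ?mulr_ge0 ?exprn_ge0 ?normc_ge0.
move=> e me; have mce := cmeas_cexpi me.
have If i : cL1 mu (f i) by exact: (cL1_L2 (mf i) IB (fB i) (If2 i)).
have If'2 i : L1 mu (fun x => normc (f' i x) ^+ 2).
  apply: (L1_le _ (If2 i)).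
    by apply: measurable_funX; exact: measurable_normc.
  move=> x; rewrite !ger0_norm ?exprn_ge0 ?normc_ge0//.
  have [Ax|Ax] := pselect (A x); first by rewrite f'A.
  by rewrite f'N// Normc.normc0 expr0n exprn_ge0// normc_ge0.
have If' i : cL1 mu (f' i) by exact: (cL1_L2 (mf' i) IB (f'B i) (If'2 i)).
(* Cutting [f i] down to [A] changes it on a null set only, so no integral changes. *)
have Ee i : cint mu (fun x => f i x * cexpi (e x)) = cint mu (fun x => f' i x * cexpi (e x)).
  have [m1 m2] := cmeasM (mf i) mce; have [m1' m2'] := cmeasM (mf' i) mce.
  apply: complexP; rewrite /cint; cbn [complex.Re complex.Im];
    rewrite /Rintegral; congr fine; apply: ae_eq_integral => //;
    try exact/measurable_EFinP;
    by apply: filterS muA => x Ax _ /=; rewrite f'A.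
have ES : (fun m => \sum_(i < m) cint mu (fun x => f i x * cexpi (e x))) =
    (fun m => cint mu (fun x => S m x * cexpi (e x))).
  apply/funext => m; under eq_bigr do rewrite Ee.
  rewrite -cint_sum; last by move=> i; exact: cL1_cexpi.
  by congr cint; apply/funext => x; rewrite mulr_suml.
rewrite ES; apply: (@cint_dominated _ _ (fun x => \1_B x + 2 * Hr x)).
- exact: cmeasM.
- by move=> m; exact: cmeasM.
- by apply: L1D => //; exact: L1Z.
- move=> x; have [c1 c2] := Su x; split.
    rewrite (_ : _ \o _ = (fun m => Re (S m x) * cos (e x) - Im (S m x) * sin (e x))).
      by rewrite cReM; apply: cvgB; apply: cvgMl.
    by apply/funext => m; rewrite [LHS]cReM.
  rewrite (_ : _ \o _ = (fun m => Re (S m x) * sin (e x) + Im (S m x) * cos (e x))).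
    by rewrite cImM; apply: cvgD; apply: cvgMl.
  by apply/funext => m; rewrite [LHS]cImM.
- move=> m x; rewrite Normc.normcM normc_cexpi mulr1.
  have [Bx|Bx] := pselect (B x); last first.
    rewrite /S big1 ?Normc.normc0 ?addr_ge0 ?mulr_ge0// => i _; exact: f'B.
  rewrite indicE mem_set//=; have := S2 m x; have := sqr_ge0 (normc (S m x) - 1).
  by have := normc_ge0 (S m x); nra.
Qed.

End limits_L1.

(** * Blocks that are large on a fixed cube *)

Section block_exists.
Context (R : realType) (n : nat).
Local Notation mu := (@lebesgue_measure R).
Local Notation RR := (measurableTypeR R).
Local Notation E := (euclid R n).
Local Notation normc := (@Normc.normc R).

(** A datum [f] with transform [g] and finite set of times [T]: [eps] bounds both squared norms and
    the times themselves, while [lam] is reached at every point of the cube at some time of [T]. *)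
Record block (s kappa eps lam : R) (f g : E -> R[i]) (T : seq R) : Prop := Block {
  block_meas : cmeas f;
  block_supp : forall x, ~ eball (2 * n) x -> f x = 0;
  block_L2 : L1 (leb R n) (fun x => normc (f x) ^+ 2);
  block_L2_le : \int[leb R n]_x (normc (f x) ^+ 2) <= eps;
  block_fourier : forall xi,
    cL1 (leb R n) (fun x => f x * cexpi (- (2 * pi * dot x xi))) /\
    cint (leb R n) (fun x => f x * cexpi (- (2 * pi * dot x xi))) = g xi;
  block_gL1 : cL1 (leb R n) g;
  block_sob : L1 (leb R n) (fun xi => sob s xi * normc (g xi) ^+ 2);
  block_sob_le : \int[leb R n]_xi (sob s xi * normc (g xi) ^+ 2) <= eps;
  block_times : forall t, t \in T -> 0 < t <= eps;
  block_low : forall x, cube kappa x ->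
    exists2 t, t \in T & lam <= normc (schrodinger_on setT g x t) }.

(** The order of the quantifiers matters: [kappa], the weight and its constant come before [eps] and
    [lam], so that all blocks share one cube and one Bessel inequality. *)
Lemma block_exists (s : R) : (0 < n)%N -> 0 < s <= 1 -> (n%:R + 2) * s < n%:R / 2 ->
  exists2 kappa : R, 0 < kappa &
  (forall eps lam : R, 0 < eps -> exists f g T, block s kappa eps lam f g T) /\
  exists (w : E -> R) (C : R), [/\ measurable_fun setT w /\ (forall x, 0 <= w x <= 1),
    0 < C, (forall x, cube kappa x -> 1 <= C * w x) &
    forall h : E -> R[i], cL1 (leb R n) h -> L1 (leb R n) (fun x => normc (h x) ^+ 2) ->
    let H x := cint (leb R n) (fun xi => h xi * cexpi (2 * pi * dot x xi)) in
    cmeas H /\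
    L1 (leb R n) (fun x => w x * normc (H x) ^+ 2) /\
    \int[leb R n]_x (w x * normc (H x) ^+ 2) <=
      C * \int[leb R n]_x (normc (h x) ^+ 2)].
Proof.
move=> n0 /andP[s0 s1] sn.
have [phi [psi [[bp mpsi psi4] [psiN psi_nat I0]]]] := profile_exists R.
set I := \int[mu]_xi psi xi in I0 *.
pose J := \int[mu]_xi (xi ^+ 2 * psi xi).
have psi0 xi : 0 <= psi xi by have /andP[] := psi4 xi.
have J0 : 0 <= J by exact: J_ge0.
have p0 : 0 < pi :> R by exact: pi_gt0.
have IJ0 : 0 < I + J by rewrite ltr_wpDr.
(* [k1] is the largest value allowed by [packet_near] with error [I / 4]; the bound 1/8 keeps the
   cube where [phi] is at least 1/16. *)
pose k1 : R := I / 4 / (6 * pi * (I + J)).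
have k10 : 0 < k1 by rewrite !divr_gt0// !mulr_gt0.
pose kappa := Num.min (1 / 8) k1.
have k0 : 0 < kappa by rewrite lt_min k10 andbT.
have k8 : kappa <= 1 / 8 by rewrite ge_min lexx.
have kI : 6 * pi * kappa * (I + J) <= I / 4.
  rewrite mulrAC -ler_pdivlMl ?mulr_gt0//.
  by rewrite mulrC ge_min lexx orbT.
exists kappa => //; split; last first.
  have Ipsi := L1_psi mpsi psi4.
  (* [16 ^+ n] inverts the lower bound of the weight on the cube, [2 * I ^+ n] is the constant of
     [bessel]. *)
  pose C : R := Num.max (16 ^+ n) (2 * I ^+ n).
  exists (wt phi), C; split.
  - split; first exact: L1_measurable (L1_wt n bp).
    by move=> x; rewrite (wt_ge0 bp) prodr_ile1// => i _; exact: bump_01 bp _.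
  - by rewrite lt_max exprn_gt0.
  - move=> x xK; apply: (@le_trans _ _ (16 ^+ n * wt phi x)); last first.
      by rewrite ler_wpM2r ?(wt_ge0 bp)// le_max lexx.
    have := wt_low bp (fun i => le_trans (xK i) k8).
    by rewrite expr_div_n expr1n mul1r -(ler_pM2l (_ : 0 < 16 ^+ n)) ?exprn_gt0// mulfV// gt_eqF// exprn_gt0.
  - move=> h h1 h2 H; have [b1 [b2 b3]] := bessel bp mpsi psi0 psiN Ipsi h1 h2.
    split=> //; split=> //; apply: (le_trans b3); rewrite ler_wpM2r//.
      by apply: Rintegral_ge0 => x _; rewrite exprn_ge0// normc_ge0.
    by rewrite le_max lexx orbT.
move=> eps lam eps0.
have [q [q_pi q_k]] : exists q : nat, 8 * pi <= q%:R :> R /\ 2 / kappa <= q%:R.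
  exists (Num.bound (8 * pi : R) + Num.bound (2 / kappa))%N; rewrite natrD; split.
    by rewrite (le_trans (ltW (archi_boundP _)))// ?mulr_ge0 ?(ltW p0)// lerDl.
  by rewrite (le_trans (ltW (archi_boundP _)))// ?divr_ge0 ?(ltW k0)// lerDr.
have q0 : (0 < q)%N.
  by rewrite -(ltr0n R); apply: lt_le_trans q_pi; rewrite mulr_gt0.
have qR : 0 < q%:R :> R by rewrite ltr0n.
pose C1 := 8 * (3 * I + 2 * J).
have C10 : 0 < C1 by rewrite mulr_gt0// ltr_pwDl ?mulr_gt0// mulr_ge0.
(* This choice makes both [eta ^+ 2] and [eta ^+ 2 * C1 ^+ n] at most [eps]: the first bounds the
   squared L^2 norm, the second the squared Sobolev norm. *)
pose eta : R := Num.sqrt (eps / (1 + C1 ^+ n)).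
have eta2 : eta ^+ 2 = eps / (1 + C1 ^+ n).
  by rewrite sqr_sqrtr// divr_ge0 ?(ltW eps0)// addr_ge0// exprn_ge0// ltW.
have D0 : 0 < 1 + C1 ^+ n by rewrite ltr_pwDl// exprn_ge0// ltW.
have eta0 : 0 < eta by rewrite sqrtr_gt0 divr_gt0.
pose e := n%:R / 2 - (n%:R + 2) * s.
have e0 : 0 < e by rewrite subr_gt0.
pose K := eta * (q%:R `^ (n%:R + 2)) `^ (- s) * (I / 2) ^+ n.
have K0 : 0 < K.
  by rewrite !mulr_gt0 ?powR_gt0 ?exprn_gt0// ?divr_gt0// powR_gt0.
pose X := Num.max 1 (lam / K).
have X0 : 0 < X by rewrite lt_max ltr01.
pose M := (Num.bound (X `^ e^-1) + Num.bound (2 / eps)).+1.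
have MX : X `^ e^-1 <= M%:R.
  rewrite (le_trans (ltW (archi_boundP (powR_ge0 _ _))))// ler_nat /M.
  by rewrite leqW// leq_addr.
have Meps : 2 / eps <= M%:R.
  have h : 0 <= 2 / eps by rewrite divr_ge0// ltW.
  rewrite (le_trans (ltW (archi_boundP h)))// ler_nat /M.
  by rewrite leqW// leq_addl.
have M0 : (0 < M)%N by [].
have MR : 0 < M%:R :> R by rewrite ltr0n.
have MeX : X <= M%:R `^ e.
  have := ge0_ler_powR (ltW e0) _ _ MX; rewrite !nnegrE ?powR_ge0// => /(_ isT (ltW MR)).
  by rewrite -powRrM mulVf ?gt_eqF// powRr1// ltW.
have [Q [D [QE DQ]]] : exists Q D : nat, Q = (q * M)%N /\ D = (Q ^ n.+1)%N.
  by exists (q * M)%N, ((q * M) ^ n.+1)%N.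
have QR : Q%:R = q%:R * M%:R :> R by rewrite QE natrM.
pose r : R := Q%:R ^+ n.+2.
have r1 : 1 <= r by rewrite expr_ge1// ?ler0n// ler1n QE muln_gt0 q0.
have r0 : 0 < r by exact: lt_le_trans r1.
(* Normalises the block: the powers of [M] and [r] cancel those in [blk_g_sob]. *)
pose c := eta * M%:R `^ (- (n%:R / 2)) * r `^ (- s).
have c0 : 0 <= c by rewrite !mulr_ge0 ?powR_ge0// ltW.
have M2 : (M%:R `^ (- (n%:R / 2))) ^+ 2 * M%:R ^+ n = 1 :> R.
  rewrite -!powR_mulrn ?powR_ge0 ?(ltW MR)// -powRrM -powRD; last first.
    by rewrite (gt_eqF MR) implybT.
  by rewrite (_ : - (n%:R / 2) * 2%:R + n%:R = 0) ?powRr0//; field.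
have rs : r `^ (- s) * r `^ s = 1 by rewrite powRN mulVf// gt_eqF// powR_gt0.
exists (@blk_f R n phi M Q D c), (@blk_g R n psi M Q D c), (@blk_times R n Q D).
split.
- exact: (cmeas_blk_f n bp).
- by move=> x; exact: (blk_f_supp n0 bp).
- exact: (blk_f_sq bp psiN psi_nat q_pi M0 QE DQ c).1.
- apply: (le_trans (blk_f_sq bp psiN psi_nat q_pi M0 QE DQ c).2).
  have -> : c ^+ 2 * M%:R ^+ n = eta ^+ 2 * (r `^ (- s)) ^+ 2.
    rewrite /c; transitivity (eta ^+ 2 * (r `^ (- s)) ^+ 2 *
      ((M%:R `^ (- (n%:R / 2))) ^+ 2 * M%:R ^+ n)); first ring.
    by rewrite M2 mulr1.
  rewrite eta2; apply: (@le_trans _ _ (eps / (1 + C1 ^+ n))).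
    rewrite ler_piMr ?divr_ge0 ?(ltW eps0) ?(ltW D0)// expr_le1 ?powR_ge0//.
    by rewrite powRN invf_le1 ?powR_gt0// -(powRr0 r) ler_powR// ltW.
  by rewrite ler_pdivrMr// ler_peMr ?(ltW eps0)// lerDl exprn_ge0// ltW.
- exact: (blk_f_fourier bp psiN).
- exact: cL1_blk_g.
- by apply: (blk_g_sob mpsi psi4 q_pi M0 QE DQ c _).1; rewrite (ltW s0).
- have s01 : 0 <= s <= 1 by rewrite (ltW s0).
  apply: (le_trans (blk_g_sob mpsi psi4 q_pi M0 QE DQ c s01).2).
  rewrite -/I -/J -/C1 -/r (exprMn n C1 M%:R).
  have -> : (r `^ s) ^+ 2 * c ^+ 2 * (C1 ^+ n * M%:R ^+ n) = eta ^+ 2 * C1 ^+ n.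
    transitivity ((r `^ (- s) * r `^ s) ^+ 2 *
      ((M%:R `^ (- (n%:R / 2))) ^+ 2 * M%:R ^+ n) * (eta ^+ 2 * C1 ^+ n)).
      by rewrite /c; ring.
    by rewrite rs M2 expr1n !mul1r.
  by rewrite eta2 mulrAC ler_pdivrMr// ler_pM2l// lerDr.
- move=> t /mapP[k]; rewrite mem_iota addnn -mul2n => kb ->.
  have /andP[h1 h2] := blk_time_bd q_pi M0 QE DQ kb.
  rewrite h1 (le_trans h2)//.
  have MQ : M%:R <= Q%:R :> R by rewrite ler_nat QE leq_pmull.
  rewrite ler_pdivrMr ?(lt_le_trans MR)//.
  rewrite -ler_pdivrMl// mulrC; exact: le_trans MQ.
- move=> x xK; have [t tT ht] := blk_low mpsi psi4 I0 k0 kI q_pi q_k M0 QE DQ c0 xK.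
  exists t => //; apply: le_trans ht.
  have -> : c * (M%:R * (I / 2)) ^+ n = K * M%:R `^ e.
    have M1 : 0 <= M%:R :> R by exact: ler0n.
    have rE : r `^ (- s) = (q%:R `^ (n%:R + 2)) `^ (- s) * M%:R `^ ((n%:R + 2) * - s).
      rewrite powRrM -powRM ?powR_ge0// -powRM ?ler0n// -QR /r.
      by rewrite -powR_mulrn ?ler0n// -addn2 natrD.
    have eE : M%:R `^ e = M%:R `^ (- (n%:R / 2)) * M%:R ^+ n * M%:R `^ ((n%:R + 2) * - s) :> R.
      rewrite -powR_mulrn// -!powRD; try by rewrite (gt_eqF MR) implybT.
      by congr (_ `^ _); rewrite /e; field.
    by rewrite /c /K exprMn rE eE; ring.
  have : lam / K <= M%:R `^ e by rewrite (le_trans _ MeX)// le_max lexx orbT.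
  by rewrite ler_pdivrMr// mulrC.
Qed.

End block_exists.

(** * Stability of the evolution in weighted L^2 *)

Section ball.
Context (R : realType) (n : nat).
Local Notation E := (euclid R n).

Lemma eball_le N M (x : E) : (N <= M)%N -> eball N x -> eball M x.
Proof.
rewrite /eball /= => NM h; apply: (le_trans h).
by rewrite lerXn2r ?nnegrE ?ler0n// ler_nat.
Qed.

Lemma eball_absorb (x : E) : exists N0, forall N, (N0 <= N)%N -> eball N x.
Proof.
exists (Num.bound (dot x x)).+1 => N N0; apply: (eball_le N0); rewrite /eball /=.
have d0 := dot_ge0 x.
apply: (le_trans (ltW (archi_boundP d0))).
rewrite -natrX ler_nat (leq_trans (leqnSn _))// -{1}[_.+1]expn1 leq_pexp2l//.
Qed.

Lemma measurable_eball N : measurable (eball N : set E).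
Proof.
rewrite -[eball N]setTI.
rewrite (_ : eball N = (fun x : E => dot x x) @^-1` `]-oo, N%:R ^+ 2]).
  have md : measurable_fun setT (fun x : E => dot x x) by exact: measurable_dot.
  by apply: md => //; exact: measurable_itv.
by apply/seteqP; split => x /=; rewrite /eball /= in_itv.
Qed.

Lemma L1_eball N : L1 (leb R n) (\1_(eball N : set E)).
Proof.
pose I (y : R) : R := \1_(`[- N%:R, N%:R]%classic : set R) y.
have [IT _] := @Rint_tens R n (fun _ => I) (fun _ => L1_indic N%:R).
apply: (L1_le _ IT); first exact: measurable_indic (measurable_eball N).
move=> x; rewrite indicE.
have t0 : 0 <= tens (fun _ : 'I_n => I) x by apply: prodr_ge0 => i _.
have [xN|xN] := pselect (eball N x); last by rewrite memNset// normr0.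
rewrite mem_set//= normr1 ger0_norm// /tens big1// => i _.
rewrite /I indicE_itv (_ : _ <= _)//.
rewrite -(ler_pXn2r (n := 2))// ?nnegrE ?ler0n// real_normK ?num_real//.
apply: le_trans xN; rewrite /dot (bigD1 i)//= expr2 lerDl.
by apply: sumr_ge0 => j _; rewrite -expr2 sqr_ge0.
Qed.

End ball.

Section evolution.
Context (R : realType) (n : nat).
Local Notation E := (euclid R n).
Local Notation normc := (@Normc.normc R).
Local Notation C := R[i].

Lemma normcB_sq (a b c : C) :
  normc (a - b) ^+ 2 <= 2 * normc (a - c) ^+ 2 + 2 * normc (c - b) ^+ 2.
Proof.
have : normc (a - b) <= normc (a - c) + normc (c - b).
  by apply: le_trans (le_normcD _ _); rewrite addrA subrK.
have := normc_ge0 (a - b).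
move: (normc _) (normc (a - c)) (normc (c - b)) => x y z x0 xyz.
have : x ^+ 2 <= (y + z) ^+ 2 by rewrite lerXn2r// ?nnegrE// (le_trans x0).
have := sqr_ge0 (y - z); lra.
Qed.

Lemma normcBC (a b : C) : normc (a - b) = normc (b - a).
Proof. by rewrite -normcN opprB. Qed.

Lemma cmeasB d (T : measurableType d) (f g : T -> C) :
  cmeas f -> cmeas g -> cmeas (fun x => f x - g x).
Proof.
move=> [f1 f2] [g1 g2]; split.
  rewrite (_ : _ \o _ = fun x => complex.Re (f x) - complex.Re (g x)).
    exact: measurable_funB.
  by apply/funext => x; rewrite [LHS]cReD cReN.
rewrite (_ : _ \o _ = fun x => complex.Im (f x) - complex.Im (g x)).
  exact: measurable_funB.
by apply/funext => x; rewrite [LHS]cImD cImN.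
Qed.

Lemma cL1B d (T : measurableType d) (mu : {measure set T -> \bar R}) (f g : T -> C) :
  cL1 mu f -> cL1 mu g -> cL1 mu (fun x => f x - g x).
Proof.
move=> [f1 f2] [g1 g2]; split.
  rewrite (_ : _ \o _ = fun x => complex.Re (f x) - complex.Re (g x)).
    exact: L1B.
  by apply/funext => x; rewrite [LHS]cReD cReN.
rewrite (_ : _ \o _ = fun x => complex.Im (f x) - complex.Im (g x)).
  exact: L1B.
by apply/funext => x; rewrite [LHS]cImD cImN.
Qed.

Lemma cintB d (T : measurableType d) (mu : {measure set T -> \bar R}) (f g : T -> C) :
  cL1 mu f -> cL1 mu g -> cint mu (fun x => f x - g x) = cint mu f - cint mu g.
Proof.
move=> [f1 f2] [g1 g2]; apply: complexP; rewrite ?cReD ?cImD ?cReN ?cImN /=.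
  by rewrite -RintegralB//; apply: eq_Rintegral => x _; rewrite cReD cReN.
by rewrite -RintegralB//; apply: eq_Rintegral => x _; rewrite cImD cImN.
Qed.

Lemma L1_sqB d (T : measurableType d) (mu : {measure set T -> \bar R}) (f g : T -> C) :
  cmeas f -> cmeas g -> L1 mu (fun x => normc (f x) ^+ 2) ->
  L1 mu (fun x => normc (g x) ^+ 2) -> L1 mu (fun x => normc (f x - g x) ^+ 2).
Proof.
move=> mf mg If Ig; apply: (L1_le _ (L1D (L1Z 2 If) (L1Z 2 Ig))).
  by apply: measurable_funX; apply: measurable_normc; exact: cmeasB.
move=> x; have := normcB_sq (f x) (g x) 0; rewrite subr0 sub0r normcN => h.
by rewrite ger0_norm ?exprn_ge0 ?normc_ge0// (le_trans h)// ler_norm.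
Qed.

Lemma cintegralE (D : set E) (f : E -> C) :
  cintegral D f = cint (leb R n) (fun x => real_complex R (\1_D x) * f x).
Proof.
apply: complexP => /=; rewrite [LHS]Rintegral_mkcond; apply: eq_Rintegral => x _;
  rewrite patchE indicE; case: (f x) => a b; case: ifP => _ /=;
  by rewrite ?mul1r ?mul0r ?subr0 ?addr0.
Qed.

Variables (w : E -> R) (K : R).
Hypothesis mw : measurable_fun setT w.
Hypothesis w01 : forall x, 0 <= w x <= 1.
Hypothesis K_gt0 : 0 < K.
Hypothesis bessel_w : forall h : E -> C, cL1 (leb R n) h ->
  L1 (leb R n) (fun x => normc (h x) ^+ 2) ->
  let H x := cint (leb R n) (fun xi => h xi * cexpi (2 * pi * dot x xi)) in
    cmeas H /\
    L1 (leb R n) (fun x => w x * normc (H x) ^+ 2) /\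
    \int[leb R n]_x (w x * normc (H x) ^+ 2) <=
      K * \int[leb R n]_x (normc (h x) ^+ 2).

(** [g] is only in L^2, so [Ut] is known through truncations; [P] is integrable, so [V] is defined
    pointwise. Each truncated evolution minus [V] is the transform of an integrable function, to
    which [bessel_w] applies, and the truncation is then removed. Passing through the truncation
    costs the factor 2. *)
Lemma evol_approx (g P : E -> C) (Ut : E -> C) (t : R) :
  cmeas g -> L1 (leb R n) (fun x => normc (g x) ^+ 2) ->
  cL1 (leb R n) P -> L1 (leb R n) (fun x => normc (P x) ^+ 2) ->
  cmeas Ut -> cvg_L2 (fun N x => schrodinger_on (eball N) g x t) Ut ->
  let V x := schrodinger_on setT P x t in
  cmeas V /\
  L1 (leb R n) (fun x => w x * normc (Ut x - V x) ^+ 2) /\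
  \int[leb R n]_x (w x * normc (Ut x - V x) ^+ 2) <=
    2 * K * \int[leb R n]_x (normc (g x - P x) ^+ 2).
Proof.
move=> mg Ig2 IP IP2 mU cU V.
have mP := cL1_cmeas IP.
pose ph (xi : E) : R := - (4 * pi ^+ 2 * t * dot xi xi).
have mph : measurable_fun setT ph.
  rewrite /ph (_ : (fun xi => _) = (fun xi => (- (4 * pi ^+ 2 * t)) * dot xi xi)); last first.
    by apply/funext => xi; rewrite mulNr.
  by apply: measurable_funM => //; exact: measurable_dot.
have mdot x : measurable_fun setT (fun xi : E => 2 * pi * dot x xi).
  by apply: measurable_funM => //; exact: measurable_dot.
have E0 f x xi : f xi * cexpi (2 * pi * dot x xi - 4 * pi ^+ 2 * t * dot xi xi) =
    f xi * cexpi (ph xi) * cexpi (2 * pi * dot x xi) :> C.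
  by rewrite -[RHS]mulrA -cexpiD addrC.
have nph f xi : normc (f * cexpi (ph xi)) = normc f :> R.
  by rewrite Normc.normcM normc_cexpi mulr1.
pose gN N xi : C := real_complex R (\1_(eball N) xi) * g xi.
have mgN N : cmeas (gN N).
  apply: cmeasM => //; split; last exact: measurable_cst.
  exact: measurable_indic (measurable_eball N).
have gNin N xi : eball N xi -> gN N xi = g xi.
  by move=> h; rewrite /gN indicE mem_set//= rmorph1 mul1r.
have gNout N xi : ~ eball N xi -> gN N xi = 0.
  by move=> h; rewrite /gN indicE memNset//= rmorph0 mul0r.
have IgN2 N : L1 (leb R n) (fun x => normc (gN N x) ^+ 2).
  apply: (L1_le _ Ig2).
    by apply: measurable_funX; exact: measurable_normc.
  move=> x; rewrite !ger0_norm ?exprn_ge0 ?normc_ge0//.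
  have [h|h] := pselect (eball N x); first by rewrite gNin.
  by rewrite gNout// Normc.normc0 expr0n exprn_ge0// normc_ge0.
have IgN N : cL1 (leb R n) (gN N).
  by apply: (cL1_L2 (mgN N) (L1_eball R n N)) => // x; exact: gNout.
pose h N xi := (gN N xi - P xi) * cexpi (ph xi).
have Ih N : cL1 (leb R n) (h N) by apply: cL1_cexpi => //; exact: cL1B.
have Ih2 N : L1 (leb R n) (fun x => normc (h N x) ^+ 2).
  rewrite (_ : (fun x => _) = (fun x => normc (gN N x - P x) ^+ 2)).
    exact: L1_sqB.
  by apply/funext => x; rewrite nph.
pose SN N x := schrodinger_on (eball N) g x t.
have SNV N x : SN N x - V x = cint (leb R n) (fun xi => h N xi * cexpi (2 * pi * dot x xi)).
  have -> : SN N x = cint (leb R n) (fun xi => gN N xi * cexpi (ph xi) * cexpi (2 * pi * dot x xi)).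
    rewrite /SN /schrodinger_on cintegralE; congr cint; apply/funext => xi.
    by rewrite E0 /gN !mulrA.
  have -> : V x = cint (leb R n) (fun xi => P xi * cexpi (ph xi) * cexpi (2 * pi * dot x xi)).
    by rewrite /V /schrodinger_on -[LHS]/(cint (leb R n) _); congr cint; apply/funext => xi; rewrite E0.
  rewrite -cintB; last 2 first.
  - by apply: cL1_cexpi => //; apply: cL1_cexpi.
  - by apply: cL1_cexpi => //; apply: cL1_cexpi.
  by congr cint; apply/funext => xi; rewrite /h !mulrBl.
have mSV N : cmeas (fun x => SN N x - V x).
  by have [m _] := bessel_w (Ih N) (Ih2 N); under eq_fun do rewrite SNV.
have mV : cmeas V.
  have IPp : L1 (leb R n) (fun x => normc (P x * cexpi (ph x)) ^+ 2).
    by under eq_fun do rewrite nph.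
  have [m _] := bessel_w (cL1_cexpi mph IP) IPp.
  rewrite (_ : V = (fun x => cint (leb R n) (fun xi => P xi * cexpi (ph xi) * cexpi (2 * pi * dot x xi))))//.
  by apply/funext => x; rewrite /V /schrodinger_on -[LHS]/(cint (leb R n) _); congr cint; apply/funext => xi; rewrite E0.
(* Measurability in [x] of these integrals is part of the conclusion of [bessel_w], here for
   [SN N - V] and for [V]. *)
have mSN N : cmeas (SN N).
  have -> : SN N = (fun x => (SN N x - V x) - (0 - V x)).
    by apply/funext => x; rewrite sub0r opprK subrK.
  by apply: cmeasB => //; apply: cmeasB => //; split; exact: measurable_cst.
(* Outside the ball the truncated [g] is 0, so the error there is the mass of [P], which tends to 0
   by dominated convergence. *)
pose out N xi : R := if `[< eball N xi >] then 0 else normc (P xi) ^+ 2.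
have outE N : out N = (fun xi => normc (P xi) ^+ 2 * (1 - \1_(eball N) xi)).
  apply/funext => xi; rewrite /out indicE.
  have [b|b] := pselect (eball N xi).
    by rewrite asboolT// mem_set// subrr mulr0.
  by rewrite asboolF// memNset// subr0 mulr1.
have mout N : measurable_fun setT (out N).
  rewrite outE; apply: measurable_funM; first exact: L1_measurable IP2.
  by apply: measurable_funB => //; exact: measurable_indic (measurable_eball N).
have out0 N xi : 0 <= out N xi by rewrite /out; case: ifP => // _; rewrite exprn_ge0// normc_ge0.
have outle N xi : `|out N xi| <= normc (P xi) ^+ 2.
  by rewrite ger0_norm// /out; case: ifP => // _; rewrite exprn_ge0// normc_ge0.
have Iout N : L1 (leb R n) (out N).
  apply: (L1_le (mout N) IP2) => x; rewrite (le_trans (outle N x))// ler_norm//.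
have out_cvg xi : out N xi @[N --> \oo] --> (cst 0 xi : R).
  have [N0 HN0] := eball_absorb xi.
  apply/cvgrPdist_le => e e0; exists N0 => // N /= N0N.
  by rewrite /out asboolT; [rewrite subrr normr0 ltW|exact: HN0].
have [_ cout] := @Rint_dominated _ E R (leb R n) out (cst 0) (fun x => normc (P x) ^+ 2)
  (measurable_cst _) mout IP2 out_cvg outle.
rewrite Rintegral_cst// mul0r in cout.
pose A := \int[leb R n]_x (normc (g x - P x) ^+ 2).
have IA : L1 (leb R n) (fun x => normc (g x - P x) ^+ 2) by exact: L1_sqB.
have hle N : \int[leb R n]_x (normc (h N x) ^+ 2) <= A + \int[leb R n]_x out N x.
  rewrite -RintegralD//; apply: le_Rintegral => //; first exact: L1D.
  move=> x _; rewrite nph /out.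
  have [b|b] := pselect (eball N x).
    by rewrite asboolT// gNin// addr0.
  by rewrite asboolF// gNout// sub0r normcN lerDr exprn_ge0// normc_ge0.
pose F x := w x * normc (Ut x - V x) ^+ 2.
have F0 x : 0 <= F x by rewrite mulr_ge0 ?exprn_ge0 ?normc_ge0//; have /andP[] := w01 x.
have mF : measurable_fun setT F.
  apply: measurable_funM => //; apply: measurable_funX; apply: measurable_normc.
  exact: cmeasB.
pose dN N : \bar R := sqL2norm (fun x => SN N x - Ut x).
have key N : (\int[leb R n]_x (F x)%:E <=
   (2 * K * (A + \int[leb R n]_x out N x))%:E + 2%:E * dN N)%E.
  have [_ [b1 b2]] := bessel_w (Ih N) (Ih2 N).
  rewrite /dN /sqL2norm.
  apply: (@le_trans _ _ (\int[leb R n]_x ((2 * (w x * normc (SN N x - V x)%R ^+ 2))%:E +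
      2%:E * (normc (SN N x - Ut x)%R ^+ 2)%:E))%E).
    apply: ge0_le_integral => //.
    - by move=> x _; rewrite lee_fin.
    - exact/measurable_EFinP.
    - apply: emeasurable_funD.
        apply/measurable_EFinP; apply: measurable_funM => //; apply: measurable_funM => //.
        by apply: measurable_funX; exact: measurable_normc.
      apply: emeasurable_funM => //; apply/measurable_EFinP.
      by apply: measurable_funX; apply: measurable_normc; exact: cmeasB.
    - move=> x _; rewrite -EFinM -EFinD lee_fin /F.
      have := normcB_sq (Ut x) (V x) (SN N x); rewrite (normcBC (Ut x) (SN N x)).
      have /andP[w0 w1] := w01 x.
      have := sqr_ge0 (normc (SN N x - Ut x)); have := sqr_ge0 (normc (Ut x - V x)).
      move: (normc _ ^+ 2) (normc _ ^+ 2) (normc _ ^+ 2) => a b c; nra.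
  rewrite ge0_integralD//; last 4 first.
  - move=> x _; rewrite lee_fin mulr_ge0// mulr_ge0 ?exprn_ge0 ?normc_ge0//.
    by have /andP[] := w01 x.
  - apply/measurable_EFinP; apply: measurable_funM => //; apply: measurable_funM => //.
    by apply: measurable_funX; exact: measurable_normc.
  - by move=> x _; rewrite mule_ge0// lee_fin ?exprn_ge0 ?normc_ge0.
  - apply: emeasurable_funM => //; apply/measurable_EFinP.
    by apply: measurable_funX; apply: measurable_normc; exact: cmeasB.
  rewrite ge0_integralZl//; last 2 first.
  - by apply/measurable_EFinP; apply: measurable_funX; apply: measurable_normc; exact: cmeasB.
  - by move=> x _; rewrite lee_fin exprn_ge0// normc_ge0.
  apply: leeD => //.
  under eq_integral do rewrite SNV.
  rewrite -EFin_Rint; last exact: L1Z.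
  rewrite lee_fin RintegralZl// -mulrA ler_pM2l// (le_trans b2)// ler_pM2l//.
have lim : ((2 * K * (A + \int[leb R n]_x out N x))%:E +
    2%:E * dN N)%E @[N --> \oo] --> ((2 * K * A)%:E + 2%:E * 0)%E.
  apply: cvgeD => //.
  - apply: cvg_EFin; first exact: nearW.
    have cA : A + \int[leb R n]_x out N x @[N --> \oo] --> A + 0.
      by apply: cvgD => //; exact: cvg_cst.
    rewrite addr0 in cA.
    have cKA : 2 * K * (A + \int[leb R n]_x out N x) @[N --> \oo] --> 2 * K * A.
      by apply: cvgMl_tmp; exact: cA.
    exact: cKA.
  - by apply: cvgeZl.
have HF : (\int[leb R n]_x (F x)%:E <= (2 * K * A)%:E)%E.
  rewrite mule0 adde0 in lim.
  rewrite -(cvg_lim _ lim)//; apply: lime_ge; first exact: cvgP lim.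
  by apply: nearW => N; exact: key.
have IF : L1 (leb R n) F.
  apply: L1P => //; under eq_integral do rewrite ger0_norm//.
  by rewrite (le_lt_trans HF)// ltry.
split=> //; split=> //.
by rewrite -lee_fin EFin_Rint.
Qed.

End evolution.

(** * Choice of the blocks and exceptional sets *)

Section assembly.
Context (R : realType) (n : nat).
Local Notation E := (euclid R n).
Local Notation normc := (@Normc.normc R).
Local Notation C := R[i].

(** The sum in the lower bound dominates the evolutions of all earlier blocks at every point. The
    last bound on [eps i] prepares the union over the times of any earlier block [j]. *)
Lemma block_sequence (s kappa e0 : R) : 0 < e0 ->
  (forall eps lam : R, 0 < eps -> exists f g T, @block R n s kappa eps lam f g T) ->
  exists (f g : nat -> E -> C) (T : nat -> seq R) (eps : nat -> R),
    [/\ forall i, block s kappa (eps i)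
          (i.+1%:R + \sum_(l < i) \int[leb R n]_x normc (g l x)) (f i) (g i) (T i),
      forall i, 0 < eps i <= e0 / 4 ^+ i &
      forall j i, (j < i)%N -> eps i <= e0 / 4 ^+ i / (1 + (size (T j))%:R)].
Proof.
move=> e00 ex.
(* [choice] needs a witness for every pair, hence a dummy value when the first component is not
   positive. *)
have /choice[pick pickP] (p : R * R) : exists b : (E -> C) * (E -> C) * seq R,
    0 < p.1 -> block s kappa p.1 p.2 b.1.1 b.1.2 b.2.
  have [p0|p0] := ltP 0 p.1; last by exists (fun=> 0, fun=> 0, [::]).
  by have [f [g [T b]]] := ex p.1 p.2 p0; exists (f, g, T).
pose ep i c : R := e0 / 4 ^+ i / (1 + c%:R).
pose lm i S : R := i.+1%:R + S.
(* The state records the number of times used so far and the sum of the L^1 norms of the transforms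
   so far; the total count exceeds the size of each single earlier [T j]. *)
pose step i (st : nat * R) := let b := pick (ep i st.1, lm i st.2) in
  ((st.1 + size b.2)%N, st.2 + \int[leb R n]_x normc (b.1.2 x)).
pose st := fix st i := if i is i'.+1 then step i' (st i') else (0%N, 0 : R).
pose b i := pick (ep i (st i).1, lm i (st i).2).
have ep0 i c : 0 < ep i c by rewrite !divr_gt0 ?exprn_gt0// ltr_pwDl.
have st2 i : (st i).2 = \sum_(l < i) \int[leb R n]_x normc ((b l).1.2 x).
  elim: i => [|i IH]; first by rewrite big_ord0.
  by rewrite big_ord_recr /= -IH.
have st1 j i : (j < i)%N -> (size (b j).2 <= (st i).1)%N.
  elim: i => // i IH; rewrite ltnS leq_eqVlt => /predU1P[->|ji].
    by rewrite /= leq_addl.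
  by rewrite (leq_trans (IH ji))//= leq_addr.
exists (fun i => (b i).1.1), (fun i => (b i).1.2), (fun i => (b i).2),
  (fun i => ep i (st i).1); split.
- by move=> i; rewrite -st2; exact: (pickP (ep i (st i).1, lm i (st i).2) (ep0 _ _)).
- move=> i; rewrite ep0/= ler_pdivrMr ?ltr_pwDl// ler_peMr ?lerDl//.
  by rewrite divr_ge0 ?exprn_ge0// ltW.
- move=> j i ji; rewrite ler_wpM2l ?divr_ge0 ?exprn_ge0 ?(ltW e00)//.
  by rewrite lef_pV2 ?posrE ?ltr_pwDl// lerD2l ler_nat st1.
Qed.

Lemma geo_half m : \sum_(i < m) (1 / 2) ^+ i <= 2 :> R.
Proof.
suff -> : \sum_(i < m) (1 / 2) ^+ i = 2 - 2 * (1 / 2) ^+ m :> R.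
  by rewrite lerBlDr lerDl mulr_ge0// exprn_ge0// divr_ge0.
elim: m => [|m IH]; first by rewrite big_ord0 expr0; ring.
by rewrite big_ord_recr /= IH exprS; field.
Qed.

Lemma sob_ge1 (s : R) (xi : E) : 0 <= s -> 1 <= sob s xi.
Proof.
move=> s0; rewrite /sob -[leLHS](powRr0 (1 + dot xi xi)).
by rewrite ler_powR// lerDl dot_ge0.
Qed.

Lemma cmeas_cvg d (T : measurableType d) (F : nat -> T -> C) (f : T -> C) :
  (forall m, cmeas (F m)) -> (forall x, ccvg (F ^~ x) (f x)) -> cmeas f.
Proof.
move=> mF Ff; split.
  apply: (@measurable_fun_cvg _ _ _ setT (fun m x => complex.Re (F m x))).
    by move=> m; exact: (mF m).1.
  by move=> x _; exact: (Ff x).1.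
apply: (@measurable_fun_cvg _ _ _ setT (fun m x => complex.Im (F m x))).
  by move=> m; exact: (mF m).2.
by move=> x _; exact: (Ff x).2.
Qed.

Lemma ccvg_shift (z : nat -> C) l k : ccvg z l -> ccvg (fun m => z (m + k)%N) l.
Proof.
move=> [z1 z2]; split.
  by have := z1; rewrite -(cvg_shiftn k).
by have := z2; rewrite -(cvg_shiftn k).
Qed.

Lemma chebyshev_cube (A : set E) (F : E -> R) : measurable A ->
  L1 (leb R n) F -> (forall x, 0 <= F x) -> (forall x, A x -> 1 <= F x) ->
  (leb R n A <= (\int[leb R n]_x F x)%:E)%E.
Proof.
move=> mA IF F0 F1.
rewrite -[leLHS](_ : \int[leb R n]_x (\1_A x)%:E = _)%E; last by rewrite integral_indic// setIT.
rewrite EFin_Rint//; apply: ge0_le_integral => //.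
- by apply/measurable_EFinP; exact: measurable_indic.
- by apply/measurable_EFinP; exact: (L1_measurable IF).
- move=> x _; rewrite lee_fin indicE.
  have [Ax|Ax] := pselect (A x); first by rewrite mem_set// F1.
  by rewrite memNset.
Qed.

Lemma measure_seq_union (I : Type) (T : seq I) (A : I -> set E) (c : R) :
  0 <= c -> (forall t, measurable (A t)) -> (forall t, leb R n (A t) <= c%:E)%E ->
  exists B : set E, [/\ measurable B, (leb R n B <= ((size T)%:R * c)%:E)%E &
    forall i, (i < size T)%N -> forall t0, A (nth t0 T i) `<=` B].
Proof.
move=> c0 mA Ac; elim: T => [|t T [B [mB Bc AB]]].
  by exists set0; split => //; rewrite measure0 mul0r.
exists (A t `|` B); split; first exact: measurableU.
  apply: le_trans; first exact: measureU2.
  rewrite /= -nat1r mulrDl mul1r EFinD; exact: leeD.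
case=> [|i] /= iT t0 x Ax; [left|right] => //.
exact: (AB i iT t0).
Qed.

Lemma leb_cube (kappa : R) : 0 < kappa -> measurable (cube kappa : set E) /\
  leb R n (cube kappa) = ((2 * kappa) ^+ n)%:E.
Proof.
move=> k0.
pose A (i : 'I_n) : set (measurableTypeR R) := `[- kappa, kappa]%classic.
have mA i : measurable (A i) by exact: measurable_itv.
have EA : cube kappa = [set t : E | forall i, A i (tnth t i)].
  by apply/seteqP; split => t /= h i; have := h i; rewrite /A /= in_itv /= ler_norml.
split.
  rewrite EA (_ : [set t : E | _] = \bigcap_(i in [set: 'I_n]) ((fun t => tnth t i) @^-1` A i)).
    apply: fin_bigcap_measurable => // i _.
    by rewrite -[X in measurable X]setTI; exact: measurable_tnth.
  by apply/seteqP; split => t /= h i; [move=> _|]; apply: h.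
rewrite EA leb_box//.
have -> : (\prod_(i < n) lebesgue_measure (A i) = \prod_(i < n) (2 * kappa)%:E)%E.
  apply: eq_bigr => i _; rewrite lebesgue_measure_itv/= lte_fin.
  have -> : - kappa < kappa by lra.
  by rewrite -EFinD; congr EFin; ring.
by rewrite prodEFin prodr_const card_ord.
Qed.

End assembly.

(** * Superposition of the blocks *)

Section superposition.
Context (R : realType) (n : nat).
Local Notation E := (euclid R n).
Local Notation normc := (@Normc.normc R).
Local Notation C := R[i].
Variables (s kappa e0 : R).
Hypothesis s_ge0 : 0 <= s.
Hypothesis e0_gt0 : 0 < e0.
Variables (f g : nat -> E -> C) (T : nat -> seq R) (eps : nat -> R).
Hypothesis blk : forall i, block s kappa (eps i)
  (i.+1%:R + \sum_(l < i) \int[leb R n]_x normc (g l x)) (f i) (g i) (T i).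
Hypothesis eps4 : forall i, 0 < eps i <= e0 / 4 ^+ i.
Hypothesis epsT : forall j i, (j < i)%N -> eps i <= e0 / 4 ^+ i / (1 + (size (T j))%:R).

Let partial m (xi : E) : C := \sum_(i < m) g i xi.

Let sum_eps m : \sum_(i < m) 2 ^+ i * eps i <= 2 * e0.
Proof.
apply: (@le_trans _ _ (\sum_(i < m) e0 * (1 / 2) ^+ i)).
  apply: ler_sum => i _; have /andP[_ h] := eps4 i.
  apply: (le_trans (ler_wpM2l (exprn_ge0 i (ler0n R 2)) h)).
  rewrite mulrCA ler_pM2l//.
  have -> : 4 = 2 * 2 :> R by ring.
  by rewrite exprMn invfM mulrA mulfV ?expf_neq0// !mul1r exprVn.
by rewrite -mulr_sumr mulrC ler_wpM2r ?geo_half// ltW.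
Qed.

Let g_meas i : cmeas (g i). Proof. exact: cL1_cmeas (block_gL1 (blk i)). Qed.

Let g_sq i : L1 (leb R n) (fun xi => normc (g i xi) ^+ 2) /\
  \int[leb R n]_xi (normc (g i xi) ^+ 2) <= eps i.
Proof.
have le1 xi : normc (g i xi) ^+ 2 <= sob s xi * normc (g i xi) ^+ 2.
  by rewrite ler_peMl ?exprn_ge0 ?normc_ge0// sob_ge1.
have Ig : L1 (leb R n) (fun xi => normc (g i xi) ^+ 2).
  apply: (L1_le _ (block_sob (blk i))).
    by apply: measurable_funX; exact: measurable_normc.
  move=> xi; rewrite ger0_norm ?exprn_ge0 ?normc_ge0//.
  by rewrite (le_trans (le1 xi))// ler_norm.
split=> //; apply: le_trans (block_sob_le (blk i)).
by apply: le_Rintegral => //; exact: block_sob (blk i).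
Qed.

Let partial_meas m : cmeas (partial m).
Proof. exact: cmeas_sum. Qed.

(** Used with the weight [sob s] for the Sobolev norm of the sum and with the weight 1 for its
    tails. *)
Let L1_sumsq k m (v : E -> R) : measurable_fun setT v -> (forall x, 0 <= v x) ->
  (forall i, L1 (leb R n) (fun xi => v xi * normc (g i xi) ^+ 2)) ->
  L1 (leb R n) (fun xi => v xi * normc (\sum_(i < m) g (k + i)%N xi) ^+ 2) /\
  \int[leb R n]_xi (v xi * normc (\sum_(i < m) g (k + i)%N xi) ^+ 2) <=
  2 * \sum_(i < m) 2 ^+ i * \int[leb R n]_xi (v xi * normc (g (k + i)%N xi) ^+ 2).
Proof.
move=> mv v0 Iv.
have Ir : L1 (leb R n) (fun xi => 2 * \sum_(i < m) 2 ^+ i * (v xi * normc (g (k + i)%N xi) ^+ 2)).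
  by apply: L1Z; apply: L1_sum => i; apply: L1Z.
have le1 xi : v xi * normc (\sum_(i < m) g (k + i)%N xi) ^+ 2 <=
    2 * \sum_(i < m) 2 ^+ i * (v xi * normc (g (k + i)%N xi) ^+ 2).
  apply: (le_trans (ler_wpM2l (v0 xi) (L2_sum_le (fun i => g (k + i)%N) xi m))).
  rewrite mulrCA ler_pM2l// mulr_sumr; apply: ler_sum => i _.
  by rewrite mulrCA.
have Il : L1 (leb R n) (fun xi => v xi * normc (\sum_(i < m) g (k + i)%N xi) ^+ 2).
  apply: (L1_le _ Ir).
    apply: measurable_funM => //; apply: measurable_funX; apply: measurable_normc.
    exact: cmeas_sum.
  move=> xi; rewrite ger0_norm ?mulr_ge0 ?exprn_ge0 ?normc_ge0//.
  by rewrite (le_trans (le1 xi))// ler_norm.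
split=> //; apply: (le_trans (le_Rintegral measurableT Il Ir (fun x _ => le1 x))).
rewrite RintegralZl//; last by apply: L1_sum => i; apply: L1Z.
rewrite Rint_sum; last by move=> i; apply: L1Z.
by rewrite ler_pM2l//; apply: ler_sum => i _; rewrite RintegralZl.
Qed.

(** For [i] past [j.+1], [epsT] provides [4 ^ - (j.+1 + i)]; the weight [2 ^ i] of [L1_sumsq] uses
    up part of it, and a convergent geometric series remains. *)
Let tail j m : let v := cst 1 : E -> R in
  L1 (leb R n) (fun xi => v xi * normc (\sum_(i < m) g (j.+1 + i)%N xi) ^+ 2) /\
  \int[leb R n]_xi (v xi * normc (\sum_(i < m) g (j.+1 + i)%N xi) ^+ 2) <=
  e0 / 2 ^+ j / (1 + (size (T j))%:R).
Proof.
move=> v.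
have vE i : (fun xi => v xi * normc (g i xi) ^+ 2) = (fun xi => normc (g i xi) ^+ 2).
  by apply/funext => xi; rewrite /v /= mul1r.
have Iv i : L1 (leb R n) (fun xi => v xi * normc (g i xi) ^+ 2).
  by rewrite vE; have [] := g_sq i.
have [h1 h2] := L1_sumsq j.+1 m (measurable_cst (1 : R) : measurable_fun setT v)
  (fun=> ler01) Iv.
split=> //; apply: (le_trans h2).
set c := e0 / 2 ^+ j / (1 + (size (T j))%:R).
have c0 : 0 < c by rewrite !divr_gt0 ?exprn_gt0// ltr_pwDl.
apply: (@le_trans _ _ (2 * \sum_(i < m) c / 4 * (1 / 2) ^+ i)).
  rewrite ler_pM2l//; apply: ler_sum => i _; rewrite vE.
  have ji : (j < j.+1 + i)%N by rewrite ltn_addr.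
  apply: (le_trans (ler_wpM2l (exprn_ge0 i (ler0n R 2)) (le_trans (g_sq _).2 (epsT ji)))).
  have E4 k : 4 ^+ k = 2 ^+ k * 2 ^+ k :> R by rewrite -exprMn; congr (_ ^+ _); ring.
  rewrite exprD expr_div_n expr1n (E4 i) exprS (E4 j) /c.
  set S := 1 + _; have S0 : 0 < S by rewrite ltr_pwDl.
  set a := 2 ^+ j; have a1 : 1 <= a by rewrite exprn_ege1// ler1n.
  have a0 : 0 < a by apply: lt_le_trans a1.
  set b := 2 ^+ i; have b0 : 0 < b by rewrite exprn_gt0.
  rewrite [leLHS](_ : _ = e0 / S / 4 / b / a / a); last first.
    by field; rewrite !gt_eqF.
  rewrite [leRHS](_ : _ = e0 / S / 4 / b / a); last first.
    by field; rewrite !gt_eqF.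
  by rewrite ler_pdivrMr// ler_peMr// !divr_ge0// ltW.
rewrite -mulr_sumr; have := geo_half R m.
set z := \sum_(i < m) _ => zz.
by rewrite (_ : 2 * _ = c * (z / 2)); [rewrite ler_piMr ?(ltW c0)//; lra|field].
Qed.

(** All blocks vanish off one ball, so the transform [G] of the sum is an absolutely convergent
    integral at each point, and the pointwise limit of the partial sums. Fatou then gives its
    Sobolev norm and the tails. The clause on [g'] is there because a solution comes with a
    transform of its own. *)
Lemma superposition : exists u0 G : E -> C,
  [/\ fourier_L2 u0 G,
      (\int[leb R n]_xi (sob s xi * normc (G xi) ^+ 2)%:E < +oo)%E,
      forall g', fourier_L2 u0 g' -> sqL2norm (fun xi => G xi - g' xi) = 0%E &
      forall j, L1 (leb R n) (fun xi => normc (G xi - partial j.+1 xi) ^+ 2) /\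
        \int[leb R n]_xi (normc (G xi - partial j.+1 xi) ^+ 2) <=
        e0 / 2 ^+ j / (1 + (size (T j))%:R)].
Proof.
have fb m : \sum_(i < m) 2 ^+ i * \int[leb R n]_x (normc (f i x) ^+ 2) <= 2 * e0.
  apply: le_trans (sum_eps m); apply: ler_sum => i _.
  by rewrite ler_wpM2l ?exprn_ge0// (block_L2_le (blk i)).
have [u0 [mu0 u0B u02 u0F]] := L2_series (L1_eball R n (2 * n))
  (fun i => block_meas (blk i)) (fun i x => @block_supp _ _ _ _ _ _ _ _ _ (blk i) x)
  (fun i => block_L2 (blk i)) fb.
pose ph (xi x : E) : R := - (2 * pi * dot x xi).
have mph xi : measurable_fun setT (ph xi).
  rewrite /ph (_ : (fun x => _) = (fun x => (- (2 * pi)) * dot x xi)); last first.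
    by apply/funext => x; rewrite mulNr.
  by apply: measurable_funM => //; exact: measurable_dot.
pose G xi := cint (leb R n) (fun x => u0 x * cexpi (ph xi x)).
have cG xi : ccvg (partial ^~ xi) (G xi).
  have := u0F _ (mph xi); congr ccvg; apply/funext => m.
  by apply: eq_bigr => i _; rewrite (block_fourier (blk i) xi).2.
have mG : cmeas G by exact: cmeas_cvg cG.
have msob := @measurable_sob R n s.
have sob0 xi : 0 <= sob s (xi : E) by exact: powR_ge0.
have [IsG _] : L1 (leb R n) (fun xi => sob s xi * normc (G xi) ^+ 2) /\
   \int[leb R n]_xi (sob s xi * normc (G xi) ^+ 2) <= 2 * (2 * e0).
  apply: (@fatou_L1 _ _ _ _ (fun m xi => sob s xi * normc (partial m xi) ^+ 2)).
  - by apply: measurable_funM => //; apply: measurable_funX; exact: measurable_normc.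
  - by move=> xi; apply: cvgMl_tmp; exact: ccvg_sqr.
  - by move=> m xi; rewrite mulr_ge0 ?exprn_ge0 ?normc_ge0.
  - by move=> m; exact: (L1_sumsq 0 m msob sob0 (fun i => block_sob (blk i))).1.
  - move=> m; apply: (le_trans (L1_sumsq 0 m msob sob0 (fun i => block_sob (blk i))).2).
    rewrite ler_pM2l//; apply: le_trans (sum_eps m); apply: ler_sum => i _.
    by rewrite ler_wpM2l ?exprn_ge0// add0n (block_sob_le (blk i)).
have IG2 : L1 (leb R n) (fun xi => normc (G xi) ^+ 2).
  apply: (L1_le _ IsG); first by apply: measurable_funX; exact: measurable_normc.
  move=> xi; rewrite !ger0_norm ?mulr_ge0 ?exprn_ge0 ?normc_ge0//.
  by rewrite ler_peMl ?exprn_ge0 ?normc_ge0// sob_ge1.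
have sqlty (h : E -> C) : L1 (leb R n) (fun x => normc (h x) ^+ 2) -> (sqL2norm h < +oo)%E.
  move=> /L1_lty; rewrite /sqL2norm; under eq_integral do rewrite ger0_norm ?exprn_ge0 ?normc_ge0//.
  by [].
have FTN N : (2 * n <= N)%N -> (fun xi => cintegral (eball N)
    (fun x => u0 x * cexpi (- (2 * pi * dot x xi)))) = G.
  move=> nN; apply/funext => xi; rewrite cintegralE /G; congr cint; apply/funext => x.
  have [xN|xN] := pselect (eball N x); first by rewrite indicE mem_set//= rmorph1 mul1r.
  rewrite indicE memNset//= rmorph0 mul0r u0B ?mul0r// => xn.
  by apply: xN; exact: eball_le xn.
have sqL2_0 (h : E -> C) : sqL2norm (fun xi => h xi - h xi) = 0%E.
  rewrite /sqL2norm; under eq_integral do rewrite subrr Normc.normc0 expr0n.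
  by rewrite integral0.
exists u0, G; split.
- split.
  + by split; [exact: mu0|exact: sqlty].
  + by split; [exact: mG|exact: sqlty].
  + apply: (@cvg_trans _ (nbhs (0 : \bar R)%E)) => //; apply: cvg_near_cst.
    exists (2 * n)%N => // N /= nN.
    have := congr1 (fun F => sqL2norm (fun xi => F xi - G xi)) (FTN N nN).
    by rewrite sqL2_0.
- have := L1_lty IsG; under eq_integral do rewrite ger0_norm ?mulr_ge0 ?exprn_ge0 ?normc_ge0//.
  by [].
- move=> g' [_ _ cg].
  (* As [u0] lives on the ball of radius [2 * n], this sequence is constant from [2 * n] on, while
     it tends to 0 by the definition of [g']. *)
  pose a N := sqL2norm (fun xi => cintegral (eball N)
    (fun x => u0 x * cexpi (- (2 * pi * dot x xi))) - g' xi).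
  have aE N : (2 * n <= N)%N -> a N = sqL2norm (fun xi => G xi - g' xi).
    by move=> nN; exact: (congr1 (fun F => sqL2norm (fun xi => F xi - g' xi)) (FTN N nN)).
  have ca : a N @[N --> \oo] --> sqL2norm (fun xi => G xi - g' xi).
    by apply: cvg_near_cst; exists (2 * n)%N => // N /= nN; exact: aE.
  have ca0 : a N @[N --> \oo] --> (0 : \bar R)%E by exact: cg.
  by rewrite -(cvg_lim (@ereal_hausdorff R) ca) (cvg_lim (@ereal_hausdorff R) ca0).
- have dE j m : (fun xi => normc (partial (m + j.+1) xi - partial j.+1 xi) ^+ 2) =
      (fun xi => cst 1 xi * normc (\sum_(i < m) g (j.+1 + i)%N xi) ^+ 2).
    apply/funext => xi; rewrite /= mul1r /partial addnC big_split_ord /=.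
    by rewrite addrAC subrr add0r.
  move=> j.
  apply: (@fatou_L1 _ _ _ _ (fun m xi => normc (partial (m + j.+1) xi - partial j.+1 xi) ^+ 2)).
  + by apply: measurable_funX; apply: measurable_normc; exact: cmeasB.
  + by move=> xi; apply: (ccvg_sqr (z := fun m => partial (m + j.+1) xi - partial j.+1 xi)); apply: ccvgB; exact: (ccvg_shift j.+1 (cG xi)).
  + by move=> m xi; rewrite exprn_ge0// normc_ge0.
  + by move=> m; rewrite dE; exact: (tail j m).1.
  + by move=> m; rewrite dE; exact: (tail j m).2.
Qed.

End superposition.

(** * Conclusion *)

Section conclusion.
Context (R : realType) (n : nat).
Local Notation E := (euclid R n).
Local Notation normc := (@Normc.normc R).
Local Notation C := R[i].

Lemma sqL2norm_L1 (h : E -> C) : cmeas h -> (sqL2norm h < +oo)%E ->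
  L1 (leb R n) (fun x => normc (h x) ^+ 2).
Proof.
move=> mh h2; apply: L1P.
  by apply: measurable_funX; exact: measurable_normc.
by under eq_integral do rewrite ger0_norm ?exprn_ge0 ?normc_ge0//.
Qed.

Lemma cube_avoid (kappa c : R) (N : set E) (B : nat -> set E) :
  0 < kappa -> 0 <= c -> 2 * c < (2 * kappa) ^+ n -> (leb R n).-negligible N ->
  (forall j, measurable (B j) /\ (leb R n (B j) <= (c / 2 ^+ j)%:E)%E) ->
  exists x, [/\ cube kappa x, ~ N x & forall j, ~ B j x].
Proof.
move=> k0 c0 ck [A [mA A0 NA]] mB; have [mK muK] := @leb_cube R n _ k0.
apply: contrapT => H.
have mU : measurable (\bigcup_j B j) by apply: bigcup_measurable => j _; exact: (mB j).1.
have KU : cube kappa `<=` A `|` \bigcup_j B j.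
  move=> x xK; apply: contrapT => /not_orP[nA nB]; apply: H; exists x; split=> //.
    by move=> /NA.
  by move=> j Bj; apply: nB; exists j.
have : (leb R n (cube kappa) <= (2 * c)%:E)%E.
  apply: (le_trans (le_measure (leb R n) _ _ KU)); rewrite ?inE//; first exact: measurableU.
  apply: (le_trans (measureU2 _ mA mU)).
  rewrite [X in (X + _)%E](_ : _ = 0%E)// add0e.
  apply: (@le_trans _ _ (\sum_(j <oo) leb R n (B j))%E).
    by apply: measure_sigma_subadditive => // j; exact: (mB j).1.
  have c20 : 0 <= 2 * c by rewrite mulr_ge0.
  apply: le_trans (epsilon_trick0 xpredT c20).
  apply: lee_nneseries => // j _; apply: (le_trans (mB j).2).
  (* [epsilon_trick0] sums [2 * c / 2 ^ j.+1], which is [c / 2 ^ j]. *)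
  by rewrite lee_fin natrX exprS invfM mulrACA mulfV ?mul1r.
by rewrite muK lee_fin leNgt ck.
Qed.

(** Moves the tail estimate from [G] to the transform [g'] attached to the given solution, which
    agrees with [G] almost everywhere. *)
Lemma L2_limit_close (G g' P : E -> C) d : cmeas G -> cmeas g' -> cmeas P ->
  (sqL2norm G < +oo)%E -> (sqL2norm g' < +oo)%E ->
  sqL2norm (fun xi => G xi - g' xi) = 0%E ->
  L1 (leb R n) (fun xi => normc (G xi - P xi) ^+ 2) ->
  \int[leb R n]_xi (normc (G xi - P xi) ^+ 2) <= d ->
  L1 (leb R n) (fun xi => normc (P xi) ^+ 2) /\
  \int[leb R n]_xi (normc (g' xi - P xi) ^+ 2) <= 2 * d.
Proof.
move=> mG mg mP G2 g2 Gg IGP GPd.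
have IG := sqL2norm_L1 mG G2; have Ig := sqL2norm_L1 mg g2.
have IGg := L1_sqB mG mg IG Ig.
have IP : L1 (leb R n) (fun xi => normc (P xi) ^+ 2).
  apply: (L1_le _ (L1D (L1Z 2 IG) (L1Z 2 IGP))).
    by apply: measurable_funX; exact: measurable_normc.
  move=> xi; have := normcB_sq 0 (P xi) (G xi).
  rewrite !sub0r !normcN => h.
  by rewrite !ger0_norm ?addr_ge0 ?mulr_ge0 ?exprn_ge0 ?normc_ge0.
split=> //.
have I2 := L1D (L1Z 2 IGg) (L1Z 2 IGP).
apply: (@le_trans _ _ (\int[leb R n]_xi (2 * normc (G xi - g' xi) ^+ 2 + 2 * normc (G xi - P xi) ^+ 2))).
  apply: le_Rintegral => //; first exact: L1_sqB.
  by move=> xi _; rewrite (normcBC (G xi) (g' xi)) normcB_sq.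
rewrite RintegralD//; [|exact: L1Z|exact: L1Z].
rewrite !RintegralZl// [X in 2 * X + _](_ : _ = 0) ?mulr0 ?add0r ?ler_pM2l//.
by rewrite /Rintegral -[RHS]/(fine 0%E) -Gg.
Qed.

(** Chebyshev for the weighted norm: on this set [K * w x * |h x|^2] is at least 1. *)
Lemma bad_set_bound (w : E -> R) (K kappa d : R) (h : E -> C) : 0 < K -> 0 < kappa ->
  (forall x, 0 <= w x) -> (forall x, cube kappa x -> 1 <= K * w x) -> cmeas h ->
  L1 (leb R n) (fun x => w x * normc (h x) ^+ 2) ->
  \int[leb R n]_x (w x * normc (h x) ^+ 2) <= d ->
  measurable (cube kappa `&` [set x | 1 < normc (h x)]) /\
  (leb R n (cube kappa `&` [set x | (1 < normc (h x))%R]) <= (K * d)%:E)%E.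
Proof.
move=> K0 k0 w0 Kw mh Ih hd.
have [mK _] := @leb_cube R n _ k0.
have mA : measurable (cube kappa `&` [set x | 1 < normc (h x)]).
  apply: measurableI => //.
  rewrite (_ : [set x | _] = setT `&` (normc \o h) @^-1` `]1, +oo[%classic).
    by apply: measurable_normc.
  by rewrite setTI; apply/seteqP; split => x /=; rewrite in_itv /= andbT.
split=> //.
have IF : L1 (leb R n) (fun x => K * (w x * normc (h x) ^+ 2)) by exact: L1Z.
have F0 x : 0 <= K * (w x * normc (h x) ^+ 2).
  by rewrite mulr_ge0 ?(ltW K0)// mulr_ge0// exprn_ge0// normc_ge0.
apply: (le_trans (chebyshev_cube mA IF F0 _)).
  move=> x [/Kw wx /= hx]; rewrite mulrA -[leLHS]mulr1 ler_pM//.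
  by rewrite exprn_ege1// ltW.
by rewrite lee_fin RintegralZl// ler_pM2l.
Qed.

(** The evolution of an earlier [g l] is bounded everywhere by the L^1 norm of [g l]. The lower
    bound of block [i] contains the sum of these norms, so [i.+1] survives the triangle
    inequality. *)
Lemma partial_low (s kappa : R) (eps : nat -> R) (f g : nat -> E -> C) (T : nat -> seq R) :
  (forall i, block s kappa (eps i)
    (i.+1%:R + \sum_(l < i) \int[leb R n]_x normc (g l x)) (f i) (g i) (T i)) ->
  forall i x, cube kappa x -> exists2 t, t \in T i &
    i.+1%:R <= normc (schrodinger_on setT (fun xi => \sum_(l < i.+1) g l xi) x t).
Proof.
move=> blk i x xK; have [t tT low] := block_low (blk i) xK; exists t => //.
pose ph (xi : E) : R := 2 * pi * dot x xi - 4 * pi ^+ 2 * t * dot xi xi.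
have mph : measurable_fun setT ph.
  by apply: measurable_funB; apply: measurable_funM => //; exact: measurable_dot.
have Ig l : cL1 (leb R n) (fun xi => g l xi * cexpi (ph xi)).
  by apply: cL1_cexpi => //; exact: (block_gL1 (blk l)).
have -> : schrodinger_on setT (fun xi => \sum_(l < i.+1) g l xi) x t =
    \sum_(l < i.+1) cint (leb R n) (fun xi => g l xi * cexpi (ph xi)).
  rewrite -cint_sum; last by move=> l; exact: Ig.
  rewrite /schrodinger_on -[LHS]/(cint (leb R n) _); congr cint; apply/funext => xi.
  by rewrite mulr_suml.
rewrite big_ord_recr /=.
set a := \sum_(l < i) _; set b := cint _ _.
have la : normc a <= \sum_(l < i) \int[leb R n]_x normc (g l x).
  apply: (le_trans (normc_sum _ _)); apply: ler_sum => l _.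
  apply: (le_trans (normc_cint_le (Ig l))).
  by under eq_Rintegral do rewrite Normc.normcM normc_cexpi mulr1.
have lb : i.+1%:R + \sum_(l < i) \int[leb R n]_x normc (g l x) <= normc b by exact: low.
have := le_normcD (a + b) (- a); rewrite normcN addrAC subrr add0r.
move: la lb; lra.
Qed.

End conclusion.

Unset Implicit Arguments.

Theorem corollary1p1 (R : realType) (n : nat) (s : R)
    (U : (euclid R n -> R[i]) -> euclid R n -> R -> R[i]) :
  (3 <= n)%N -> 0 < s ->
  (forall u0, sobolev s u0 -> schrodinger_solution u0 (U u0)) ->
  (forall u0, sobolev s u0 ->
     {ae leb R n, forall x,
       Normc.normc (U u0 x t - u0 x) @[t --> 0^'] --> (0 : R)}) ->
  1 / 2 - 1 / (n%:R + 2) <= s.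
Proof.
move=> n3 s0 solU convU; rewrite leNgt; apply/negP => slt.
have nR : 3 <= n%:R :> R by rewrite (ler_nat _ 3).
have n2 : 0 < n%:R + 2 :> R by lra.
have sn : (n%:R + 2) * s < n%:R / 2.
  rewrite -ltr_pdivlMl//; apply: (lt_le_trans slt).
  by rewrite le_eqVlt; apply/orP; left; apply/eqP; field; rewrite gt_eqF.
have s1 : s <= 1.
  apply: ltW; apply: (lt_trans slt).
  have : 0 < 1 / (n%:R + 2) :> R by rewrite divr_gt0.
  lra.
have s01 : 0 < s <= 1 by rewrite s0.
have [kappa k0 [exB [w [K [[mw w01] K0 Kw bes]]]]] := block_exists (ltn_trans (isT : (0 < 2)%N) n3) s01 sn.
(* The bad sets of level [j] have total measure at most [4 * K ^+ 2 * e0 / 2 ^+ j], hence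
   [8 * K ^+ 2 * e0] over all levels; the constant 16 makes this half the measure of the cube. *)
have [e0 e00 e0E] : exists2 e0 : R, 0 < e0 & 16 * K ^+ 2 * e0 = (2 * kappa) ^+ n.
  have K20 : 0 < 16 * K ^+ 2 by rewrite mulr_gt0// exprn_gt0.
  exists ((2 * kappa) ^+ n / (16 * K ^+ 2)); last by rewrite mulrC divfK ?gt_eqF.
  by rewrite divr_gt0// exprn_gt0// mulr_gt0.
have [f [g [T [eps [blk eps4 epsT]]]]] := block_sequence e00 exB.
have [u0 [G [FG sG Guniq Gj]]] := superposition (ltW s0) e00 blk eps4 epsT.
have su0 : sobolev s u0 by exists G.
have [g' Fg' [sol _]] := solU _ su0.
have [_ [mG G2] _] := FG; have [_ [mg' g2] _] := Fg'.
pose P j (xi : euclid R n) := \sum_(l < j.+1) g l xi.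
have IP j : cL1 (leb R n) (P j) by apply: cL1_sum => l; exact: block_gL1 (blk l).
pose c j : R := e0 / 2 ^+ j / (1 + (size (T j))%:R).
have c0 j : 0 < c j by rewrite /c !divr_gt0 ?exprn_gt0// ltr_pwDl.
pose V j t x := schrodinger_on setT (P j) x t.
pose A j t := cube kappa `&` [set x | 1 < Normc.normc (U u0 x t - V j t x)].
(* [L2_limit_close] contributes a factor 2, [evol_approx] a factor [2 * K] and Chebyshev a factor
   [K]. The bound holds at each fixed time, whichever version of the solution [U u0] is. *)
have hA j t : measurable (A j t) /\ (leb R n (A j t) <= (4 * K ^+ 2 * c j)%:E)%E.
  have [IGj Gjc] := Gj j.
  have [IP2 gP] := L2_limit_close mG mg' (cL1_cmeas (IP j)) G2 g2 (Guniq _ Fg') IGj Gjc.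
  have [[mU _] cU] := sol t.
  have [mV [IV Vb]] := evol_approx mw w01 K0 bes mg' (sqL2norm_L1 mg' g2) (IP j) IP2 mU cU.
  have Vd : 2 * K * \int[leb R n]_x Normc.normc (g' x - P j x) ^+ 2 <= 2 * K * (2 * c j).
    by rewrite ler_pM2l// mulr_gt0.
  have w0 x : 0 <= w x by have /andP[] := w01 x.
  have := bad_set_bound K0 k0 w0 Kw (cmeasB mU mV) IV (le_trans Vb Vd).
  by rewrite (_ : 4 * K ^+ 2 * c j = K * (2 * K * (2 * c j)))//; ring.
(* The union over [T j] multiplies the bound by its size, which the denominator in [c j] absorbs. *)
have /choice[B hB] j : exists B : set (euclid R n),
    [/\ measurable B, (leb R n B <= (4 * K ^+ 2 * e0 / 2 ^+ j)%:E)%E &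
    forall t, t \in T j -> A j t `<=` B].
  have cc0 : 0 <= 4 * K ^+ 2 * c j.
    by rewrite mulr_ge0 ?(ltW (c0 j))// mulr_ge0// exprn_ge0// ltW.
  have [B [mB Bc AB]] :=
    measure_seq_union (T j) cc0 (fun t => (hA j t).1) (fun t => (hA j t).2).
  exists B; split=> //.
    apply: (le_trans Bc); rewrite lee_fin /c.
    have S0 : 0 < 1 + (size (T j))%:R :> R by rewrite ltr_pwDl.
    have H0 : 0 < 4 * K ^+ 2 * e0 / 2 ^+ j.
      by rewrite divr_gt0 ?exprn_gt0// !mulr_gt0// exprn_gt0.
    rewrite (_ : _ * _ = 4 * K ^+ 2 * e0 / 2 ^+ j * ((size (T j))%:R / (1 + (size (T j))%:R))).
      rewrite ler_piMr ?(ltW H0)// ler_pdivrMr// mul1r; lra.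
    by field; rewrite !gt_eqF// exprn_gt0.
  move=> t tT; have := AB (index t (T j)); rewrite index_mem => /(_ tT 0).
  by rewrite nth_index.
have hc : 0 <= 4 * K ^+ 2 * e0 by rewrite !mulr_ge0 ?exprn_ge0// ltW.
have hck : 2 * (4 * K ^+ 2 * e0) < (2 * kappa) ^+ n.
  have : 0 < K ^+ 2 * e0 by rewrite mulr_gt0// exprn_gt0.
  by rewrite -e0E; lra.
have [x [xK xN xB]] := cube_avoid k0 hc hck (convU _ su0)
  (fun j => let: And3 b1 b2 _ := hB j in conj b1 b2).
have {}xN : Normc.normc (U u0 x t - u0 x) @[t --> 0^'] --> (0 : R).
  by apply: contrapT => ?; exact: xN.
have [d d0 hd] : exists2 d : R, 0 < d & forall t, 0 < t < d ->
    Normc.normc (U u0 x t - u0 x) < 1.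
  move/cvgrPdist_lt : xN => /(_ 1 ltr01) [d /= d0 hd]; exists d => // t /andP[t0 td].
  have := hd t; rewrite /= sub0r normrN gtr0_norm// => /(_ td).
  rewrite sub0r normrN ger0_norm ?normc_ge0//; apply.
  by rewrite gt_eqF.
(* At level [j] the times are below [d], so the solution is within 1 of [u0 x] there. Off the bad
   set [V j] is within 1 of the solution, yet at one of these times it is at least [j.+1], more than
   [|u0 x| + 2]. *)
pose j := (Num.bound (Normc.normc (u0 x)) + Num.bound (e0 / d)).+2.
have jx : Normc.normc (u0 x) + 2 < j.+1%:R.
  rewrite /j; move: (archi_boundP (normc_ge0 (u0 x))).
  move: (Num.bound _) (Num.bound (e0 / d)) => a b ha.
  by rewrite -[_.+3]addn3 !natrD; move: (ler0n R b) ha; lra.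
have jd : e0 / 4 ^+ j < d.
  rewrite ltr_pdivrMr ?exprn_gt0// mulrC -ltr_pdivrMr//.
  apply: lt_le_trans (archi_boundP (divr_ge0 (ltW e00) (ltW d0))) _.
  rewrite -natrX ler_nat; apply: leq_trans (ltnW (ltn_expl j (isT : (1 < 4)%N))).
  by rewrite /j !leqW// leq_addl.
have [t tT low] := partial_low blk j xK.
have /andP[t0 te] := block_times (blk j) tT.
have /andP[_ ej] := eps4 j.
have td : 0 < t < d by rewrite t0 (le_lt_trans (le_trans te ej)).
have xA : Normc.normc (U u0 x t - V j t x) <= 1.
  rewrite leNgt; apply/negP => h; apply: (xB j); have [_ _ AB] := hB j.
  by apply: (AB t tT); split.
have h1 := hd t td.
have h2 : Normc.normc (V j t x) <= Normc.normc (V j t x - U u0 x t) +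
    (Normc.normc (U u0 x t - u0 x) + Normc.normc (u0 x)).
  apply: (@le_trans _ _ (Normc.normc (V j t x - U u0 x t) + Normc.normc (U u0 x t))).
    by apply: le_trans (le_normcD _ _); rewrite subrK.
  rewrite lerD2l; apply: le_trans (le_normcD _ _); by rewrite subrK.
have h3 : j.+1%:R <= Normc.normc (V j t x) by exact: low.
move: h2; rewrite normcBC => h2.
move: xA h1 h2 h3 jx; lra.
Qed.
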